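(* Let $b>0$, $\eta>0$ and $\Delta\ge3$. Suppose $G=(V,E)$ is an $n$-vertex graph of maximum degree $\Delta$. Let $\mu$ be the distribution of a totally-connected monotone spin system on $G$. If $\mu$ is $\eta$-spectrally independent and $b$-marginally bounded, then there exists a universal constant $C>0$ such that for any ordering $\phi$ of $V$, the symmetrized systematic scan dynamics $P_\phi$ satisfies $$T_{mix}(P_\phi)=\Delta^{9+4\lceil\frac{2\eta}{b}\rceil}\cdot\left(\frac{C(\eta+1)^5}{b^6}\right)^{2+\lceil\frac{2\eta}{b}\rceil}\cdot O(\log n),$$ meaning an upper bound in which $C$ and the constant implied by $O(\log n)$ do not depend on $n,\Delta,\eta,b,G,\phi$ (the number of spins $q$ being fixed).
   Context: Spin systems: $G=(V,E)$ is a finite graph, $\mathcal S=\{1,\dots,q\}$. A spin system is given by a symmetric $K:\mathcal S\times\mathcal S\to\mathbb R\cup\{-\infty\}$ and $U:\mathcal S\to\mathbb R$, possibly together with a boundary condition: $G$ may be an induced subgraph of a larger graph, and $\tau:(\partial V)_\tau\to\mathcal S$ is an assignment of spins to a (possibly empty) subset $(\partial V)_\tau$ of the vertices outside $V$ adjacent to $V$. The Hamiltonian is $H(\sigma)=-\sum_{\{u,v\}\in E}K(\sigma_u,\sigma_v)-\sum_{\{u,v\}:u\in V,v\in(\partial V)_\tau}K(\sigma_u,\tau_v)-\sum_{v\in V}U(\sigma_v)$ (the second sum over edges of the larger graph), and the Gibbs distribution is $\mu(\sigma)=e^{-H(\sigma)}/Z$, with $e^{-\infty}=0$ and $Z>0$.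 $\Omega\subseteq\mathcal S^V$ denotes its support. Pinnings: for $\Lambda\subseteq V$, $\Omega_\Lambda=\{\tau\in\mathcal S^\Lambda:\mu(\sigma_\Lambda=\tau)>0\}$; for $\tau\in\Omega_\Lambda$ and $W\subseteq V\setminus\Lambda$, $\Omega_W^\tau=\{\xi\in\mathcal S^W:\mu(\sigma_W=\xi\mid\sigma_\Lambda=\tau)>0\}$; $\Omega^\tau_u=\Omega^\tau_{\{u\}}$; $\mathcal P^\tau=\{(u,s):u\in V\setminus\Lambda,s\in\Omega_u^\tau\}$. Totally-connected: for every $\Lambda\subseteq V$ and $\tau\in\Omega_\Lambda$, the graph on $\Omega^\tau_{V\setminus\Lambda}$ whose edges join configurations differing at exactly one vertex is connected. Monotone: there is a linear ordering of the spins at each vertex, inducing the coordinatewise partial order $\preceq_q$ on configurations, and for every $\Lambda\subseteq V$ and every pair of feasible pinnings $\tau_1\succeq_q\tau_2$ on $V\setminus\Lambda$, $\mu(\cdot\mid\sigma_{V\setminus\Lambda}=\tau_1)$ stochastically dominates $\mu(\cdot\mid\sigma_{V\setminus\Lambda}=\tau_2)$. $\eta$-spectrally independent: for every $\Lambda\subseteq V$ (with $V\setminus\Lambda\ne\emptyset$) and $\tau\in\Omega_\Lambda$, the largest eigenvalue of the matrix $\Psi^\tau_\mu\in\mathbb R^{\mathcal P^\tau\times\mathcal P^\tau}$ is at most $\eta$, where $\Psi^\tau_\mu((u,a),(v,b'))=\mu(\sigma_v=b'\mid\sigma_u=a,\sigma_\Lambda=\tau)-\mu(\sigma_v=b'\mid\sigma_\Lambda=\tau)$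 for $u\ne v$ and $0$ if $u=v$. $b$-marginally bounded: for every $\Lambda\subseteq V$, $\tau\in\Omega_\Lambda$ and $(v,s)\in\mathcal P^\tau$, $\mu(\sigma_v=s\mid\sigma_\Lambda=\tau)\ge b$. Systematic scan: for an ordering $\phi=[v_1,\dots,v_n]$ of $V$, let $P_i$ be the transition matrix on $\Omega$ of the heat-bath update at $v_i$ (the spin at $v_i$ is resampled from the conditional distribution of $\mu$ at $v_i$ given the configuration on $V\setminus\{v_i\}$). Then $P_\phi=P_1P_2\cdots P_n\,P_nP_{n-1}\cdots P_1$. Mixing time: $T_{mix}(P)=\min\{t>0:\max_{x\in\Omega}\|P^t(x,\cdot)-\mu\|_{TV}\le1/4\}$. *)

(* Defs.v *)
From HB Require Import structures.
From mathcomp Require Import all_boot all_order all_algebra.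
From mathcomp Require Import all_classical all_reals all_analysis.

Set Implicit Arguments.
Unset Strict Implicit.
Unset Printing Implicit Defensive.

Import Order.TTheory GRing.Theory Num.Theory.

Local Open Scope ring_scope.

(* Finite simple graphs. *)
Record sgraph := SGraph {
  svertex :> finType;
  sedge : rel svertex;
  sedge_sym : symmetric sedge;
  sedge_irrefl : irreflexive sedge }.

Definition max_degree (G : sgraph) : nat :=
  (\max_(v : G) #|[set w : G | sedge v w]|)%N.

(* A boundary condition: G is the subgraph of [bc_ext] induced by the image of
   [bc_emb], and [bc_spin] is an assignment of spins to the set [bc_dom] of
   vertices outside G adjacent to G.  The absence of a boundary condition is
   the case where [bc_dom] is empty. *)
Record boundary (G : sgraph) (q : nat) := Boundary {
  bc_ext : sgraph;
  bc_emb : G -> bc_ext;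
  bc_emb_inj : injective bc_emb;
  bc_induced : forall u v : G, sedge (bc_emb u) (bc_emb v) = sedge u v;
  bc_dom : {set bc_ext};
  bc_dom_outside : forall w, w \in bc_dom -> w \notin codom bc_emb;
  bc_dom_adj : forall w, w \in bc_dom -> exists v : G, sedge (bc_emb v) w;
  bc_spin : {w : bc_ext | w \in bc_dom} -> 'I_q }.

Record spin_system (R : realType) (q : nat) (G : sgraph) := SpinSystem {
  ss_K : 'I_q -> 'I_q -> \bar R;
  ss_K_sym : forall s t, ss_K s t = ss_K t s;
  ss_K_lty : forall s t, (ss_K s t < +oo)%E;
  ss_U : 'I_q -> R;
  ss_bc : boundary G q }.

Section Gibbs.
Variables (R : realType) (q : nat) (G : sgraph) (X : spin_system R q G).

(* The condition on [enum_rank] selects each unordered edge exactly once. *)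
Definition hamiltonian (s : {ffun G -> 'I_q}) : \bar R :=
  (- (\sum_(u : G) \sum_(v : G | sedge u v && (enum_rank u < enum_rank v)%N)
        ss_K X (s u) (s v))
   - (\sum_(u : G)
        \sum_(w : {w : bc_ext (ss_bc X) | w \in bc_dom (ss_bc X)}
               | sedge (bc_emb (ss_bc X) u) (val w))
        ss_K X (s u) (bc_spin w))
   - (\sum_(v : G) (ss_U X (s v))%:E))%E.

(* [expeR -oo = 0], and [hamiltonian s] is never [-oo]. *)
Definition weight (s : {ffun G -> 'I_q}) : R := fine (expeR (- hamiltonian s)%E).

Definition partition_function : R := \sum_s weight s.

Definition gibbs (s : {ffun G -> 'I_q}) : R := weight s / partition_function.

End Gibbs.

(* Below, a pinning on L : {set V} is represented by a full configuration t, of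
   which only the restriction to L is used. *)
Section Distributions.
Variables (R : realType) (q : nat) (V : finType).
Local Notation config := {ffun V -> 'I_q}.
Variable mu : config -> R.

Definition prob (A : {set config}) : R := \sum_(s in A) mu s.

Definition cprob (A B : {set config}) : R := prob (A :&: B) / prob B.

Definition feasible_configs : {set config} := [set s | 0 < mu s].

Definition pinned (L : {set V}) (t : config) : {set config} :=
  [set s : config | [forall v in L, s v == t v]].

Definition has_spin (v : V) (a : 'I_q) : {set config} :=
  [set s : config | s v == a].

Definition feasible (L : {set V}) (t : config) : Prop := 0 < prob (pinned L t).

(* The feasible pairs (u, a) given the pinning t on L. *)
Definition feasible_pairs (L : {set V}) (t : config) : {set V * 'I_q} :=
  [set p | (p.1 \notin L) && (0 < cprob (has_spin p.1 p.2) (pinned L t))].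

Definition one_flip (s s' : config) : bool := #|[set v | s v != s' v]| == 1%N.

(* The feasible configurations on the complement of L given t are represented
   by their extensions by t on L. *)
Definition totally_connected : Prop :=
  forall (L : {set V}) (t : config), feasible L t ->
  let Om := feasible_configs :&: pinned L t in
  {in Om &, forall s s',
     connect (fun x y => [&& x \in Om, y \in Om & one_flip x y]) s s'}.

Definition config_le (le : V -> rel 'I_q) (s s' : config) : Prop :=
  forall v, le v (s v) (s' v).

Definition stoch_dominates (le : V -> rel 'I_q) (nu1 nu2 : config -> R) : Prop :=
  forall f : config -> R,
    (forall s s', config_le le s s' -> f s <= f s') ->
    \sum_s nu2 s * f s <= \sum_s nu1 s * f s.

Definition conditioned (B : {set config}) (s : config) : R := cprob [set s] B.

Definition linear_order (le : rel 'I_q) : Prop :=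
  [/\ reflexive le, antisymmetric le, transitive le & total le].

Definition monotone_system : Prop :=
  exists2 le : V -> rel 'I_q, (forall v, linear_order (le v)) &
  forall (L : {set V}) (t1 t2 : config),
    feasible (~: L) t1 -> feasible (~: L) t2 ->
    (forall v, v \in ~: L -> le v (t2 v) (t1 v)) ->
    stoch_dominates le (conditioned (pinned (~: L) t1))
                       (conditioned (pinned (~: L) t2)).

Definition influence (L : {set V}) (t : config) :
    'M[R]_#|feasible_pairs L t| :=
  \matrix_(i, j)
    let p := enum_val i in let r := enum_val j in
    if p.1 == r.1 then 0
    else cprob (has_spin r.1 r.2) (has_spin p.1 p.2 :&: pinned L t)
         - cprob (has_spin r.1 r.2) (pinned L t).

(* The influence matrix is self-adjoint for the inner product weighted by the
   conditional marginals, so all its eigenvalues lie in R. *)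
Definition spectrally_independent (eta : R) : Prop :=
  forall (L : {set V}) (t : config), L != [set: V] -> feasible L t ->
  forall x : R, eigenvalue (influence L t) x -> x <= eta.

Definition marginally_bounded (b : R) : Prop :=
  forall (L : {set V}) (t : config), feasible L t ->
  forall p, p \in feasible_pairs L t ->
  b <= cprob (has_spin p.1 p.2) (pinned L t).

(* Heat-bath update at v, as a matrix indexed by the support of mu. *)
Definition heat_bath (v : V) : 'M[R]_#|feasible_configs| :=
  \matrix_(i, j)
    let x : config := enum_val i in let y : config := enum_val j in
    if y \in pinned (~: [set v]) x
    then cprob (has_spin v (y v)) (pinned (~: [set v]) x) else 0.

Definition sym_scan (phi : seq V) : 'M[R]_#|feasible_configs| :=
  (\prod_(v <- phi) heat_bath v) * (\prod_(v <- rev phi) heat_bath v).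

Definition tv_to_mu (P : 'M[R]_#|feasible_configs|) (i : 'I_#|feasible_configs|) : R :=
  2^-1 * \sum_j `|P i j - mu (enum_val j)|.

(* The value is +oo if the chain never gets within distance 1/4 of mu. *)
Definition mixing_time (P : 'M[R]_#|feasible_configs|) : \bar R :=
  ereal_inf [set (t%:R)%:E | t in
    [set t : nat | (0 < t)%N /\
       \big[Num.max/0]_(i < #|feasible_configs|) tv_to_mu (P ^+ t) i <= 4^-1]]%classic.

End Distributions.

(* Main.v *)
Require Import Defs.
From HB Require Import structures.
From mathcomp Require Import all_boot all_order all_algebra.
From mathcomp Require Import all_classical all_reals all_analysis.
From mathcomp Require Import ring lra.
Set Implicit Arguments.
Unset Strict Implicit.
Unset Printing Implicit Defensive.
Import Order.TTheory GRing.Theory Num.Theory.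
Import numFieldNormedType.Exports.
Import fintype mathcomp.boot.finset.
Local Open Scope ring_scope.

(** Let [E_B] be the heat-bath update of a block [B] of vertices.  It is a
    conditional expectation, and [Phi f - Phi (E_B f)], with [Phi f] the mean of
    [f ln f], is the average entropy that [f] keeps inside [B].

    Monotonicity reduces the scan to a simpler chain.  A heat-bath update of one
    site is self-adjoint, preserves increasing functions, and by Chebyshev's
    inequality on its linearly ordered fibres it can only decrease
    [mean (f * g)] for increasing [f] and [g].  Hence deleting updates from the
    symmetrized scan only slows it down, in the sense of this bilinear form
    ([mean_scan_filter]).  So the means of increasing functions approach their
    limits, from the extreme starting configurations, at least as fast as for the
    chain that picks a random set [S] of vertices and updates the isolated
    vertices of [S] simultaneously ([mean_iter_le]).  The extreme configurations
    exist because the support is connected by single flips ([exists_top]), and they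
    control all others: a test function of oscillation at most one becomes
    increasing when the height is added to it ([convergence_bound]).  Everything costs only a polynomial
    factor in the number [n] of vertices, hence a logarithmic number of steps once
    the comparison chain contracts entropy at a rate independent of [n].

    That contraction comes from spectral independence.  Given any pinning, the
    covariances of single-site functions are controlled by the largest eigenvalue
    of the influence matrix ([sum_cov_le], through [quadratic_form_le]), and lower
    bounds on the marginals turn variances into entropies.  So the entropy gained
    by revealing one more spin decreases slowly as spins are revealed
    ([Phi_local_ge]), and the last spins to be revealed, a random set [S] of
    density [t], carry a fraction [t ^+ (k + 1)] of the whole entropy, where
    [2 * eta / b <= k] ([random_block_ge]).  When [t] is a small multiple of
    [b ^+ 4 / Delta ^+ 2], the components of [S] are small.  Inside a component [C]
    total connectivity gives a factorization into single sites with a constant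
    exponential in [#|C|] ([Phi_block_le]).  Replacing the component of [v] by
    [v] alone turns a set [S] into one where [v] is isolated, and
    multiplies its probability by about [t ^- (#|C| - 1)]; as there are few
    connected sets that contain [v], the entropy in [S] is at most a constant
    times the entropy in the isolated vertices of [S] ([isolated_block_le]). *)

(** * Scalar inequalities for the entropy function *)

Section ScalarInequalities.
Variable R : realType.
Implicit Types x y a b c : R.

Lemma ln_le_sub1 x : 0 < x -> ln x <= x - 1.
Proof.
move=> x0; have := @le_ln1Dx R (x - 1).
by rewrite addrCA subrr addr0; apply; lra.
Qed.

Lemma xlnx_ge x y : 0 <= x -> 0 <= y -> (0 < x -> 0 < y) ->
  x - y <= x * ln x - x * ln y.
Proof.
rewrite le_eqVlt => /predU1P[<- y0 _|x0 _ /(_ x0) y0].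
  by rewrite !mul0r; lra.
have := ln_le_sub1 (divr_gt0 y0 x0); rewrite ln_div ?posrE//.
move=> /(ler_wpM2l (ltW x0)); rewrite !mulrBr mulr1 mulrCA divff ?gt_eqF// mulr1.
lra.
Qed.

(** The case [y = a * b / c] of [xlnx_ge], in the shape in which the entropies of
    four nested conditional expectations meet. *)
Lemma xlnx_ge_ratio x a b c : 0 <= x -> 0 <= a -> 0 <= b -> 0 <= c ->
  (0 < x -> [/\ 0 < a, 0 < b & 0 < c]) ->
  x - a * b / c <= x * ln x - x * ln a - x * ln b + x * ln c.
Proof.
move=> x0 a0 b0 c0 H.
have y0 : 0 <= a * b / c by rewrite divr_ge0 ?mulr_ge0.
have [x1|x1] := ltP 0 x; last first.
  by have -> : x = 0 by [lra]; rewrite !mul0r; lra.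
have [a1 b1 c1] := H x1.
have y1 : 0 < a * b / c by rewrite divr_gt0 ?mulr_gt0.
apply: le_trans (xlnx_ge x0 y0 (fun=> y1)) _.
rewrite ln_div ?posrE ?mulr_gt0// lnM ?posrE//; lra.
Qed.

(** Since [ln t = 2 ln (sqrt t)], the inequality [ln t <= t - 1] may be applied to
    [sqrt (y / x)]. *)
Lemma sqr_sqrtB_le_xlnx x y : 0 <= x -> 0 <= y -> (0 < x -> 0 < y) ->
  (Num.sqrt x - Num.sqrt y) ^+ 2 <= x * ln x - x * ln y - x + y.
Proof.
move=> x0 y0 H; rewrite sqrrB !sqr_sqrtr//.
have [x1|x1] := ltP 0 x; last first.
  by have -> : x = 0 by [lra]; rewrite sqrtr0 !mul0r; lra.
have {H} y1 := H x1.
have sx : 0 < Num.sqrt x by rewrite sqrtr_gt0.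
have sy : 0 < Num.sqrt y by rewrite sqrtr_gt0.
have := xlnx_ge (ltW sx) (ltW sy) (fun=> sy).
move=> /(ler_wpM2l (ltW sx)).
have lnsqr (z : R) : 0 < Num.sqrt z -> ln z = ln (Num.sqrt z) + ln (Num.sqrt z).
  move=> z0; rewrite -lnM ?posrE// -expr2 sqr_sqrtr//.
  by rewrite ltW// -sqrtr_gt0.
rewrite (lnsqr x sx) (lnsqr y sy).
move: (sqr_sqrtr x0) sx sy; set u := Num.sqrt x; set v := Num.sqrt y.
by move=> <- _ _; lra.
Qed.

Lemma xlnx_le_chi2 x y : 0 <= x -> 0 < y ->
  x * ln x - x * ln y - x + y <= (x - y) ^+ 2 / y.
Proof.
move=> x0 y0; have -> : (x - y) ^+ 2 / y = x ^+ 2 / y - 2 * x + y.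
  by field; rewrite gt_eqF.
have [x1|x1] := ltP 0 x; last first.
  by have -> : x = 0 by [lra]; rewrite !mul0r expr0n/= !mul0r; lra.
have := ln_le_sub1 (divr_gt0 x1 y0); rewrite ln_div ?posrE//.
by move=> /(ler_wpM2l x0); rewrite !mulrBr mulr1 mulrA -expr2; lra.
Qed.

(** The mean value theorem on [[0, x]]. *)
Lemma ge0_of_derive (f df : R -> R) x : (forall y, is_derive y 1 f (df y)) ->
  (forall y, 0 <= y -> 0 <= df y) -> f 0 = 0 -> 0 <= x -> 0 <= f x.
Proof.
move=> fd df0 f0 x0; rewrite -[leLHS]f0.
have cf : ({within `[0, x], continuous f})%classic.
  apply: continuous_subspaceT => y; apply: differentiable_continuous.
  by apply/derivable1_diffP; case: (fd y).
have [c] := MVT_segment x0 (fun y _ => fd y) cf.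
rewrite in_itv/= => /andP[c0 _] /eqP; rewrite subr_eq => /eqP ->.
by rewrite f0 subr0 addr0 mulr_ge0 ?df0.
Qed.

Lemma ge_twice_expRB x : 0 <= x -> 2 * x <= expR x - expR (- x).
Proof.
rewrite -[_ <= _ - _]subr_ge0.
apply: (@ge0_of_derive (fun x => expR x - expR (- x) - 2 * x)
  (fun x => expR x + expR (- x) - 2)) => [y|y y0|].
- apply: is_derive_eq; rewrite /GRing.scale/=; ring.
- have : 1 <= expR y by rewrite -expR0 ler_expR.
  rewrite expRN -[_ + _ - _]/(_) => e1.
  have -> : expR y + (expR y)^-1 - 2 = (expR y - 1) ^+ 2 / expR y.
    by field; rewrite gt_eqF ?expR_gt0.
  by rewrite divr_ge0 ?sqr_ge0 ?expR_ge0.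
- by rewrite oppr0 expR0; ring.
Qed.

Lemma le_twice_expRN x : 0 <= x ->
  3 - 4 * expR (- x) + expR (- x) ^+ 2 <= 2 * x.
Proof.
rewrite -[_ <= _ * _]subr_ge0.
apply: (@ge0_of_derive
  (fun x => 2 * x - (3 - 4 * expR (- x) + expR (- x) ^+ 2))
  (fun x => 2 * (1 - expR (- x)) ^+ 2)) => [y|y y0|].
- apply: is_derive_eq; rewrite /GRing.scale/=; ring.
- by rewrite mulr_ge0 ?sqr_ge0.
- by rewrite oppr0 expR0; ring.
Qed.

(** Both cases are a comparison with the exponential: with [x = y * exp z], the
    claim becomes [2 z <= exp z - exp (- z)] or [3 - 4 exp (- z) + exp (- 2 z)
    <= 2 z]. *)
Lemma sqrB_le_max_xlnx x y : 0 <= x -> 0 < y ->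
  (x - y) ^+ 2 <= 2 * Num.max x y * (x * ln x - x * ln y - x + y).
Proof.
move=> x0 y0; have [xp|xp] := ltP 0 x; last first.
  have -> : x = 0 by [lra].
  by rewrite max_r 1?ltW// !mul0r !sub0r sqrrN; have := sqr_ge0 y; nra.
have -> : x * ln x - x * ln y = x * ln (x / y) by rewrite ln_div ?posrE//; ring.
set z := ln (x / y); have ez : x = y * expR z.
  by rewrite lnK ?posrE ?divr_gt0// mulrCA divff ?mulr1// gt_eqF.
have yy : 0 < y ^+ 2 by rewrite exprn_gt0.
have [z0|z0] := leP 0 z.
  rewrite max_l; last first.
    by rewrite ez ler_pMr// -expR0 ler_expR.
  rewrite ez; have e0 := expR_gt0 z.
  have -> : (y * expR z - y) ^+ 2 = y ^+ 2 * expR z ^+ 2 * (1 - expR (- z)) ^+ 2.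
    by rewrite expRN; field; rewrite gt_eqF.
  have -> : 2 * (y * expR z) * (y * expR z * z - y * expR z + y) =
      y ^+ 2 * expR z ^+ 2 * (2 * (z - 1 + expR (- z))).
    by rewrite expRN; field; rewrite gt_eqF.
  rewrite ler_pM2l ?mulr_gt0 ?exprn_gt0//.
  by have := le_twice_expRN z0; rewrite sqrrB; lra.
rewrite max_r; last first.
  by rewrite ez ger_pMr// -expR0 ler_expR ltW.
rewrite ez; have e0 := expR_gt0 z.
have -> : (y * expR z - y) ^+ 2 =
    y ^+ 2 * expR z * (expR z - 2 + expR (- z)).
  by rewrite expRN; field; rewrite gt_eqF.
have -> : 2 * y * (y * expR z * z - y * expR z + y) =
    y ^+ 2 * expR z * (2 * (z - 1 + expR (- z))).
  by rewrite expRN; field; rewrite gt_eqF.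
rewrite ler_pM2l ?mulr_gt0 ?exprn_gt0//.
have := @ge_twice_expRB (- z); rewrite opprK oppr_ge0 => /(_ (ltW z0)); lra.
Qed.

End ScalarInequalities.

(** * Conditional expectations given the spins on a set *)

Section Pinned.
Variables (q : nat) (V : finType).
Implicit Types (s x y : {ffun V -> 'I_q}) (L : {set V}).

Lemma pinnedP L s x :
  reflect (forall v, v \in L -> x v = s v) (x \in pinned L s).
Proof.
rewrite inE; apply: (iffP forall_inP) => H v vL; first exact/eqP/H.
by rewrite H.
Qed.

Lemma pinned_refl L s : s \in pinned L s.
Proof. exact/pinnedP. Qed.

Lemma pinned_sym L s x : (x \in pinned L s) = (s \in pinned L x).
Proof. by apply/pinnedP/pinnedP => H v vL; rewrite H. Qed.

Lemma pinned_eq L s x : x \in pinned L s -> pinned L x = pinned L s.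
Proof.
move=> /pinnedP xs; apply/setP => y.
by apply/pinnedP/pinnedP => H v vL; rewrite H ?xs.
Qed.

Lemma pinned_sub L L' s : L \subset L' -> pinned L' s \subset pinned L s.
Proof.
move=> LL'; apply/subsetP => x /pinnedP H; apply/pinnedP => v vL.
by rewrite H// (subsetP LL').
Qed.

Lemma pinned_subP L L' s x : L \subset L' -> x \in pinned L' s ->
  x \in pinned L s.
Proof. by move=> LL'; exact: (subsetP (pinned_sub s LL')). Qed.

Lemma pinned0 s : pinned set0 s = [set: _].
Proof. by apply/setP => x; rewrite in_setT; apply/pinnedP => v; rewrite in_set0. Qed.

Lemma pinnedU L L' s : pinned (L :|: L') s = pinned L s :&: pinned L' s.
Proof.
apply/setP => x; rewrite in_setI; apply/pinnedP/andP => [H|[/pinnedP H /pinnedP H'] v].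
  by split; apply/pinnedP => v vL; apply: H; rewrite inE vL ?orbT.
by rewrite inE => /orP[/H|/H'].
Qed.

Lemma in_has_spin v (a : 'I_q) x : (x \in has_spin v a) = (x v == a).
Proof. by rewrite inE. Qed.

Lemma pinned1 v s : pinned [set v] s = has_spin v (s v).
Proof.
apply/setP => x; rewrite [RHS]inE; apply/pinnedP/eqP => [->//|e w].
  by rewrite inE.
by rewrite inE => /eqP ->.
Qed.

Lemma pinned_setT s : pinned [set: V] s = [set s].
Proof.
apply/setP => x; rewrite in_set1; apply/pinnedP/eqP => [H|->//].
by apply/ffunP => v; rewrite H.
Qed.

End Pinned.

Section CondExp.
Variables (R : realType) (q : nat) (V : finType).
Local Notation config := {ffun V -> 'I_q}.
Variable mu : config -> R.
Hypothesis mu_ge0 : forall s, 0 <= mu s.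
Implicit Types (f g h k : config -> R) (s t x y : config) (A B L : {set V}).

Definition mean f := \sum_s mu s * f s.

(** The conditional expectation of [f] given the spins on [L]; the heat-bath
    update of a block [B] is [condE (~: B)]. *)
Definition condE L f s :=
  (\sum_(x in pinned L s) mu x * f x) / prob mu (pinned L s).

(** Measurability with respect to the spins on [L]. *)
Definition depends_on L k := forall s x, x \in pinned L s -> k x = k s.

Lemma mu_gt0P s : mu s = 0 \/ 0 < mu s.
Proof. by have := mu_ge0 s; rewrite le_eqVlt => /predU1P[|]; [left|right]. Qed.

Lemma prob_ge0 (A : {set config}) : 0 <= prob mu A.
Proof. exact: sumr_ge0. Qed.

Lemma prob_gt0 (A : {set config}) s : s \in A -> 0 < mu s -> 0 < prob mu A.
Proof.
by move=> sA s0; rewrite /prob (bigD1 s)//= ltr_pwDl// sumr_ge0.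
Qed.

Lemma prob_pinned_gt0 L s : 0 < mu s -> 0 < prob mu (pinned L s).
Proof. exact/prob_gt0/pinned_refl. Qed.

Lemma prob_sub (A B : {set config}) : A \subset B -> prob mu A <= prob mu B.
Proof.
move=> AB; rewrite /prob [leRHS](big_setID A)/= (setIidPr AB) lerDl.
exact: sumr_ge0.
Qed.

Lemma eq_mean f g : (forall s, 0 < mu s -> f s = g s) -> mean f = mean g.
Proof.
move=> fg; apply: eq_bigr => s _.
by have [->|/fg->] := mu_gt0P s; rewrite ?mul0r.
Qed.

Lemma le_mean f g : (forall s, 0 < mu s -> f s <= g s) -> mean f <= mean g.
Proof.
move=> fg; apply: ler_sum => s _.
by have [->|s0] := mu_gt0P s; [rewrite !mul0r|rewrite ler_wpM2l// fg].
Qed.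

Lemma mean_ge0 f : (forall s, 0 < mu s -> 0 <= f s) -> 0 <= mean f.
Proof.
move=> f0; rewrite -[leLHS](_ : mean (fun=> 0) = 0); first exact: le_mean.
by rewrite /mean big1// => s _; rewrite mulr0.
Qed.

Lemma meanD f g : mean (fun s => f s + g s) = mean f + mean g.
Proof. by rewrite -big_split; apply: eq_bigr => s _; rewrite mulrDr. Qed.

Lemma meanN f : mean (fun s => - f s) = - mean f.
Proof. by rewrite -sumrN; apply: eq_bigr => s _; rewrite mulrN. Qed.

Lemma meanB f g : mean (fun s => f s - g s) = mean f - mean g.
Proof. by rewrite meanD meanN. Qed.

Lemma meanZ c f : mean (fun s => c * f s) = c * mean f.
Proof. by rewrite mulr_sumr; apply: eq_bigr => s _; rewrite mulrCA. Qed.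

Lemma mean_sum (I : Type) (r : seq I) (P : pred I) (F : I -> config -> R) :
  mean (fun s => \sum_(i <- r | P i) F i s) = \sum_(i <- r | P i) mean (F i).
Proof.
rewrite /mean exchange_big/=; apply: eq_bigr => s _; exact: mulr_sumr.
Qed.

Lemma eq_condE L f g s : (forall x, x \in pinned L s -> 0 < mu x -> f x = g x) ->
  condE L f s = condE L g s.
Proof.
move=> fg; congr (_ / _); apply: eq_bigr => x /fg {}fg.
by have [->|/fg->] := mu_gt0P x; rewrite ?mul0r.
Qed.

Lemma le_condE L f g s : (forall x, x \in pinned L s -> 0 < mu x -> f x <= g x) ->
  condE L f s <= condE L g s.
Proof.
move=> fg; rewrite ler_wpM2r ?invr_ge0 ?prob_ge0//; apply: ler_sum => x /fg {}fg.
by have [->|x0] := mu_gt0P x; [rewrite !mul0r|rewrite ler_wpM2l// fg].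
Qed.

Lemma condE_ge0 L f s : (forall x, 0 < mu x -> 0 <= f x) -> 0 <= condE L f s.
Proof.
move=> f0; rewrite divr_ge0 ?prob_ge0// sumr_ge0// => x _.
by have [->|x0] := mu_gt0P x; [rewrite mul0r|rewrite mulr_ge0// f0].
Qed.

Lemma condE_cst L c s : 0 < mu s -> condE L (fun=> c) s = c.
Proof.
move=> s0; rewrite /condE -mulr_suml mulrAC divff ?mul1r//.
by rewrite gt_eqF// prob_pinned_gt0.
Qed.

Lemma condED L f g s : condE L (fun x => f x + g x) s = condE L f s + condE L g s.
Proof.
rewrite -mulrDl -big_split; congr (_ / _).
by apply: eq_bigr => x _; rewrite mulrDr.
Qed.

Lemma condEN L f s : condE L (fun x => - f x) s = - condE L f s.
Proof.
by rewrite -mulNr -sumrN; congr (_ / _); apply: eq_bigr => x _; rewrite mulrN.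
Qed.

Lemma condEB L f g s : condE L (fun x => f x - g x) s = condE L f s - condE L g s.
Proof. by rewrite condED condEN. Qed.

Lemma condEZ L c f s : condE L (fun x => c * f x) s = c * condE L f s.
Proof.
rewrite mulrA mulr_sumr; congr (_ / _).
by apply: eq_bigr => x _; rewrite mulrCA.
Qed.

Lemma condE_sum L (I : Type) (r : seq I) (P : pred I) (F : I -> config -> R) s :
  condE L (fun x => \sum_(i <- r | P i) F i x) s =
  \sum_(i <- r | P i) condE L (F i) s.
Proof.
rewrite /condE -mulr_suml exchange_big/=; congr (_ / _).
by apply: eq_bigr => x _; rewrite mulr_sumr.
Qed.

Lemma condE_dep L f : depends_on L (condE L f).
Proof. by move=> s x /pinned_eq; rewrite /condE => ->. Qed.

Lemma depends_onW L L' k : L \subset L' -> depends_on L k -> depends_on L' k.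
Proof. by move=> /pinned_subP LL' H s x /LL'/H. Qed.

Lemma condE_depW L L' f : L \subset L' -> depends_on L' (condE L f).
Proof. by move=> /depends_onW; apply; exact: condE_dep. Qed.

Lemma condE_pull L f k s : depends_on L k ->
  condE L (fun x => f x * k x) s = condE L f s * k s.
Proof.
move=> dk; rewrite mulrAC mulr_suml; congr (_ / _).
by apply: eq_bigr => x /dk ->; rewrite mulrA.
Qed.

Lemma condE_id L k s : depends_on L k -> 0 < mu s -> condE L k s = k s.
Proof.
move=> dk s0; rewrite -[RHS]mul1r -(condE_cst L 1 s0) -condE_pull//.
by apply: eq_condE => x _ _; rewrite mul1r.
Qed.

(** Conditional expectations are self-adjoint in [L^2]: their kernel
    [mu x mu y / prob (pinned L x)], supported on pairs that agree on [L], is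
    symmetric. *)
Lemma mean_condE_sym L f g :
  mean (fun s => condE L f s * g s) = mean (fun s => f s * condE L g s).
Proof.
rewrite /mean /condE.
under eq_bigr do rewrite 2!mulrA mulr_sumr 2!mulr_suml.
under [RHS]eq_bigr do rewrite 2!mulrA mulr_sumr mulr_suml.
rewrite [LHS](exchange_big_dep xpredT)//=; apply: eq_bigr => y _.
under eq_bigl do rewrite pinned_sym.
by apply: eq_bigr => x xy; rewrite (pinned_eq xy); ring.
Qed.

Lemma mean_condE_pull L f k : depends_on L k ->
  mean (fun s => condE L f s * k s) = mean (fun s => f s * k s).
Proof.
move=> dk; rewrite mean_condE_sym; apply: eq_mean => s s0.
by rewrite condE_id.
Qed.

Lemma mean_condE L f : mean (condE L f) = mean f.
Proof.
transitivity (mean (fun s => condE L f s * 1)).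
  by apply: eq_mean => s; rewrite mulr1.
by rewrite mean_condE_pull//; apply: eq_mean => s; rewrite mulr1.
Qed.

Lemma condE_mean L f s : condE L f s =
  mean (fun x => f x * (x \in pinned L s)%:R) / prob mu (pinned L s).
Proof.
congr (_ / _); rewrite [LHS]big_mkcond; apply: eq_bigr => x _.
by case: ifP => _; rewrite ?mulr1 ?mulr0.
Qed.

Lemma condE_tower L L' f s : L \subset L' ->
  condE L (condE L' f) s = condE L f s.
Proof.
move=> LL'; rewrite !condE_mean mean_condE_pull// => x y /(pinned_subP LL').
by move=> xy; rewrite pinned_sym [in RHS]pinned_sym (pinned_eq xy).
Qed.

Lemma condE_set0 f s : \sum_x mu x = 1 -> condE set0 f s = mean f.
Proof.
move=> mu1; rewrite /condE pinned0 /prob.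
have sumT (F : config -> R) : \sum_(x in [set: config]) F x = \sum_x F x.
  by apply: eq_bigl => x; rewrite in_setT.
by rewrite !sumT mu1 divr1.
Qed.

Lemma condE_setT f s : 0 < mu s -> condE [set: V] f s = f s.
Proof.
move=> s0; rewrite condE_id// => x y /pinnedP xy.
by congr f; apply/ffunP => v; rewrite xy// inE.
Qed.

Lemma sqr_condE_le L f s : 0 < mu s ->
  condE L f s ^+ 2 <= condE L (fun x => f x ^+ 2) s.
Proof.
move=> s0; set c := condE L f s.
have : 0 <= condE L (fun x => (f x ^+ 2 - 2 * c * f x) + c ^+ 2) s.
  apply: condE_ge0 => // x _.
  have -> : f x ^+ 2 - 2 * c * f x + c ^+ 2 = (f x - c) ^+ 2 by ring.
  exact: sqr_ge0.
by rewrite condED condEB condEZ condE_cst// -/c; lra.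
Qed.

Lemma support_nonempty : \sum_s mu s = 1 -> exists x, 0 < mu x.
Proof.
move=> mu1; apply: contrapT => H; have := mu1; rewrite big1 => [/eqP|s _].
  by rewrite eq_sym oner_eq0.
by have [//|s0] := mu_gt0P s; exfalso; apply: H; exists s.
Qed.

End CondExp.

(** * Entropy of conditional expectations *)

Section Entropy.
Variables (R : realType) (q : nat) (V : finType).
Local Notation config := {ffun V -> 'I_q}.
Variable mu : config -> R.
Hypothesis mu_ge0 : forall s, 0 <= mu s.
Implicit Types (f g h k : config -> R) (s t x y : config) (A B L : {set V}).
Local Notation avg := (mean mu).
Local Notation cE := (condE mu).

(** The entropy of [f] is [Phi f - Phi (fun=> avg f)], and the mean of its
    entropies given the spins on [L] is [Phi f - Phi (cE L f)].  Since
    [ln 0 = 0], zeros of [f] contribute nothing. *)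
Definition Phi f := avg (fun s => f s * ln (f s)).

Lemma eq_Phi f g : (forall s, 0 < mu s -> f s = g s) -> Phi f = Phi g.
Proof. by move=> fg; apply: eq_mean => // s /fg ->. Qed.

Lemma condE_gt0 L f s : (forall x, 0 < mu x -> 0 <= f x) -> 0 < mu s ->
  0 < f s -> 0 < cE L f s.
Proof.
move=> f0 s0 fs; apply: divr_gt0; last exact: prob_pinned_gt0.
apply: (@prob_pinned_gt0 _ _ _ (fun x => mu x * f x)); last exact: mulr_gt0.
by move=> x; have [->|x0] := mu_gt0P mu_ge0 x; [rewrite mul0r|rewrite mulr_ge0// f0].
Qed.

Lemma mean_ln_condE L f : avg (fun s => f s * ln (cE L f s)) = Phi (cE L f).
Proof.
rewrite /Phi mean_condE_pull// => s x /(condE_dep mu f).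
by move=> ->.
Qed.

Lemma mean_ln_condE_sub L L' f : L \subset L' ->
  avg (fun s => cE L' f s * ln (cE L f s)) = Phi (cE L f).
Proof.
move=> LL'; rewrite -[RHS](@eq_Phi (cE L (cE L' f))) => [|s s0].
  rewrite -mean_ln_condE; apply: eq_mean => // s s0.
  by rewrite condE_tower.
by rewrite condE_tower.
Qed.

Lemma Phi_diffE L f : Phi f - Phi (cE L f) =
  avg (fun s => f s * ln (f s) - f s * ln (cE L f s) - f s + cE L f s).
Proof.
by rewrite meanD meanB meanB mean_ln_condE mean_condE// subrK.
Qed.

Lemma Phi_condE_le L f : (forall x, 0 < mu x -> 0 <= f x) ->
  Phi (cE L f) <= Phi f.
Proof.
move=> f0; rewrite -subr_ge0 Phi_diffE; apply: mean_ge0 => // s s0.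
have := @xlnx_ge R (f s) (cE L f s) (f0 s s0) (condE_ge0 mu_ge0 L s f0).
move=> /(_ (condE_gt0 L f0 s0)); lra.
Qed.

(** With [f_i := cE L_i f], the right-hand side is the mean of
    [f_3 ln (f_3 f_0 / (f_1 f_2))]; bounding it below by a mean without logarithm
    leaves a covariance of [f_1] and [f_2]. *)
Lemma Phi_square_ge L0 L1 L2 L3 f : (forall x, 0 < mu x -> 0 <= f x) ->
  L0 \subset L1 -> L0 \subset L2 -> L1 \subset L3 -> L2 \subset L3 ->
  avg f - avg (fun s => cE L1 f s * cE L2 f s / cE L0 f s) <=
  Phi (cE L3 f) - Phi (cE L1 f) - Phi (cE L2 f) + Phi (cE L0 f).
Proof.
move=> f0 L01 L02 L13 L23; have L03 := subset_trans L01 L13.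
rewrite -(mean_condE mu_ge0 L3 f) -meanB.
rewrite -(mean_ln_condE_sub f L13) -(mean_ln_condE_sub f L23).
rewrite -(mean_ln_condE_sub f L03) -!meanB -meanD.
apply: le_mean => // s s0; apply: xlnx_ge_ratio; rewrite ?condE_ge0// => p.
have E0 x : 0 < mu x -> 0 <= cE L3 f x by move=> _; exact: condE_ge0.
by split; [rewrite -(condE_tower mu_ge0 f s L13)|rewrite -(condE_tower mu_ge0 f s L23)
  |rewrite -(condE_tower mu_ge0 f s L03)]; exact: condE_gt0.
Qed.

(** Entropy is submodular along commuting conditional expectations: in that case
    the mean of [f_1 f_2 / f_0] is at most the mean of [f], by self-adjointness. *)
Lemma Phi_submod L0 L1 L2 f : (forall x, 0 < mu x -> 0 <= f x) ->
  L0 \subset L1 -> L0 \subset L2 ->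
  (forall s, 0 < mu s -> cE L2 (cE L1 f) s = cE L0 f s) ->
  Phi (cE L1 f) + Phi (cE L2 f) <= Phi f + Phi (cE L0 f).
Proof.
move=> f0 L01 L02 H.
have := Phi_square_ge f0 L01 L02 (finset.subsetT _) (finset.subsetT _).
rewrite (@eq_Phi (cE [set: V] f) f) => [|s s0]; last by rewrite condE_setT.
suff : avg (fun s => cE L1 f s * cE L2 f s / cE L0 f s) <= avg f by lra.
have -> : avg (fun s => cE L1 f s * cE L2 f s / cE L0 f s) =
    avg (fun s => cE L1 f s * cE L2 (fun x => f x * (cE L0 f x)^-1) s).
  apply: eq_mean => // s s0; rewrite condE_pull ?mulrA// => x y.
  by move=> /(condE_depW mu f L02) ->.
rewrite -mean_condE_sym//; apply: le_mean => // s s0; rewrite H// mulrCA.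
have [->|e] := eqVneq (cE L0 f s) 0; first by rewrite mul0r mulr0 f0.
by rewrite divff// mulr1.
Qed.

(** Each [F i] is compared with the tangent of [x ln x] at the average. *)
Lemma Phi_convex (I : finType) (p : I -> R) (F : I -> config -> R) :
  (forall i, 0 <= p i) -> \sum_i p i = 1 ->
  (forall i x, 0 < mu x -> 0 <= F i x) ->
  Phi (fun s => \sum_i p i * F i s) <= \sum_i p i * Phi (F i).
Proof.
move=> p0 p1 F0; under eq_bigr do rewrite -meanZ.
rewrite -mean_sum; apply: le_mean => // s s0; set X := \sum_i _.
have X0 : 0 <= X by apply: sumr_ge0 => i _; rewrite mulr_ge0 ?F0.
have -> : X * ln X = \sum_i p i * (F i s * ln X + F i s - X).
  under eq_bigr do rewrite mulrBr mulrDr mulrA.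
  by rewrite sumrB big_split/= -!mulr_suml p1 mul1r -/X addrK.
apply: ler_sum => i _; have [->|pi0] := eqVneq (p i) 0; first by rewrite !mul0r.
have pip : 0 < p i by rewrite lt_neqAle eq_sym pi0 p0.
rewrite ler_pM2l//; have := @xlnx_ge R (F i s) X (F0 i s s0) X0.
have XF : 0 < F i s -> 0 < X.
  move=> Fp; rewrite /X (bigD1 i)//= ltr_pwDl ?mulr_gt0// sumr_ge0// => j _.
  by rewrite mulr_ge0 ?F0.
by move=> /(_ XF); lra.
Qed.

(** A linearised Pinsker inequality: for [d = f - 1], the pointwise bound
    [d ^+ 2 <= 2 (1 + f) (f ln f - f + 1)] and the inequality of arithmetic and
    geometric means. *)
Lemma mean_norm_sub1_le f e : \sum_s mu s = 1 -> 0 < e ->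
  (forall x, 0 < mu x -> 0 <= f x) -> avg f = 1 ->
  avg (fun s => `|f s - 1|) <= Phi f / (2 * e) + 2 * e.
Proof.
move=> mu1 e0 f0 f1.
have m1 : avg (fun=> 1) = 1.
  by rewrite -[RHS]mu1; apply: eq_bigr => s _; rewrite mulr1.
have -> : Phi f / (2 * e) + 2 * e = avg (fun s =>
    (2 * e)^-1 * (f s * ln (f s) - f s + 1) + e * (1 + f s)).
  rewrite meanD !meanZ meanD meanB meanD m1 f1 -/(Phi f); ring.
apply: le_mean => // s s0; have {}f0 := f0 s s0; set x := f s in f0 *.
have := sqrB_le_max_xlnx f0 (@ltr01 R); rewrite ln1 mulr0 subr0.
have := xlnx_ge f0 (@ler01 R) (fun=> ltr01); rewrite ln1 mulr0 subr0.
set y := x * ln x => y0 xy.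
set P := (2 * e)^-1 * _; set Q := e * _.
have P0 : 0 <= P by rewrite mulr_ge0 ?invr_ge0; lra.
have Q0 : 0 <= Q by rewrite mulr_ge0; lra.
rewrite -(@ler_pXn2r _ 2) ?nnegrE ?addr_ge0// real_normK ?num_real//.
apply: le_trans xy _; apply: (@le_trans _ _ (4 * (P * Q))); last first.
  have := sqr_ge0 (P - Q); lra.
have -> : 4 * (P * Q) = 2 * (1 + x) * (y - x + 1).
  by rewrite /P /Q; field; rewrite gt_eqF.
rewrite ler_wpM2r//; first lra.
by rewrite ler_wpM2l// ge_max; apply/andP; split; lra.
Qed.

End Entropy.

(** * Crude tensorization of entropy inside a block *)

Section BlockTensorization.
Variables (R : realType) (q : nat) (V : finType) (mu : {ffun V -> 'I_q} -> R).
Local Notation config := {ffun V -> 'I_q}.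
Hypothesis mu_ge0 : forall s, 0 <= mu s.
Variable b : R.
Hypotheses (b0 : 0 < b) (hb : marginally_bounded mu b).
Hypothesis hconn : totally_connected mu.
Implicit Types (s x y : config) (L C : {set V}).
Local Notation avg := (mean mu).
Local Notation cE := (condE mu).

Lemma prob_pinnedU1_ge L v s : 0 < mu s -> v \notin L ->
  b * prob mu (pinned L s) <= prob mu (pinned (v |: L) s).
Proof.
move=> s0 vL; have Z0 := prob_pinned_gt0 mu_ge0 L s0.
have e : has_spin v (s v) :&: pinned L s = pinned (v |: L) s.
  by rewrite pinnedU pinned1.
have := hb Z0 (p := (v, s v)); rewrite /cprob e ler_pdivlMr//; apply.
by rewrite inE/= vL /cprob e divr_gt0// prob_pinned_gt0.
Qed.

Lemma prob_pinnedU_ge L C s : 0 < mu s ->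
  b ^+ #|C :\: L| * prob mu (pinned L s) <= prob mu (pinned (L :|: C) s).
Proof.
move=> s0; move: {2}#|_| (erefl #|C :\: L|) => n; elim: n => [|n IH] in L *.
  move=> e; rewrite e mul1r; move/eqP: e; rewrite cards_eq0 setD_eq0.
  by move=> /setUidPl ->.
move=> e; have /card_gt0P[v] : (0 < #|C :\: L|)%N by rewrite e.
rewrite inE => /andP[vL vC].
have e' : #|C :\: (v |: L)| = n.
  apply/eqP; rewrite -eqSS -e (cardsD1 v (C :\: L)) inE vL vC/= add1n eqSS.
  apply/eqP; congr #|pred_of_set _|; apply/setP => w; rewrite !inE.
  by case: (w == v); rewrite ?andbF.
have := IH (v |: L) e'; rewrite (_ : _ :|: C = L :|: C) => [IH'|]; last first.
  by apply/setP => w; rewrite !inE; have [->|] := eqVneq w v; rewrite ?vC ?orbT.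
apply: le_trans IH'; rewrite e e' exprSr -mulrA ler_wpM2l ?exprn_ge0 ?(ltW b0)//.
exact: prob_pinnedU1_ge.
Qed.

Lemma mu_ge_pinned C s : 0 < mu s ->
  b ^+ #|C| * prob mu (pinned (~: C) s) <= mu s.
Proof.
move=> s0; have := prob_pinnedU_ge (~: C) C s0.
rewrite setDE setCK setIid setUC setUCr pinned_setT /(prob _ [set s]).
by rewrite big_set1.
Qed.

(** Every feasible state of a fibre carries conditional mass at least
    [b ^+ #|C|], so it is seen by an average over the fibre. *)
Lemma condE_ge_point C f s x : 0 < mu s -> 0 < mu x -> x \in pinned (~: C) s ->
  (forall x, 0 < mu x -> 0 <= f x) ->
  b ^+ #|C| * f x <= cE (~: C) f s.
Proof.
move=> s0 x0 xs f0; have Z0 := prob_pinned_gt0 mu_ge0 (~: C) s0.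
rewrite ler_pdivlMr// (bigD1 x)//=.
rewrite mulrAC -[leLHS]addr0 lerD//.
  by rewrite ler_wpM2r ?f0// -(pinned_eq xs) mu_ge_pinned.
apply: sumr_ge0 => y _.
by have [->|y0] := mu_gt0P mu_ge0 y; [rewrite mul0r|rewrite mulr_ge0// f0].
Qed.

Lemma card_fiber_le C s : 0 < mu s ->
  #|feasible_configs mu :&: pinned (~: C) s|%:R * b ^+ #|C| <= 1.
Proof.
move=> s0; have Z0 := prob_pinned_gt0 mu_ge0 (~: C) s0.
rewrite -(ler_pM2r Z0) mul1r -mulrA.
apply: le_trans (prob_sub mu_ge0 (subsetIr (feasible_configs mu) _)).
rewrite -[X in X%:R * _]sum1_card natr_sum mulr_suml.
apply: ler_sum => x; rewrite mul1r !inE => /andP[x0 xs].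
by rewrite -(@pinned_eq _ _ _ s x) ?mu_ge_pinned// inE.
Qed.

Lemma path_osc (T : eqType) (e : rel T) (h : T -> R) (d : R) (x : T) p :
  (forall y z : T, e y z -> `|h y - h z| <= d) -> path e x p ->
  `|h x - h (last x p)| <= d * (size p)%:R.
Proof.
move=> hd; elim: p x => [|y p IH] x /=; first by rewrite subrr normr0 mulr0.
move=> /andP[/hd xy /IH yp]; rewrite -natr1 mulrDr mulr1.
rewrite [X in `|X|](_ : _ = (h x - h y) + (h y - h (last y p))); last by ring.
by apply: le_trans (ler_normD _ _) _; rewrite addrC lerD.
Qed.

(** Along a flip path inside a fibre, [h] changes by at most [d] per step, and a
    path without repetition has at most as many steps as the fibre has states,
    hence at most [b ^- #|C|]. *)
Lemma fiber_osc C s (h : config -> R) (d : R) : 0 < mu s -> 0 <= d ->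
  (forall x y v, 0 < mu x -> 0 < mu y -> v \in C ->
     x \in pinned (~: C) s -> y \in pinned (~: C) s ->
     y \in pinned (~: [set v]) x -> `|h x - h y| <= d) ->
  forall x, 0 < mu x -> x \in pinned (~: C) s ->
  b ^+ #|C| * `|h s - h x| <= d.
Proof.
move=> s0 d0 hd x x0 xs.
set Om := feasible_configs mu :&: pinned (~: C) s.
have sO : s \in Om by rewrite in_setI pinned_refl inE s0.
have xO : x \in Om by rewrite in_setI xs inE x0.
have /connectP[p0 pp0 ->] := hconn (prob_pinned_gt0 mu_ge0 (~: C) s0) sO xO.
pose e y z := [&& y \in Om, z \in Om & one_flip y z].
have {}pp0 : path e s p0 := pp0.
case/shortenP: pp0 => p pp up _.
have pO y z : e y z -> `|h y - h z| <= d.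
  move=> /and3P[]; rewrite !in_setI => /andP[yO ys] /andP[zO zs].
  move=> /cards1P[v ev]; rewrite !inE in yO zO.
  have yz w : (y w != z w) = (w == v) by rewrite -in_set1 -ev inE.
  apply: (@hd _ _ v) => //.
    apply: contraT => vC; have /eqP[] : y v != z v by rewrite yz.
    by rewrite (pinnedP _ _ _ ys) ?(pinnedP _ _ _ zs)// inE.
  apply/pinnedP => w; rewrite !inE => wv; apply/esym/eqP.
  by rewrite -[_ == _]negbK yz.
have := path_osc pO pp => H.
have sz : ((size p)%:R : R) * b ^+ #|C| <= 1.
  apply: le_trans (card_fiber_le C s0).
  rewrite ler_wpM2r ?exprn_ge0 ?(ltW b0)// ler_nat.
  apply: leq_trans (leqnSn _) _; rewrite -[(size p).+1]/(size (s :: p)).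
  rewrite -(card_uniqP up); apply: subset_leq_card; apply/subsetP => y.
  rewrite inE => /predU1P[->//|yp].
  case/splitPr: yp pp => p1 p2; rewrite cat_path/= => /and3P[_ + _].
  by case/and3P.
apply: le_trans (ler_wpM2l (exprn_ge0 _ (ltW b0)) H) _.
by rewrite mulrCA [_ * _%:R]mulrC -[leRHS]mulr1 ler_wpM2l.
Qed.

Hypothesis b1 : b <= 1.

(** Crude approximate tensorization in a block, with a constant exponential in
    its size.  With [h = Num.sqrt g], both entropies are compared to oscillations
    of [h]: single-site entropies bound its one-flip differences from above, and
    the block entropy is at most the mean of [(g - G) ^+ 2 / G], where [G] is the
    block average, which is controlled by the differences of [h] along paths. *)
Lemma Phi_block_le C g : (forall x, 0 < mu x -> 0 <= g x) ->
  Phi mu g - Phi mu (cE (~: C) g) <=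
  16 / b ^+ #|C| ^+ 4 *
  \sum_(v in C) (Phi mu g - Phi mu (cE (~: [set v]) g)).
Proof.
move=> g0; set B := b ^+ #|C|.
have B0 : 0 < B by rewrite exprn_gt0.
have B1 : B <= 1 by rewrite exprn_ile1 ?(ltW b0).
pose h x := Num.sqrt (g x).
pose F v x := (h x - Num.sqrt (cE (~: [set v]) g x)) ^+ 2.
pose D s := \sum_(v in C) cE (~: C) (F v) s.
have F0 v x : 0 <= F v x by exact: sqr_ge0.
have D0 s : 0 <= D s by apply: sumr_ge0 => v _; apply: condE_ge0.
have site v : avg (F v) <= Phi mu g - Phi mu (cE (~: [set v]) g).
  rewrite Phi_diffE//; apply: le_mean => // x x0; apply: sqr_sqrtB_le_xlnx.
  - exact: g0.
  - exact: condE_ge0.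
  - exact: condE_gt0.
have osc s x : 0 < mu s -> 0 < mu x -> x \in pinned (~: C) s ->
    B * `|h s - h x| <= 2 * Num.sqrt (D s / B).
  move=> s0 x0 xs.
  have d0 : 0 <= 2 * Num.sqrt (D s / B) by rewrite mulr_ge0 ?sqrtr_ge0.
  (* Both endpoints of a flip at [v] are compared with [m], the square root of
     the average of [g] over the fibre that they share. *)
  apply: (@fiber_osc C s h _ s0 d0 _ x x0 xs) => {xs x0}x y v x0 y0 vC xs ys xy.
  have near z : 0 < mu z -> z \in pinned (~: C) s ->
      `|h z - Num.sqrt (cE (~: [set v]) g z)| <= Num.sqrt (D s / B).
    move=> z0 zs; rewrite -sqrtr_sqr ler_wsqrtr// ler_pdivlMr// mulrC.
    apply: le_trans (condE_ge_point s0 z0 zs (fun x _ => F0 v x)) _.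
    rewrite /D (bigD1 v)//= lerDl sumr_ge0// => w _; exact: condE_ge0.
  have := near y y0 ys; rewrite (condE_dep mu g xy) distrC.
  have := near x x0 xs; set m := Num.sqrt (cE _ _ _) => nx ny.
  rewrite [X in `|X|](_ : _ = (h x - m) + (m - h y)); last by ring.
  by apply: le_trans (ler_normD _ _) _; lra.
have osc2 s x : 0 < mu s -> 0 < mu x -> x \in pinned (~: C) s ->
    (g s - g x) ^+ 2 <= 8 * D s / B ^+ 3 * (g s + g x).
  move=> s0 x0 xs; have := osc s x s0 x0 xs.
  rewrite -(@ler_pXn2r _ 2) ?nnegrE ?mulr_ge0 ?sqrtr_ge0 ?normr_ge0 ?(ltW B0)//.
  rewrite !exprMn real_normK ?num_real// sqr_sqrtr ?divr_ge0 ?(ltW B0)// => o.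
  have o' : (h s - h x) ^+ 2 <= 4 * D s / B ^+ 3.
    rewrite -(ler_pM2l (exprn_gt0 2 B0)); apply: le_trans o _.
    by rewrite le_eqVlt; apply/orP; left; apply/eqP; field; rewrite gt_eqF.
  have gE z : 0 < mu z -> g z = h z ^+ 2 by move=> z0; rewrite sqr_sqrtr ?g0.
  rewrite !gE//; have -> : (h s ^+ 2 - h x ^+ 2) ^+ 2 =
    (h s - h x) ^+ 2 * (h s + h x) ^+ 2 by ring.
  apply: (@le_trans _ _ (4 * D s / B ^+ 3 * (2 * (h s ^+ 2 + h x ^+ 2)))).
    apply: ler_pM; rewrite ?sqr_ge0//.
    have := sqr_ge0 (h s - h x); lra.
  by rewrite le_eqVlt; apply/orP; left; apply/eqP; field; rewrite gt_eqF.
have point s : 0 < mu s -> g s * ln (g s) - g s * ln (cE (~: C) g s) - g s +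
    cE (~: C) g s <= 16 / B ^+ 4 * D s.
  move=> s0; have := condE_ge_point s0 s0 (pinned_refl (~: C) s) g0; rewrite -/B.
  have := condE_ge0 mu_ge0 (~: C) s g0; set G := cE _ g s.
  rewrite le_eqVlt => /predU1P[<-|G0] gG.
    have -> : g s = 0.
      by apply/eqP; rewrite eq_le g0// andbT -(pmulr_rle0 _ B0).
    by rewrite !mul0r !subr0 addr0 mulr_ge0// divr_ge0// exprn_ge0 ?(ltW B0).
  apply: le_trans (xlnx_le_chi2 (g0 s s0) G0) _.
  rewrite ler_pdivrMr//.
  have : g s - G = cE (~: C) (fun x => g s - g x) s by rewrite condEB condE_cst.
  move=> ->; apply: le_trans (sqr_condE_le mu_ge0 _ _ s0) _.
  apply: (@le_trans _ _ (cE (~: C) (fun x => 8 * D s / B ^+ 3 * (g s + g x)) s)).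
    by apply: le_condE => // x xs x0; apply: osc2.
  rewrite condEZ condED condE_cst// -/G.
  have -> : 16 / B ^+ 4 * D s * G = 8 * D s / B ^+ 3 * (2 * G / B).
    by field; rewrite gt_eqF.
  have k0 : 0 <= 8 * D s / B ^+ 3.
    by apply: divr_ge0; [apply: mulr_ge0|apply: exprn_ge0; exact: ltW].
  apply: (ler_wpM2l k0); rewrite ler_pdivlMr// mulrDl.
  have : G * B <= G by rewrite ler_piMr// ltW.
  by rewrite [g s * B]mulrC; lra.
rewrite Phi_diffE//; apply: (@le_trans _ _ (avg (fun s => 16 / B ^+ 4 * D s))).
  exact: le_mean.
rewrite meanZ ler_wpM2l ?divr_ge0 ?exprn_ge0 ?(ltW b0)//.
have -> : avg D = \sum_(v in C) avg (cE (~: C) (F v)) by exact: mean_sum.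
by apply: ler_sum => v vC; rewrite mean_condE.
Qed.

End BlockTensorization.

(** * The largest eigenvalue bounds the quadratic form *)

Section Rayleigh.
Variables (R : realType) (n : nat) (M : 'M[R]_n) (d : 'I_n -> R).
Hypothesis d0 : forall i, 0 < d i.
Hypothesis dM : forall i j, d i * M i j = d j * M j i.

Let Q (v w : 'rV[R]_n) := \sum_i \sum_j d i * M i j * v 0 i * w 0 j.
Let W (v w : 'rV[R]_n) := \sum_i d i * v 0 i * w 0 i.

Let QDZ (v w : 'rV[R]_n) t : Q (v + t *: w) (v + t *: w) = Q v v + 2 * t * Q v w + t ^+ 2 * Q w w.
Proof.
have QC : Q w v = Q v w.
  rewrite /Q exchange_big; apply: eq_bigr => i _; apply: eq_bigr => j _.
  by rewrite dM; ring.
transitivity (Q v v + t * Q v w + t * Q w v + t ^+ 2 * Q w w); last first.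
  by rewrite QC; ring.
rewrite /Q !mulr_sumr -!big_split; apply: eq_bigr => i _ /=.
rewrite !mulr_sumr -!big_split; apply: eq_bigr => j _ /=.
by rewrite !mxE; ring.
Qed.

Let WDZ (v w : 'rV[R]_n) t : W (v + t *: w) (v + t *: w) = W v v + 2 * t * W v w + t ^+ 2 * W w w.
Proof.
rewrite /W !mulr_sumr -!big_split; apply: eq_bigr => i _ /=.
by rewrite !mxE; ring.
Qed.

Let QZ (v : 'rV[R]_n) t : Q (t *: v) (t *: v) = t ^+ 2 * Q v v.
Proof.
rewrite /Q !mulr_sumr; apply: eq_bigr => i _; rewrite !mulr_sumr.
by apply: eq_bigr => j _; rewrite !mxE; ring.
Qed.

Let WZ (v : 'rV[R]_n) t : W (t *: v) (t *: v) = t ^+ 2 * W v v.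
Proof.
by rewrite /W !mulr_sumr; apply: eq_bigr => i _; rewrite !mxE; ring.
Qed.

Let W_ge (v : 'rV[R]_n) i : d i * v 0 i ^+ 2 <= W v v.
Proof.
rewrite /W (bigD1 i)//= expr2 mulrA lerDl sumr_ge0// => j _.
by rewrite -mulrA mulr_ge0 ?(ltW (d0 j))// -expr2 sqr_ge0.
Qed.

Let W_ge0 (v : 'rV[R]_n) : 0 <= W v v.
Proof.
by apply: sumr_ge0 => j _; rewrite -mulrA mulr_ge0 ?(ltW (d0 j))// -expr2 sqr_ge0.
Qed.

Let W_eq0 (v : 'rV[R]_n) : W v v = 0 -> v = 0.
Proof.
move=> Wv; apply/rowP => i; rewrite mxE; have := W_ge v i; rewrite Wv.
rewrite pmulr_rle0// => v0; apply/eqP; rewrite -sqrf_eq0 eq_le v0; exact: sqr_ge0.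
Qed.

Let sphere := [set v | W v v = 1]%classic.

Let sum_continuous (I : finType) (F : I -> 'rV[R]_n -> R) :
  (forall i, continuous (F i)) -> continuous (fun v => \sum_i F i v).
Proof.
move=> cF; apply: continuous_big => [|i _]; last exact: cF.
exact: add_continuous.
Qed.

Let monomial_continuous c i j : continuous (fun v : 'rV[R]_n => c * v 0 i * v 0 j).
Proof.
move=> v; apply: (@continuousM _ _ (fun v : 'rV[R]_n => c * v 0 i)).
  apply: (@continuousM _ _ (fun=> c)); first exact: cst_continuous.
  exact: coord_continuous.
exact: coord_continuous.
Qed.

Let Q_continuous : continuous (fun v => Q v v).
Proof.
by apply: sum_continuous => i; apply: sum_continuous => j; exact: monomial_continuous.
Qed.

Let W_continuous : continuous (fun v => W v v).
Proof. by apply: sum_continuous => i; exact: monomial_continuous. Qed.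

Let sphere_compact : compact sphere.
Proof.
pose c i := (d i)^-1 + 1.
have K := @rV_compact R n _ (fun i => @segment_compact _ (- c i) (c i)).
apply: subclosed_compact K _ => [|v Wv i].
  apply: (@closed_comp _ _ (fun v => W v v) [set 1 : R]%classic) => [v _|].
    exact: W_continuous.
  exact: closed_eq.
rewrite /= in_itv/= -ler_norml (_ : ord0 = 0); last exact: val_inj.
have := W_ge v i; rewrite Wv -ler_pdivlMl// mulr1 => v2.
have := sqr_ge0 (`|v 0 i| - 1); rewrite sqrrB real_normK ?num_real// expr1n mulr1.
have : 0 <= (d i)^-1 by rewrite invr_ge0 ltW.
by rewrite /c; have := normr_ge0 (v 0 i); lra.
Qed.

(** The form [sum_(i, j) d i M i j v i v j] attains its maximum on the sphere
    [sum_i d i v i ^+ 2 = 1]; stationarity makes the maximizer, rescaled by [d],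
    a left eigenvector of [M] whose eigenvalue is the maximum. *)
Lemma quadratic_form_le (eta : R) : (forall x, eigenvalue M x -> x <= eta) ->
  forall g : 'I_n -> R,
  \sum_i \sum_j d i * M i j * g i * g j <= eta * \sum_i d i * g i ^+ 2.
Proof.
move=> heta g; pose v := \row_i g i.
have -> : \sum_i \sum_j d i * M i j * g i * g j = Q v v.
  by apply: eq_bigr => i _; apply: eq_bigr => j _; rewrite !mxE.
have -> : \sum_i d i * g i ^+ 2 = W v v.
  by apply: eq_bigr => i _; rewrite !mxE expr2 mulrA.
move: v => {g} v.
have normalize (w : 'rV[R]_n) : w != 0 ->
    exists2 t : R, 0 < t & sphere (t *: w).
  move=> w0; have Wp : 0 < W w w.
    rewrite lt_neqAle W_ge0 andbT eq_sym; apply: contra w0 => /eqP.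
    by move=> /W_eq0 ->.
  exists (Num.sqrt (W w w))^-1; first by rewrite invr_gt0 sqrtr_gt0.
  by rewrite /sphere/= WZ exprVn sqr_sqrtr ?(ltW Wp)// mulVf ?gt_eqF.
have [->|v0] := eqVneq v 0.
  by rewrite -(scale0r 0) QZ WZ expr0n/= !mul0r mulr0.
have [t0 _ st0] := normalize v v0.
have cQ : {within sphere, continuous (fun v => Q v v)}%classic.
  by apply: continuous_subspaceT => w; exact: Q_continuous.
have [u /set_mem us umax] := EVT_max_rV (ex_intro _ _ st0) sphere_compact cQ.
set l := Q u u in umax; have Wu : W u u = 1 by [].
have Ql w : Q w w <= l * W w w.
  have [->|w0] := eqVneq w 0.
    by rewrite -(scale0r 0) QZ WZ expr0n/= !mul0r mulr0.
  have [t tp ts] := normalize w w0.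
  have := umax _ (mem_set ts); rewrite QZ => tQ.
  have : W (t *: w) (t *: w) = 1 by [].
  rewrite WZ => tW; rewrite -(ler_pM2l (exprn_gt0 2 tp)) mulrCA tW mulr1.
  exact: tQ.
have QW w : Q u w = l * W u w.
  have key t : 2 * t * (Q u w - l * W u w) <= t ^+ 2 * (l * W w w - Q w w).
    by have := Ql (u + t *: w); rewrite QDZ WDZ Wu -/l; lra.
  set D := Q u w - _ in key; set e := _ - Q w w in key.
  have e0 : 0 <= e by rewrite subr_ge0 Ql.
  apply/eqP; rewrite -subr_eq0 -/D -sqrf_eq0 eq_le sqr_ge0 andbT.
  (* This [t] makes the linear term beat the quadratic one unless [D = 0]; adding
     [1] to [e] covers the case [e = 0]. *)
  have := key (D / (e + 1)).
  rewrite [leLHS](_ : _ = 2 * D ^+ 2 / (e + 1)); last by field; lra.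
  rewrite [leRHS](_ : _ = D ^+ 2 * e / (e + 1) / (e + 1)); last by field; lra.
  rewrite ler_pM2r ?invr_gt0; last lra.
  rewrite ler_pdivlMr; last lra.
  have := sqr_ge0 D; set D2 := D ^+ 2; nra.
have le : l <= eta.
  apply: heta; apply/eigenvalueP; exists (\row_i (d i * u 0 i)).
    apply/rowP => j; rewrite !mxE.
    have WE : W u (delta_mx 0 j) = d j * u 0 j.
      rewrite /W (bigD1 j)//= !mxE !eqxx mulr1 big1 ?addr0// => i ij.
      by rewrite mxE (negPf ij) andbF mulr0.
    rewrite -WE -QW; apply: eq_bigr => i _; rewrite (bigD1 j)//= !mxE !eqxx mulr1.
    rewrite big1 ?addr0 => [|k kj]; first by ring.
    by rewrite mxE (negPf kj) andbF mulr0.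
  apply/eqP => u0; have := Wu; rewrite /W big1 => [/eqP|i _].
    by rewrite eq_sym oner_eq0.
  by move/rowP: u0 => /(_ i); rewrite !mxE => ->; rewrite mul0r.
by apply: le_trans (Ql v) _; rewrite ler_wpM2r.
Qed.

End Rayleigh.

(** * Local entropy inequality from spectral independence *)

Section LocalInequality.
Variables (R : realType) (q : nat) (V : finType) (mu : {ffun V -> 'I_q} -> R).
Local Notation config := {ffun V -> 'I_q}.
Hypothesis mu_ge0 : forall s, 0 <= mu s.
Variable eta : R.
Hypothesis hSI : spectrally_independent mu eta.
Implicit Types (s x y : config) (L A : {set V}).
Local Notation avg := (mean mu).
Local Notation cE := (condE mu).

(** The quadratic form of the influence matrix, weighted by the marginals, is
    the sum of the covariances of single-site functions. *)
Lemma sum_cov_le A t (F : V -> config -> R) : 0 < mu t -> A != [set: V] ->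
  (forall u, u \notin A -> depends_on (u |: A) (F u)) ->
  (forall u, u \notin A -> cE A (F u) t = 0) ->
  cE A (fun x => \sum_(u | u \notin A) \sum_(v | (v \notin A) && (v != u))
                    F u x * F v x) t <=
  eta * cE A (fun x => \sum_(u | u \notin A) F u x ^+ 2) t.
Proof.
move=> t0 AT dF F0; set B := pinned A t.
have Z0 : 0 < prob mu B by exact: prob_pinned_gt0.
pose chi (p : V * 'I_q) (x : config) : R := (x p.1 == p.2)%:R.
pose d p := cprob mu (has_spin p.1 p.2) B.
pose P p r := cE A (fun x => chi p x * chi r x) t.
have cprobE (C : {set config}) : cprob mu C B = cE A (fun x => (x \in C)%:R) t.
  rewrite /cprob /condE; congr (_ / _); rewrite /prob.
  rewrite big_mkcond [RHS]big_mkcond; apply: eq_bigr => x _.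
  by rewrite in_setI; case: (x \in C); case: (x \in B); rewrite ?mulr1 ?mulr0.
have dE p : d p = cE A (chi p) t.
  by rewrite /d cprobE; apply: eq_condE => // x _ _; rewrite inE.
have d_ge0 p : 0 <= d p by rewrite dE; apply: condE_ge0 => // x _; exact: ler0n.
have PE p r : P p r =
    prob mu (has_spin r.1 r.2 :&: (has_spin p.1 p.2 :&: B)) / prob mu B.
  rewrite setIA -[RHS]/(cprob _ _ _) cprobE; apply: eq_condE => // x _ _.
  by rewrite in_setI !in_has_spin /chi; case: eqP; case: eqP; rewrite ?mulr1 ?mulr0.
have PC p r : P p r = P r p by apply: eq_condE => // x _ _; rewrite mulrC.
have P_le p r : 0 <= P p r <= d p.
  rewrite dE; apply/andP; split.
    by apply: condE_ge0 => // x _; rewrite mulr_ge0.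
  by apply: le_condE => // x _ _; rewrite /chi; do 2!case: eqP => _;
    rewrite ?mulr1 ?mulr0.
(* Given the pinning, [F u] depends only on the spin at [u]: [G (u, a)] is its
   value when that spin is [a]. *)
pose G (p : V * 'I_q) :=
  if [pick x in B :&: has_spin p.1 p.2] is Some x then F p.1 x else 0.
have FE u x : u \notin A -> x \in B -> F u x = G (u, x u).
  move=> uA xB; rewrite /G; case: pickP => [y|/(_ x)]; last by rewrite in_setI in_has_spin xB eqxx.
  rewrite in_setI => /andP[yB]; rewrite in_has_spin => /eqP yu; apply: dF => //.
  rewrite pinnedU pinned1 in_setI in_has_spin yu eqxx/=.
  by rewrite (pinned_eq yB).
have FS u x : u \notin A -> x \in B -> F u x = \sum_a chi (u, a) x * G (u, a).
  move=> uA xB; rewrite FE// (bigD1 (x u))//= /chi/= eqxx mul1r big1 ?addr0// => a.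
  by rewrite eq_sym => /negPf ->; rewrite mul0r.
have sumFP (X : V * 'I_q -> R) : (forall p, d p = 0 -> X p = 0) ->
    \sum_(p in feasible_pairs mu A t) X p = \sum_(u | u \notin A) \sum_a X (u, a).
  move=> X0; rewrite pair_big_dep/= big_mkcond [RHS]big_mkcond.
  apply: eq_bigr => -[u a] _; rewrite inE/=; case: ifP => [/andP[-> _]//|].
  case: (u \notin A) => //= /negbT; rewrite -leNgt => h.
  by rewrite X0//; apply/eqP; rewrite eq_le d_ge0 andbT.
have dM (i j : 'I_#|feasible_pairs mu A t|) :
    d (enum_val i) * influence mu A t i j =
    if (enum_val i).1 == (enum_val j).1 then 0
    else P (enum_val i) (enum_val j) - d (enum_val i) * d (enum_val j).
  rewrite mxE/=; case: (_.1 == _.1); first by rewrite mulr0.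
  rewrite mulrBr; congr (_ - _); rewrite PE /d /cprob.
  have /setIdP[_] := enum_valP i; rewrite /cprob -/B => i0.
  have : 0 < prob mu (has_spin (enum_val i).1 (enum_val i).2 :&: B).
    by rewrite -(pmulr_lgt0 _ (_ : 0 < (prob mu B)^-1)) ?invr_gt0.
  by move=> h; field; rewrite !gt_eqF.
have dpos (i : 'I_#|feasible_pairs mu A t|) : 0 < d (enum_val i).
  by have := enum_valP i; rewrite inE => /andP[].
have dsym (i j : 'I_#|feasible_pairs mu A t|) :
    d (enum_val i) * influence mu A t i j = d (enum_val j) * influence mu A t j i.
  by rewrite !dM eq_sym PC [d (enum_val i) * _]mulrC.
have := @quadratic_form_le R _ (influence mu A t) (fun i => d (enum_val i)) dpos
  dsym eta (hSI AT Z0) (fun i => G (enum_val i)).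
have -> : \sum_i \sum_j d (enum_val i) * influence mu A t i j *
     G (enum_val i) * G (enum_val j) =
   \sum_(p in feasible_pairs mu A t) \sum_(r in feasible_pairs mu A t)
     (if p.1 == r.1 then 0 else P p r - d p * d r) * G p * G r.
  rewrite [RHS]big_enum_val; apply: eq_bigr => i _.
  rewrite [RHS]big_enum_val; apply: eq_bigr => j _.
  by rewrite dM.
rewrite -(big_enum_val (fun p => d p * G p ^+ 2)).
rewrite sumFP => [|p dp]; last first.
  rewrite big1 // => r _; case: ifP => _; first by rewrite !mul0r.
  have /andP[P0 Pd] := P_le p r.
  have -> : P p r = 0 by apply/eqP; rewrite eq_le P0 -dp Pd.
  by rewrite dp mul0r subr0 !mul0r.
rewrite (sumFP (fun p => d p * G p ^+ 2)) => [|p ->]; last by rewrite mul0r.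
have dsum u : u \notin A -> \sum_a d (u, a) * G (u, a) = 0.
  move=> uA; rewrite -[RHS](F0 u uA); under eq_bigr do rewrite dE mulrC -condEZ.
  rewrite -condE_sum; apply: eq_condE => // x xB _; rewrite FS//.
  by apply: eq_bigr => a _; rewrite mulrC.
have -> : \sum_(u | u \notin A) \sum_a \sum_(r in feasible_pairs mu A t)
      (if (u, a).1 == r.1 then 0 else P (u, a) r - d (u, a) * d r) *
        G (u, a) * G r =
    cE A (fun x => \sum_(u | u \notin A) \sum_(v | (v \notin A) && (v != u))
                    F u x * F v x) t.
  rewrite condE_sum; apply: eq_bigr => u uA; rewrite condE_sum.
  transitivity (\sum_a \sum_(v | v \notin A) \sum_c
     (if u == v then 0 else P (u, a) (v, c) - d (u, a) * d (v, c)) *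
        G (u, a) * G (v, c)).
    apply: eq_bigr => a _; rewrite sumFP// => r dr; case: ifP => _.
      by rewrite !mul0r.
    have /andP[P0 Pd] := P_le r (u, a).
    have -> : P (u, a) r = 0 by apply/eqP; rewrite PC eq_le P0 -dr Pd.
    by rewrite dr mulr0 subr0 !mul0r.
  rewrite exchange_big/= [LHS]big_mkcond [RHS]big_mkcond/=; apply: eq_bigr => v _.
  case: (boolP (v \notin A)) => //= vA; rewrite eq_sym; case: eqP => _ /=.
    by rewrite big1// => a _; rewrite big1// => c _; rewrite !mul0r.
  transitivity (\sum_a \sum_c P (u, a) (v, c) * G (u, a) * G (v, c) -
    (\sum_a d (u, a) * G (u, a)) * (\sum_c d (v, c) * G (v, c))).
    rewrite mulr_suml -sumrB; apply: eq_bigr => a _.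
    by rewrite mulr_sumr -sumrB; apply: eq_bigr => c _; ring.
  rewrite dsum// mul0r subr0.
  transitivity (\sum_a cE A (fun x => \sum_c
     (chi (u, a) x * G (u, a)) * (chi (v, c) x * G (v, c))) t).
    apply: eq_bigr => a _; rewrite condE_sum; apply: eq_bigr => c _.
    rewrite /P -mulrA mulrC -condEZ; apply: eq_condE => // x _ _; ring.
  rewrite -condE_sum; apply: eq_condE => // x xB _; rewrite !FS//.
  rewrite mulr_suml; apply: eq_bigr => a _; rewrite mulr_sumr.
  by apply: eq_bigr.
have -> : \sum_(u | u \notin A) \sum_a d (u, a) * G (u, a) ^+ 2 =
    cE A (fun x => \sum_(u | u \notin A) F u x ^+ 2) t.
  rewrite condE_sum; apply: eq_bigr => u uA.
  under eq_bigr do rewrite dE mulrC -condEZ.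
  rewrite -condE_sum; apply: eq_condE => // x xB _; rewrite FE//.
  rewrite (bigD1 (x u))//= /chi/= eqxx mulr1 big1 ?addr0// => a.
  by rewrite eq_sym => /negPf ->; rewrite mulr0.
by apply.
Qed.

Variable b : R.
Hypotheses (b0 : 0 < b) (hb : marginally_bounded mu b).
Hypotheses (b1 : b <= 1) (eta0 : 0 < eta).

Lemma condE_le_marginal A u f s : (forall x, 0 < mu x -> 0 <= f x) ->
  u \notin A -> 0 < mu s -> b * cE (u |: A) f s <= cE A f s.
Proof.
move=> f0 uA s0; have pA := prob_pinned_gt0 mu_ge0 A s0.
have pu := prob_pinned_gt0 mu_ge0 (u |: A) s0.
have pb := prob_pinnedU1_ge mu_ge0 hb s0 uA.
pose S L := \sum_(x in pinned L s) mu x * f x.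
have muf x : 0 <= mu x * f x.
  by have [->|x0] := mu_gt0P mu_ge0 x; [rewrite mul0r|rewrite mulr_ge0// f0].
have Su : S (u |: A) <= S A by apply: (@prob_sub _ _ _ (fun x => mu x * f x)) => //;
  exact/pinned_sub/subsetUr.
have S0 : 0 <= S (u |: A) by exact: sumr_ge0.
rewrite /condE -/(S A) -/(S (u |: A)) mulrA ler_pdivrMr//.
rewrite mulrAC ler_pdivlMr// mulrAC.
apply: (@le_trans _ _ (prob mu (pinned (u |: A) s) * S (u |: A))).
  by rewrite ler_wpM2r.
by rewrite mulrC ler_wpM2r// ltW.
Qed.

(** Local entropy inequality: revealing two more spins gains at least about twice
    what revealing one gains.  The deficit is a sum of covariances of the
    single-site averages of [f], bounded through spectral independence by
    variances; since the single-site averages are at most [b^-1] times the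
    current one, those variances are bounded by entropies. *)
Lemma Phi_local_ge A f : (forall x, 0 < mu x -> 0 <= f x) ->
  - (2 * eta / b) *
    \sum_(u | u \notin A) (Phi mu (cE (u |: A) f) - Phi mu (cE A f)) <=
  \sum_(u | u \notin A) \sum_(v | (v \notin A) && (v != u))
    (Phi mu (cE (u |: (v |: A)) f) - Phi mu (cE (u |: A) f)
     - Phi mu (cE (v |: A) f) + Phi mu (cE A f)).
Proof.
move=> f0; have [->|AT] := eqVneq A [set: V].
  by rewrite !big1 ?mulr0// => u; rewrite in_setT.
pose fA := cE A f; pose F u x := cE (u |: A) f x - fA x.
have fA0 s : 0 <= fA s by exact: condE_ge0.
have subA u : A \subset u |: A by exact: subsetUr.
have fu0 u s : u \notin A -> 0 < mu s -> fA s = 0 -> cE (u |: A) f s = 0.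
  move=> uA s0 e; have := condE_le_marginal f0 uA s0; rewrite -/fA e pmulr_rle0//.
  by move=> h; apply/eqP; rewrite eq_le h condE_ge0.
pose k s := (fA s)^-1.
have dk : depends_on A k by move=> s x /(condE_dep mu f); rewrite /k /fA => ->.
(* [k] is the inverse of the average of [f]; where that average vanishes, so do
   the single-site averages, and the convention [0^-1 = 0] is harmless. *)
have step1 u v : u \notin A -> v \notin A ->
  - avg (fun s => F u s * F v s * k s) <=
  Phi mu (cE (u |: (v |: A)) f) - Phi mu (cE (u |: A) f)
     - Phi mu (cE (v |: A) f) + Phi mu (cE A f).
  move=> uA vA; apply: le_trans (Phi_square_ge mu_ge0 f0 (subA u) (subA v)
    (setUS _ (subA v)) (subsetUr _ _)).
  rewrite le_eqVlt; apply/orP; left; apply/eqP.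
  transitivity (avg f - avg (fun s => F u s * F v s * k s
    + (cE (u |: A) f s + cE (v |: A) f s - fA s))).
    rewrite meanD meanB meanD !mean_condE//; ring.
  congr (_ - _); apply: eq_mean => // s s0.
  rewrite /F /k; have [e|e] := eqVneq (fA s) 0; last by rewrite -/fA; field.
  by rewrite !fu0// -/fA e; ring.
have step2 : avg (fun s => (\sum_(u | u \notin A) \sum_(v | (v \notin A) && (v != u))
      F u s * F v s) * k s) <=
    eta * avg (fun s => (\sum_(u | u \notin A) F u s ^+ 2) * k s).
  rewrite -(mean_condE_pull mu_ge0 _ dk) -[in leRHS](mean_condE_pull mu_ge0 _ dk).
  rewrite -meanZ; apply: le_mean => // s s0; rewrite mulrA.
  rewrite ler_wpM2r ?invr_ge0//; apply: (sum_cov_le s0 AT) => u uA.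
    move=> x y xy; rewrite /F (condE_dep mu f xy).
    by rewrite /fA (condE_depW mu f (subA u) xy).
  rewrite condEB condE_tower// (condE_id mu_ge0 (condE_dep mu f) s0).
  exact: subrr.
have step3 u : u \notin A -> avg (fun s => F u s ^+ 2 * k s) <=
    2 / b * (Phi mu (cE (u |: A) f) - Phi mu (cE A f)).
  move=> uA.
  have -> : Phi mu (cE (u |: A) f) - Phi mu (cE A f) = avg (fun s =>
      cE (u |: A) f s * ln (cE (u |: A) f s) - cE (u |: A) f s * ln (fA s)
      - cE (u |: A) f s + fA s).
    rewrite meanD !meanB !mean_condE// subrK.
    by rewrite (mean_ln_condE_sub mu_ge0 f (subA u)).
  rewrite -meanZ; apply: le_mean => // s s0; rewrite /F /k.
  have := condE_le_marginal f0 uA s0; rewrite -/fA.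
  have x0 : 0 <= cE (u |: A) f s by exact: condE_ge0.
  have := fu0 u s uA s0; have := fA0 s; move: (cE (u |: A) f s) x0 (fA s).
  move=> x x0 y; rewrite le_eqVlt => /predU1P[<- /(_ erefl) -> _|y0 _ bxy].
    by rewrite !(subrr, addr0, mul0r, mulr0, expr0n).
  rewrite ler_pdivrMr//; apply: le_trans (sqrB_le_max_xlnx x0 y0) _.
  have phi0 := xlnx_ge x0 (ltW y0) (fun=> y0).
  have h : Num.max x y <= y / b.
    rewrite ge_max; apply/andP; split; rewrite ler_pdivlMr//; first by rewrite mulrC.
    by rewrite ler_piMr// ltW.
  have -> : 2 / b * (x * ln x - x * ln y - x + y) * y =
     2 * (y / b) * (x * ln x - x * ln y - x + y) by ring.
  by rewrite ler_wpM2r ?ler_wpM2l//; lra.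
apply: (@le_trans _ _ (- avg (fun s => (\sum_(u | u \notin A)
    \sum_(v | (v \notin A) && (v != u)) F u s * F v s) * k s))).
  rewrite mulNr lerN2; apply: le_trans step2 _.
  have -> : avg (fun s => (\sum_(u | u \notin A) F u s ^+ 2) * k s) =
      \sum_(u | u \notin A) avg (fun s => F u s ^+ 2 * k s).
    by rewrite -mean_sum; apply: eq_mean => // s _; rewrite mulr_suml.
  apply: (@le_trans _ _ (eta * \sum_(u | u \notin A)
      (2 / b * (Phi mu (cE (u |: A) f) - Phi mu (cE A f))))).
    by rewrite ler_wpM2l ?(ltW eta0)//; apply: ler_sum.
  by rewrite -mulr_sumr; lra.
have -> : avg (fun s => (\sum_(u | u \notin A)
    \sum_(v | (v \notin A) && (v != u)) F u s * F v s) * k s) =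
  \sum_(u | u \notin A) \sum_(v | (v \notin A) && (v != u))
    avg (fun s => F u s * F v s * k s).
  under [RHS]eq_bigr do rewrite -mean_sum.
  rewrite -mean_sum; apply: eq_mean => // s _; rewrite mulr_suml.
  by apply: eq_bigr => u _; rewrite mulr_suml.
rewrite -sumrN; apply: ler_sum => u uA; rewrite -sumrN.
by apply: ler_sum => v /andP[vA _]; exact: step1.
Qed.

End LocalInequality.

(** * From local to global: entropy carried by a random block *)

Section RandomSubsets.
Variables (R : realType) (V : finType).
Implicit Types (A B S : {set V}) (X : {set V} -> R).
Local Notation n := #|V|.

(** The probability that a random subset, which contains each element
    independently with probability [t], equals [S]. *)
Definition bern (t : R) S := t ^+ #|S| * (1 - t) ^+ (n - #|S|).

Lemma bern_ge0 t S : 0 <= t <= 1 -> 0 <= bern t S.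
Proof. by move=> /andP[t0 t1]; rewrite mulr_ge0 ?exprn_ge0// subr_ge0. Qed.

Lemma sum_bern t : \sum_S bern t S = 1.
Proof.
have -> : 1 = \prod_(i : V) (t + (1 - t)) :> R by rewrite big1// => i _; ring.
rewrite bigA_distr; apply: eq_bigr => S _.
rewrite (bigID (fun i => i \in S))/= (eq_bigr (fun=> t)) => [|i ->//].
rewrite [in RHS](eq_bigr (fun=> 1 - t) (P := fun i => i \notin S)) => [|i /negPf ->//].
rewrite !prodr_const /bern; congr (_ * _ ^+ _).
by rewrite -(cardC S) addKn; apply: eq_card => i; rewrite !inE.
Qed.

Lemma sum_by_card (F : {set V} -> R) :
  \sum_S F S = \sum_(l < n.+1) \sum_(S : {set V} | #|S| == l) F S.
Proof.
rewrite (partition_big (fun S : {set V} => inord #|S| : 'I_n.+1) xpredT)//=.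
apply: eq_bigr => l _; apply: eq_bigl => S; rewrite -val_eqE/= inordK//.
by rewrite ltnS max_card.
Qed.

Lemma sum_setU1 j X :
  \sum_(A : {set V} | #|A| == j) \sum_(v | v \notin A) X (v |: A) =
  j.+1%:R * \sum_(B : {set V} | #|B| == j.+1) X B.
Proof.
transitivity (\sum_(B : {set V} | #|B| == j.+1) \sum_(v in B) X B); last first.
  rewrite mulr_sumr; apply: eq_bigr => B /eqP e.
  by rewrite sumr_const e mulr_natl.
rewrite (exchange_big_dep xpredT)//= [RHS](exchange_big_dep xpredT)//=.
apply: eq_bigr => v _.
rewrite (reindex_onto (fun B => B :\ v) (fun A => v |: A)) => [|A]/=; last first.
  by move=> /andP[_ vA]; rewrite setU1K.
apply: eq_big => [B|B]; last by move=> /andP[_ /eqP ->].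
rewrite setD11 andbT; have [vB|vB] := boolP (v \in B).
  by rewrite setD1K// eqxx !andbT (cardsD1 v B) vB add1n eqSS.
rewrite andbF; apply/negbTE; rewrite negb_and; apply/orP; right.
by apply/eqP => e; rewrite -e setU11 in vB.
Qed.

(** The factorial moments of the binomial law, by Pascal's rule. *)
Lemma sum_bin_bern (t : R) (m r : nat) :
  \sum_(l < m.+1) ('C(m, l) * 'C(l, r))%:R * (t ^+ l * (1 - t) ^+ (m - l)) =
  'C(m, r)%:R * t ^+ r.
Proof.
elim: m r => [|m IH] r.
  by rewrite big_ord1 subnn !expr0 !mulr1 mul1n; case: r => [|r]; rewrite ?mulr1// bin0n mul0r.
rewrite big_ord_recl/= bin0 mul1n.
have S1 : \sum_(i < m.+1) ('C(m.+1, bump 0 i) * 'C(bump 0 i, r))%:R *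
     (t ^+ bump 0 i * (1 - t) ^+ (m.+1 - bump 0 i)) =
  \sum_(i < m.+1) ('C(m, i.+1) * 'C(i.+1, r))%:R * (t ^+ i.+1 * (1 - t) ^+ (m - i)) +
  \sum_(i < m.+1) ('C(m, i) * 'C(i.+1, r))%:R * (t ^+ i.+1 * (1 - t) ^+ (m - i)).
  rewrite -big_split; apply: eq_bigr => i _ /=.
  by rewrite /bump leq0n add1n subSS binS mulnDl natrD mulrDl.
rewrite S1 addrA {S1}.
have -> : ('C(0, r))%:R * (t ^+ 0 * (1 - t) ^+ (m.+1 - 0)) +
   \sum_(i < m.+1) ('C(m, i.+1) * 'C(i.+1, r))%:R * (t ^+ i.+1 * (1 - t) ^+ (m - i)) =
   (1 - t) * ('C(m, r)%:R * t ^+ r).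
  rewrite -IH [in RHS]big_ord_recl/= bin0 mul1n mulrDr; congr (_ + _).
    by rewrite !subn0 exprS; ring.
  rewrite big_ord_recr/= bin_small// mul0n mul0r addr0 mulr_sumr.
  apply: eq_bigr => i _; rewrite /bump leq0n add1n.
  by rewrite -(subnSK (ltn_ord i)) [(1 - t) ^+ _.+1]exprS; ring.
have -> : \sum_(i < m.+1) ('C(m, i) * 'C(i.+1, r))%:R * (t ^+ i.+1 * (1 - t) ^+ (m - i))
  = t * (\sum_(i < m.+1) ('C(m, i) * 'C(i.+1, r))%:R * (t ^+ i * (1 - t) ^+ (m - i))).
  by rewrite mulr_sumr; apply: eq_bigr => i _; rewrite exprS; ring.
case: r => [|r].
  have -> : \sum_(i < m.+1) ('C(m, i) * 'C(i.+1, 0))%:R * (t ^+ i * (1 - t) ^+ (m - i))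
      = 'C(m, 0)%:R * t ^+ 0.
    by rewrite -IH; apply: eq_bigr => i _; rewrite !bin0.
  by rewrite !bin0; ring.
under eq_bigr do rewrite binS mulnDr natrD mulrDl.
by rewrite big_split/= !IH binS natrD exprS; ring.
Qed.

End RandomSubsets.

Section LocalToGlobal.
Variables (R : realType) (V : finType) (Psi : {set V} -> R) (k : nat).
Local Notation n := #|V|.
Hypothesis Psi_mono : forall A u, Psi A <= Psi (u |: A).
Hypothesis Psi_local : forall A : {set V},
  - k%:R * \sum_(u | u \notin A) (Psi (u |: A) - Psi A) <=
  \sum_(u | u \notin A) \sum_(v | (v \notin A) && (v != u))
    (Psi (u |: (v |: A)) - Psi (u |: A) - Psi (v |: A) + Psi A).

Let N j := \sum_(A : {set V} | #|A| == j) Psi A.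
Let a j := N j / 'C(n, j)%:R.

Let N_succ j : (j < n)%N ->
  j.+1%:R * N j.+1 = 'C(n, j)%:R * (n - j)%:R * a j.+1.
Proof.
move=> jn; rewrite -natrM mulnC -mul_bin_left natrM /a -mulrA; congr (_ * _).
by rewrite mulrCA divff ?mulr1// pnatr_eq0 -lt0n bin_gt0.
Qed.

Let N_a j : (j <= n)%N -> N j = 'C(n, j)%:R * a j.
Proof.
by move=> jn; rewrite /a mulrCA divff ?mulr1// pnatr_eq0 -lt0n bin_gt0.
Qed.

Let card_notin (A : {set V}) j : #|A| = j -> #|[pred u | u \notin A]| = (n - j)%N.
Proof.
move=> <-; rewrite -(cardC A) addKn; apply: eq_card => u.
by rewrite !inE.
Qed.

Let card_notin2 (A : {set V}) u j : #|A| = j -> u \notin A ->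
  #|[pred v | (v \notin A) && (v != u)]| = (n - j).-1.
Proof.
move=> Aj uA; rewrite -(card_notin Aj) [in RHS](cardD1 u) inE uA add1n/=.
by apply: eq_card => v; rewrite !inE andbC.
Qed.

Let a_mono j : (j < n)%N -> a j <= a j.+1.
Proof.
move=> jn; have C0 : (0 : R) < 'C(n, j)%:R * (n - j)%:R.
  by rewrite -natrM ltr0n muln_gt0 bin_gt0 (ltnW jn) subn_gt0.
rewrite -(ler_pM2l C0) -N_succ// -sum_setU1 mulrAC -N_a ?(ltnW jn)//.
rewrite mulr_suml; apply: ler_sum => A /eqP Aj.
rewrite mulr_natr -(card_notin Aj) -sumr_const; apply: ler_sum => u _.
exact: Psi_mono.
Qed.

Let a_local j : (j.+1 < n)%N ->
  - k%:R * (a j.+1 - a j) <=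
  (n - j.+1)%:R * (a j.+2 - a j.+1 - (a j.+1 - a j)).
Proof.
move=> jn; have jn' := ltnW jn; set m := (n - j.+1)%N.
have nj : (n - j)%N = m.+1 by rewrite /m subnSK.
have C0 : (0 : R) < 'C(n, j)%:R * (n - j)%:R.
  by rewrite -natrM ltr0n muln_gt0 bin_gt0 (ltnW jn') subn_gt0.
have S1 : \sum_(A : {set V} | #|A| == j) \sum_(u | u \notin A) (Psi (u |: A) - Psi A)
    = 'C(n, j)%:R * (n - j)%:R * (a j.+1 - a j).
  under eq_bigr do rewrite sumrB.
  rewrite sumrB sum_setU1 N_succ// mulrBr; congr (_ - _).
  rewrite mulrAC -N_a ?(ltnW jn')// mulr_suml; apply: eq_bigr => A /eqP Aj.
  by rewrite sumr_const (card_notin Aj) mulr_natr.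
have S2 : \sum_(A : {set V} | #|A| == j) \sum_(u | u \notin A)
   \sum_(v | (v \notin A) && (v != u)) Psi (u |: (v |: A)) =
   'C(n, j)%:R * (n - j)%:R * m%:R * a j.+2.
  transitivity (\sum_(A : {set V} | #|A| == j) \sum_(v | v \notin A)
     \sum_(u | u \notin v |: A) Psi (u |: (v |: A))).
    apply: eq_bigr => A _; rewrite (exchange_big_dep (fun v => v \notin A))/=.
      apply: eq_bigr => v vA; apply: eq_bigl => u; rewrite !inE negb_or vA/=.
      by rewrite eq_sym andbC.
    by move=> u v _ /andP[].
  rewrite (sum_setU1 j (fun B => \sum_(u | u \notin B) Psi (u |: B))) sum_setU1.
  rewrite N_succ// mulrA mulrA; congr (_ * _ * _).
  by rewrite -!natrM mul_bin_left mulnC.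
have S3 : \sum_(A : {set V} | #|A| == j) \sum_(u | u \notin A)
   \sum_(v | (v \notin A) && (v != u)) Psi (u |: A) =
   'C(n, j)%:R * (n - j)%:R * m%:R * a j.+1.
  rewrite mulrAC -N_succ// -sum_setU1 mulr_suml; apply: eq_bigr => A /eqP Aj.
  rewrite mulr_suml; apply: eq_bigr => u uA.
  by rewrite sumr_const (card_notin2 Aj uA) nj mulr_natr.
have S4 : \sum_(A : {set V} | #|A| == j) \sum_(u | u \notin A)
   \sum_(v | (v \notin A) && (v != u)) Psi (v |: A) =
   'C(n, j)%:R * (n - j)%:R * m%:R * a j.+1.
  rewrite -S3; apply: eq_bigr => A _.
  rewrite (exchange_big_dep (fun v => v \notin A))/=; last by move=> u v _ /andP[].
  by apply: eq_bigr => v vA; apply: eq_bigl => u; rewrite vA eq_sym.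
have S5 : \sum_(A : {set V} | #|A| == j) \sum_(u | u \notin A)
   \sum_(v | (v \notin A) && (v != u)) Psi A =
   'C(n, j)%:R * (n - j)%:R * m%:R * a j.
  rewrite mulrAC [X in X * _]mulrAC -N_a ?(ltnW jn')// !mulr_suml.
  apply: eq_bigr => A /eqP Aj.
  rewrite -mulrA mulrC mulrAC mulr_natr -mulrnAr.
  rewrite (eq_bigr (fun=> Psi A *+ m)) => [|u uA]; last first.
    by rewrite sumr_const (card_notin2 Aj uA) nj.
  by rewrite sumr_const (card_notin Aj) mulr_natl.
have : - k%:R * ('C(n, j)%:R * (n - j)%:R * (a j.+1 - a j)) <=
  'C(n, j)%:R * (n - j)%:R * m%:R * a j.+2 - 'C(n, j)%:R * (n - j)%:R * m%:R * a j.+1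
  - 'C(n, j)%:R * (n - j)%:R * m%:R * a j.+1 + 'C(n, j)%:R * (n - j)%:R * m%:R * a j.
  rewrite -S1 -S2 -{1}S3 -S4 -S5 mulr_sumr -!sumrB -big_split.
  apply: ler_sum => A _; apply: le_trans (Psi_local A) _.
  rewrite -!sumrB -big_split /= le_eqVlt; apply/orP; left; apply/eqP.
  by apply: eq_bigr => u _; rewrite -!sumrB -big_split.
move=> h; rewrite -(ler_pM2l C0); lra.
Qed.

Let E (l : nat) := a n - a (n - l)%N.

Let E_ge0 (l : nat) : 0 <= E l.
Proof.
rewrite subr_ge0; elim: l => [|l IH]; first by rewrite subn0.
apply: le_trans IH; have [ln|nl] := ltnP l n.
  by rewrite -(subnSK ln) a_mono// subnS prednK ?subn_gt0// leq_subr.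
have /eqP -> : (n - l.+1 == 0)%N by rewrite subn_eq0 (leq_trans nl).
by have /eqP -> : (n - l == 0)%N by rewrite subn_eq0.
Qed.

Let E_increment l : (l < n)%N ->
  (l%:R - k%:R) * (E l.+1 - E l) <= k.+1%:R * E l.
Proof.
elim: l => [|l IH] ln.
  rewrite /E !subn0 subrr mulr0 sub0r mulNr oppr_le0 mulr_ge0// subr0.
  exact: (E_ge0 1).
have {IH} := IH (ltnW ln).
have := @a_local (n - l.+2)%N; have j1 : (n - l.+2).+1 = (n - l.+1)%N by rewrite subnSK.
have j2 : (n - l.+1).+1 = (n - l)%N by rewrite subnSK// ltnW.
rewrite j1 j2 subKn ?(ltnW ln)//.
move=> /(_ (leq_subr _ _)); rewrite /E -!natr1 => h IH.
move: (a n) (a (n - l)%N) (a (n - l.+1)%N) (a (n - l.+2)%N) h IH => an a0 a1 a2 h IH.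
lra.
Qed.

Let E_ratio l : (l < n)%N -> 'C(l, k.+1)%:R * E l.+1 <= 'C(l.+1, k.+1)%:R * E l.
Proof.
move=> ln; rewrite binS natrD mulrDl -lerBlDl -mulrBr.
have [kl|lk] := leqP k l; last first.
  by rewrite (bin_small lk) (@bin_small l k.+1 (ltnW lk)) !mul0r.
rewrite -(@ler_pM2l _ k.+1%:R) ?ltr0n// mulrA -natrM mul_bin_left natrM.
rewrite natrB// mulrAC mulrC [leRHS]mulrCA ler_wpM2l//; exact: E_increment.
Qed.

Let E_ge l : (l <= n)%N -> 'C(l, k.+1)%:R * E n <= 'C(n, k.+1)%:R * E l.
Proof.
move=> ln; rewrite -(subKn ln); move: (n - l)%N (leq_subr l n) => {ln} d.
elim: d => [|d IH] dn; first by rewrite subn0.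
have lt : (n - d.+1 < n)%N by rewrite ltn_subrL (leq_ltn_trans _ dn).
have {IH} := IH (ltnW dn); have := E_ratio lt; rewrite subnSK// => h1 h2.
have [l0|l0] := posnP 'C(n - d, k.+1).
  rewrite (_ : 'C(n - d.+1, k.+1) = 0%N); first by rewrite mul0r mulr_ge0.
  by apply/eqP; rewrite -leqn0 -l0 leq_bin2l// leq_sub2l.
have C0 : (0 : R) < 'C(n - d, k.+1)%:R by rewrite ltr0n.
rewrite -(ler_pM2l C0).
apply: (@le_trans _ _ ('C(n - d.+1, k.+1)%:R * ('C(n, k.+1)%:R * E (n - d)%N))).
  by rewrite mulrCA ler_wpM2l.
by rewrite mulrCA [leRHS]mulrCA ler_wpM2l.
Qed.

(** The increments of the average of [Psi] over subsets of a given size satisfy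
    a linear recurrence whose solution is a binomial coefficient; averaging over
    a random size, with probabilities of a binomial law, telescopes to a power
    of [t]. *)
Lemma random_block_ge (t : R) : 0 <= t <= 1 ->
  t ^+ k.+1 * (Psi [set: V] - Psi set0) <=
  \sum_(S : {set V}) bern t S * (Psi [set: V] - Psi (~: S)).
Proof.
move=> t01; have [t0 t1] := andP t01.
have aT : a n = Psi [set: V].
  rewrite /a /N (big_pred1 [set: V]) ?binn ?divr1// => A /=.
  rewrite eqEcard subsetT /= cardsT; have := max_card (mem A).
  by rewrite leq_eqVlt; case: ltngtP.
have a0 : a 0 = Psi set0.
  by rewrite /a /N (big_pred1 set0) ?bin0 ?divr1// => A /=; rewrite cards_eq0.
have En : E n = Psi [set: V] - Psi set0 by rewrite /E subnn aT a0.
have sumE l : (l <= n)%N -> \sum_(S : {set V} | #|S| == l)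
    (Psi [set: V] - Psi (~: S)) = 'C(n, l)%:R * E l.
  move=> ln; rewrite sumrB mulrBr; congr (_ - _).
    by rewrite sumr_const -cardsE card_draws aT mulr_natl.
  rewrite -(bin_sub ln) -N_a ?leq_subr// /N (reindex_inj (inv_inj (@setCK V)))/=.
  apply: eq_big => [A|A _]; last by rewrite setCK.
  have cA := cardsC A; apply/eqP/eqP => e.
    by rewrite -(addnK #|~: A| #|A|) cA e.
  by rewrite -(addKn #|A| #|~: A|) cA e subKn.
have S : \sum_(S : {set V}) bern t S * (Psi [set: V] - Psi (~: S)) =
    \sum_(l < n.+1) 'C(n, l)%:R * (t ^+ l * (1 - t) ^+ (n - l)) * E l.
  rewrite sum_by_card; apply: eq_bigr => l _.
  have ln : (l <= n)%N by rewrite -ltnS ltn_ord.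
  rewrite mulrAC -(sumE _ ln) mulr_suml; apply: eq_bigr => B /eqP e.
  by rewrite /bern e mulrC.
(* If [n <= k], no subset has [k + 1] elements; then [S = V] alone has a
   sufficient probability. *)
rewrite S -En; have [nk|kn] := ltnP n k.+1.
  apply: (@le_trans _ _ (t ^+ n * E n)).
    by rewrite ler_wpM2r// ler_wiXn2l// ltnW.
  rewrite big_ord_recr/= binn subnn expr0 mulr1 mul1r lerDr sumr_ge0// => l _.
  by rewrite mulr_ge0// mulr_ge0// mulr_ge0 ?exprn_ge0// subr_ge0.
have C0 : (0 : R) < 'C(n, k.+1)%:R by rewrite ltr0n bin_gt0.
rewrite -(ler_pM2l C0) mulrA -sum_bin_bern mulr_suml mulr_sumr.
apply: ler_sum => l _; set w := t ^+ l * _.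
have w0 : 0 <= w by rewrite mulr_ge0 ?exprn_ge0 ?subr_ge0.
have -> : ('C(n, l) * 'C(l, k.+1))%:R * w * E n =
    'C(n, l)%:R * w * ('C(l, k.+1)%:R * E n) by rewrite natrM; ring.
have -> : 'C(n, k.+1)%:R * ('C(n, l)%:R * w * E l) =
    'C(n, l)%:R * w * ('C(n, k.+1)%:R * E l) by ring.
have cw0 : 0 <= 'C(n, l)%:R * w by rewrite mulr_ge0.
by apply: (ler_wpM2l cw0); apply: E_ge; rewrite -ltnS ltn_ord.
Qed.

End LocalToGlobal.

(** * Spatial Markov property and commuting block updates *)

Section SpatialMarkov.
Variables (R : realType) (q : nat) (V : finType) (mu : {ffun V -> 'I_q} -> R).
Local Notation config := {ffun V -> 'I_q}.
Hypothesis mu_ge0 : forall s, 0 <= mu s.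
Variable adj : rel V.
Implicit Types (s x y z : config) (A B : {set V}).

Definition mix A s x : config := [ffun v => if v \in A then s v else x v].

(** The multiplicative form of the spatial Markov property: [s] and [x] may
    exchange their spins on [A] when they agree on the boundary of [A]. *)
Definition markov_field := forall A s x,
  (forall u v, u \in A -> v \notin A -> adj u v -> s v = x v) ->
  mu s * mu x = mu (mix A s x) * mu (mix A x s).

Hypothesis hM : markov_field.

Definition nonadjacent A B :=
  (forall v, v \in A -> v \notin B) /\ (forall u v, u \in A -> v \in B -> ~~ adj u v).

Section Blocks.
Variables (A B : {set V}).
Hypothesis sAB : nonadjacent A B.

Let mem_T v : (v \in ~: (A :|: B)) = (v \notin A) && (v \notin B).
Proof. by rewrite !inE negb_or. Qed.

Let fiber_mix s y x : y \in pinned (~: (A :|: B)) s ->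
  (x \in pinned (~: A) s) && (x \in pinned (~: B) y) = (x == mix A y s).
Proof.
move=> /pinnedP ys; apply/andP/eqP => [[/pinnedP xs /pinnedP xy]|->].
  apply/ffunP => v; rewrite ffunE; case: ifP => [vA|/negbT vA].
    by rewrite xy// inE (proj1 sAB).
  by rewrite xs// inE.
split; apply/pinnedP => v; rewrite inE ffunE => vN; first by rewrite (negPf vN).
by case: ifP => // /negbT vA; rewrite ys// mem_T vA.
Qed.

Let fiber_sub s y x : x \in pinned (~: A) s -> y \in pinned (~: B) x ->
  y \in pinned (~: (A :|: B)) s.
Proof.
move=> /pinnedP xs /pinnedP yx; apply/pinnedP => v; rewrite mem_T => /andP[vA vB].
by rewrite yx ?inE// xs ?inE.
Qed.

(* Exchanging the spins on [A] of [s] and of the configurations [z] in the fibre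
   of [y] maps that fibre onto the fibre of [s]. *)
Let prob_exchange s y : y \in pinned (~: (A :|: B)) s ->
  prob mu (pinned (~: B) y) * mu s = mu (mix A y s) * prob mu (pinned (~: B) s).
Proof.
move=> /pinnedP ys; rewrite /prob mulr_suml mulr_sumr.
rewrite [RHS](reindex_onto (fun z => mix A s z) (fun z => mix B z y)); last first.
  move=> z /pinnedP zs; apply/ffunP => v; rewrite !ffunE.
  case: ifP => [vA|/negbT vA]; first by rewrite zs// inE (proj1 sAB).
  by case: ifP => // /negbT vB; rewrite ys ?mem_T ?vA// zs// inE.
have AB v : v \in A -> v \in B = false by move=> /(proj1 sAB)/negPf.
apply: eq_big => [z|z /pinnedP zy]; last first.
  rewrite (@hM A) => [|u v uA vA uv]; last first.
    have vB : v \notin B by apply: contraL uv => vB; apply: (proj2 sAB).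
    by rewrite zy ?inE// ys// mem_T vA.
  congr (mu _ * _); apply/ffunP => v; rewrite !ffunE; case: ifP => // vA.
  by rewrite zy// inE AB.
apply/pinnedP/andP => [zy|[/pinnedP zs /eqP <-] v]; last first.
  by rewrite inE !ffunE => /negPf ->.
split.
  apply/pinnedP => v; rewrite inE ffunE => vB; case: ifP => // /negbT vA.
  by rewrite zy ?inE// ys// mem_T vA.
apply/eqP/ffunP => v; rewrite !ffunE; case: ifP => [vB|/negbT vB].
  by case: ifP => // /AB; rewrite vB.
by rewrite zy// inE.
Qed.

(** Updates of blocks without edges between them compose to the update of their
    union: conditionally on the outside, the blocks are independent. *)
Lemma condE_block f s : 0 < mu s ->
  condE mu (~: A) (condE mu (~: B) f) s = condE mu (~: (A :|: B)) f s.
Proof.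
move=> s0; pose T := ~: (A :|: B).
pose c := mu s / (prob mu (pinned (~: A) s) * prob mu (pinned (~: B) s)).
have key g : condE mu (~: A) (condE mu (~: B) g) s =
    c * \sum_(y in pinned T s) mu y * g y.
  rewrite {1}/condE mulr_suml mulr_sumr.
  under eq_bigr do rewrite /condE mulrA mulr_sumr 2!mulr_suml.
  rewrite (exchange_big_dep (fun y => y \in pinned T s))/=; last first.
    by move=> x y; apply: fiber_sub.
  apply: eq_bigr => y yT; rewrite (big_pred1 (mix A y s)) => [|x /=]; last first.
    by rewrite -(fiber_mix _ yT) [y \in _]pinned_sym.
  have /andP[_ xy] : (mix A y s \in pinned (~: A) s) &&
      (mix A y s \in pinned (~: B) y) by rewrite fiber_mix.
  rewrite (pinned_eq xy).
  have [->|y0] := mu_gt0P mu_ge0 y; first by rewrite !(mul0r, mulr0).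
  have pB := prob_pinned_gt0 mu_ge0 (~: B) s0.
  have pA := prob_pinned_gt0 mu_ge0 (~: A) s0.
  have py := prob_pinned_gt0 mu_ge0 (~: B) y0.
  have -> : mu (mix A y s) = prob mu (pinned (~: B) y) * mu s /
      prob mu (pinned (~: B) s).
    by rewrite prob_exchange// mulfK// gt_eqF.
  by rewrite /c; field; rewrite !gt_eqF.
(* The constant [c] is identified by averaging the function [1]. *)
have := key (fun=> 1).
rewrite (eq_condE mu_ge0 (g := fun=> 1)) => [|x _ x0]; last by rewrite condE_cst.
rewrite condE_cst// => e; rewrite key.
have pT := prob_pinned_gt0 mu_ge0 T s0.
have {e} : c * prob mu (pinned T s) = 1.
  by rewrite e; congr (_ * _); apply: eq_bigr => y _; rewrite mulr1.
move=> e; rewrite /condE -/T mulrC; congr (_ * _).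
by apply: (mulIf (lt0r_neq0 pT)); rewrite e mulVf ?lt0r_neq0.
Qed.

End Blocks.

End SpatialMarkov.

(** * Components of a random set of vertices *)

Section Components.
Variables (V : finType) (adj : rel V).
Hypothesis adj_sym : symmetric adj.
Implicit Types (S C A : {set V}) (u v w : V).

Definition induced S : rel V := fun u v => [&& u \in S, v \in S & adj u v].
Definition component S v : {set V} := [set u | connect (induced S) v u].
Definition isolated_vertices S : {set V} := [set v in S | [forall u in S, ~~ adj v u]].
Definition components_at v : {set {set V}} :=
  [set component S v | S : {set V} & v \in S].

Lemma induced_sym S : symmetric (induced S).
Proof. by move=> u v; rewrite /induced adj_sym andbCA. Qed.

Lemma induced_connect_sym S : connect_sym (induced S).
Proof. exact/sym_connect_sym/induced_sym. Qed.

Lemma component_refl S v : v \in component S v.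
Proof. by rewrite inE connect0. Qed.

Lemma component_sub S v : v \in S -> component S v \subset S.
Proof.
move=> vS; apply/subsetP => u; rewrite inE.
have cl : fingraph.closed (induced S) (mem S) by move=> x y /and3P[-> ->].
by move/(closed_connect cl) <-.
Qed.

Lemma component_eq S u v : u \in component S v -> component S u = component S v.
Proof.
rewrite inE => vu; apply/setP => w; rewrite !inE.
by rewrite (same_connect (@induced_connect_sym S) vu).
Qed.

Lemma component_adj S u v w : u \in S -> w \in S -> u \in component S v ->
  adj u w -> w \in component S v.
Proof.
move=> uS wS; rewrite !inE => vu uw; apply: connect_trans vu _.
by apply: connect1; rewrite /induced uS wS.
Qed.

Lemma isolatedP S v :
  reflect (v \in S /\ forall u, u \in S -> ~~ adj v u) (v \in isolated_vertices S).
Proof.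
rewrite inE; apply: (iffP andP) => -[vS H]; split=> //; first exact/forall_inP.
exact/forall_inP.
Qed.

Lemma component_isolated S v : v \in isolated_vertices S -> component S v = [set v].
Proof.
move=> /isolatedP[vS H]; apply/setP => u; rewrite !inE.
have cl : fingraph.closed (induced S) (pred1 v).
  apply: intro_closed; first exact: induced_connect_sym.
  by move=> x y /and3P[_ yS xy] /eqP e; move: xy; rewrite e (negPf (H y yS)).
apply/idP/eqP => [/(closed_connect cl)|->]; last exact: connect0.
by rewrite !inE eqxx => /esym/eqP.
Qed.

(** A depth-first traversal of a connected set [C] is a walk with at most
    [2 (#|C| - 1)] steps: a walk that misses a vertex of [C] passes next to one,
    and can be extended by a detour of two steps. *)
Lemma component_walk S v : v \in S ->
  exists2 p, path adj v p /\ [set u in v :: p] = component S v &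
             (size p <= 2 * (#|component S v|.-1))%N.
Proof.
move=> vS; set C := component S v.
suff H d p : path (induced S) v p -> [set u in v :: p] \subset C ->
    ((size p).+2 <= 2 * #|[set u in v :: p]|)%N ->
    (#|C| - #|[set u in v :: p]| = d)%N ->
    exists2 p', path adj v p' /\ [set u in v :: p'] = C &
                (size p' <= 2 * #|C|.-1)%N.
  have s1 : [set u in [:: v]] = [set v] by apply/setP => u; rewrite !inE.
  apply: (H (#|C| - #|[set u in [:: v]]|)%N [::]) => //.
    by rewrite s1 sub1set component_refl.
  by rewrite s1 cards1.
elim: d p => [|d IH] p pp sub sz ed.
  have e : [set u in v :: p] = C.
    by apply/eqP; rewrite eqEcard sub -subn_eq0 ed.
  exists p; last first.
    rewrite -e; move: sz; case: #|_| => // m; rewrite mulnS /=.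
    by rewrite ltnS ltnS.
  split=> //; apply: sub_path pp => x y; by case/and3P.
have [[u w]|no] := pickP [pred uw : V * V |
    [&& uw.1 \in v :: p, uw.2 \notin v :: p & induced S uw.1 uw.2]].
  rewrite /= => /and3P[up wp uw].
  case/splitPl: up wp pp sub sz ed => p1 p2 lu wp.
  rewrite cat_path lu => /andP[pp1 pp2] sub sz ed.
  pose p' := p1 ++ [:: w, u & p2].
  have e' : [set x in v :: p'] = w |: [set x in v :: (p1 ++ p2)].
    apply/setP => x; rewrite !inE !mem_cat !inE.
    have : u \in v :: p1 by rewrite -lu mem_last.
    rewrite inE => hu; have [->|_] := eqVneq x u => /=.
      by move: hu; case: (u == v); case: (u \in p1); case: (u == w).
    by case: (x == v); case: (x \in p1); case: (x == w).
  have card' : #|[set x in v :: p']| = #|[set x in v :: (p1 ++ p2)]|.+1.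
    by rewrite e' cardsU1 inE wp add1n.
  apply: (IH p').
  - by rewrite cat_path lu pp1/= uw induced_sym uw.
  - rewrite e' subUset sub andbT sub1set inE.
    have : u \in C by rewrite (subsetP sub)// in_set -cat_cons mem_cat -lu mem_last.
    rewrite inE => vu; apply: connect_trans vu (connect1 uw).
  - rewrite card' mulnS size_cat/= !addnS -size_cat; move: sz.
    by rewrite 2!ltnS.
  - by rewrite card' subnS ed.
have cl : fingraph.closed (induced S) (mem (v :: p)).
  apply: intro_closed; first exact: induced_connect_sym.
  move=> x y xy xp; have := no (x, y); rewrite /= xp xy andbT /= => /negbFE.
  exact.
suff e : [set u in v :: p] = C by move: ed; rewrite e subnn.
apply/eqP; rewrite eqEsubset sub; apply/subsetP => x; rewrite !inE => vx.
by have := closed_connect cl vx; rewrite !inE eqxx.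
Qed.

(** The sets [A :|: W], where [W] is the set of vertices visited after the start by
    a walk of [l] steps from [v]. *)
Fixpoint covered l v A : {set {set V}} :=
  if l is l'.+1 then \bigcup_(w | adj v w) covered l' w (w |: A) else [set A].

Lemma path_covered v A p : path adj v p ->
  A :|: [set u in p] \in covered (size p) v A.
Proof.
elim: p v A => [|w p IH] v A /=.
  by move=> _; rewrite inE; apply/eqP/setP => u; rewrite !inE orbF.
move=> /andP[vw /(IH _ (w |: A)) H]; apply/bigcupP; exists w => //.
rewrite (_ : A :|: _ = w |: A :|: [set u in p])//.
by apply/setP => u; rewrite !inE orbA [(u \in A) || _]orbC.
Qed.

Lemma card_covered d l v A : (forall v, #|[set w | adj v w]| <= d)%N ->
  (#|covered l v A| <= d ^ l)%N.
Proof.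
move=> hd; elim: l v A => [|l IH] v A /=; first by rewrite cards1.
apply: (@leq_trans (\sum_(w | adj v w) #|covered l w (w |: A)|)).
  elim/big_rec2: _ => [|w m B _ mB]; first by rewrite cards0.
  by apply: leq_trans (leq_card_setU _ _) _; rewrite leq_add2l.
apply: (@leq_trans (\sum_(w | adj v w) d ^ l)); first exact: leq_sum.
by rewrite sum_nat_const expnS leq_mul2r -cardsE hd orbT.
Qed.

(** Each component at [v] is the range of a walk from [v] of length at most
    [2 (#|C| - 1)], and there are at most [d ^ l] walks of length [l]. *)
Lemma sum_components_le (R : realType) (z : R) d v :
  (forall v, #|[set w | adj v w]| <= d)%N -> 0 <= z <= 1 -> d%:R * z <= 2^-1 ->
  \sum_(C in components_at v) (z ^+ 2) ^+ #|C|.-1 <= 2.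
Proof.
move=> hd /andP[z0 z1] dz; pose L := (2 * #|V|).+1.
apply: (@le_trans _ _ (\sum_(C : {set V}) \sum_(l < L | C \in covered l v [set v]) z ^+ l)).
  rewrite big_mkcond; apply: ler_sum => C _; case: ifP => [|_]; last first.
    by apply: sumr_ge0 => l _; rewrite exprn_ge0.
  move=> /imsetP[S /[!inE] vS ->]; have [p [pp pC] sp] := component_walk vS.
  have pL : (size p < L)%N.
    rewrite ltnS (leq_trans sp)// leq_mul2l (leq_trans (leq_pred _))//.
    exact: max_card.
  have pcov : component S v \in covered (size p) v [set v].
    rewrite -pC (_ : [set u in v :: p] = [set v] :|: [set u in p]).
      exact: path_covered.
    by apply/setP => u; rewrite !inE.
  rewrite (bigD1 (Ordinal pL))//= -exprM.
  apply: (@le_trans _ _ (z ^+ size p)); first by rewrite ler_wiXn2l.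
  by rewrite lerDl sumr_ge0// => l _; rewrite exprn_ge0.
rewrite (exchange_big_dep xpredT)//=.
apply: (@le_trans _ _ (\sum_(l < L) 2^-1 ^+ l)).
  apply: ler_sum => l _; rewrite sumr_const.
  apply: (@le_trans _ _ ((d%:R * z) ^+ l)); last by rewrite lerXn2r ?nnegrE ?mulr_ge0.
  rewrite exprMn -natrX -[leLHS]mulr_natl ler_wpM2r ?exprn_ge0// ler_nat.
  exact: card_covered.
suff -> : \sum_(l < L) (2^-1 : R) ^+ l = 2 - 2 * 2^-1 ^+ L.
  by rewrite gerBl mulr_ge0// exprn_ge0.
elim: L => [|m IH]; first by rewrite big_ord0 expr0 mulr1 subrr.
by rewrite big_ord_recr/= IH exprS; field.
Qed.

End Components.

Section ComponentSum.
Variables (R : realType) (q : nat) (V : finType) (mu : {ffun V -> 'I_q} -> R).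
Local Notation config := {ffun V -> 'I_q}.
Hypothesis mu_ge0 : forall s, 0 <= mu s.
Variable adj : rel V.
Hypotheses (adj_sym : symmetric adj) (adj_irr : irreflexive adj).
Hypothesis hM : markov_field mu adj.
Implicit Types (S C U W : {set V}) (u v w : V) (f g : config -> R).
Local Notation E B := (condE mu (~: B)).

(** The mean of the conditional entropies of [f] in the block [B]. *)
Definition block_ent B f := Phi mu f - Phi mu (E B f).

Lemma block_ent_ge0 B f : (forall x, 0 < mu x -> 0 <= f x) -> 0 <= block_ent B f.
Proof. by move=> f0; rewrite subr_ge0 Phi_condE_le. Qed.

Lemma Phi_block2 (A B : {set V}) f : nonadjacent adj A B ->
  Phi mu (E A (E B f)) = Phi mu (E (A :|: B) f).
Proof. by move=> sAB; apply: eq_Phi => // s s0; exact: (condE_block mu_ge0 hM sAB). Qed.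

Lemma nonadjacent_sym (A B : {set V}) : nonadjacent adj A B -> nonadjacent adj B A.
Proof.
move=> [H1 H2]; split=> [v vB|u v uB vA]; last by rewrite adj_sym H2.
by apply: contraL vB => /H1.
Qed.

Lemma nonadjacentUr (A B C : {set V}) :
  nonadjacent adj A B -> nonadjacent adj A C -> nonadjacent adj A (B :|: C).
Proof.
move=> [h1 h2] [h3 h4]; split=> [v vA|u v uA]; first by rewrite inE negb_or h1 ?h3.
by rewrite inE => /orP[]; [exact: h2|exact: h4].
Qed.

Lemma nonadjacentW (A B A' B' : {set V}) : A' \subset A -> B' \subset B ->
  nonadjacent adj A B -> nonadjacent adj A' B'.
Proof.
move=> sA sB [h1 h2]; split=> [v vA|u v uA vB].
  by apply: contra (h1 v (subsetP sA v vA)); exact: (subsetP sB).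
by apply: h2; [exact: (subsetP sA)|exact: (subsetP sB)].
Qed.

(** Averaging over more sites away from [v] can only decrease the entropy that
    remains at [v]: this is submodularity, as these averages commute with the
    update at [v]. *)
Lemma block_ent_mono v W U f : (forall x, 0 < mu x -> 0 <= f x) ->
  W \subset U -> nonadjacent adj [set v] U -> nonadjacent adj (U :\: W) W ->
  block_ent [set v] (E U f) <= block_ent [set v] (E W f).
Proof.
move=> f0 WU vU UW; set h := E W f.
have h0 x : 0 < mu x -> 0 <= h x by move=> _; exact: condE_ge0.
have eU : (U :\: W) :|: W = U by rewrite setUC -{1}(setIidPr WU) setID.
have e1 : Phi mu (E U f) = Phi mu (E (U :\: W) h) by rewrite Phi_block2// eU.
have vUW : nonadjacent adj [set v] (U :\: W).
  by apply: nonadjacentW vU => //; exact: subsetDl.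
have e2 : Phi mu (E [set v] (E U f)) = Phi mu (E ([set v] :|: (U :\: W)) h).
  rewrite Phi_block2// (_ : [set v] :|: U = ([set v] :|: (U :\: W)) :|: W); last first.
    by rewrite -setUA eU.
  apply/esym/Phi_block2/nonadjacent_sym/nonadjacentUr; last exact: nonadjacent_sym.
  by apply/nonadjacent_sym; apply: nonadjacentW vU.
have := @Phi_submod _ _ _ mu mu_ge0 (~: ([set v] :|: (U :\: W)))
  (~: (U :\: W)) (~: [set v]) h h0.
rewrite !setCS subsetUl subsetUr => /(_ isT isT).
move=> /(_ (fun s s0 => condE_block mu_ge0 hM vUW h s0)).
rewrite /block_ent e1 e2; lra.
Qed.

(* An arbitrary linear order of the vertices. *)
Local Notation rank v := (nat_of_ord (enum_rank v)).

Let rank_inj u v : rank u = rank v -> u = v.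
Proof. by move=> /val_inj/enum_rank_inj. Qed.

Definition below S v := [set w in isolated_vertices adj S | (rank w < rank v)%N].

(* The union of the components whose last vertex has rank less than [i]. *)
Let front S i := [set v in S | [forall u in component adj S v, (rank u < i)%N]].

Let frontP S i v :
  reflect (v \in S /\ forall u, u \in component adj S v -> (rank u < i)%N)
          (v \in front S i).
Proof.
rewrite inE; apply: (iffP andP) => -[vS H]; split=> //; first exact/forall_inP.
exact/forall_inP.
Qed.

Let front_succ S i : front S i.+1 != front S i ->
  exists2 v0, v0 \in S & let C := component adj S v0 in
    [/\ front S i.+1 = C :|: front S i,
        forall v, v \in C -> (rank v < i.+1)%N,
        nonadjacent adj C (front S i) & [disjoint C & front S i]].
Proof.
move=> neq.
have sub : front S i \subset front S i.+1.
  apply/subsetP => v /frontP[vS H]; apply/frontP; split=> // u /H.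
  exact: ltnW.
have /subsetPn[v1 v1f v1n] : ~~ (front S i.+1 \subset front S i).
  by apply: contra neq => h; rewrite eqEsubset h.
have [v1S v1r] := frontP _ _ _ v1f.
have ex v : v \in front S i.+1 -> v \notin front S i ->
    exists2 u, u \in component adj S v & rank u = i.
  move=> /frontP[vS vr] vn; move: vn; rewrite inE vS/= negb_forall_in.
  move=> /exists_inP[u uv]; rewrite -leqNgt => iu; exists u => //.
  by apply/eqP; rewrite eqn_leq iu andbT -ltnS vr.
have [v0 v0C v0i] := ex v1 v1f v1n.
have eC := component_eq adj_sym v0C.
have v0S : v0 \in S by exact: (subsetP (component_sub adj v1S)).
have CS w : w \in component adj S v0 -> w \in S.
  by move=> wC; exact: (subsetP (component_sub adj v0S)).
have nC w : w \in component adj S v0 -> w \notin front S i.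
  move=> wC; apply/negP => /frontP[_]; rewrite (component_eq adj_sym wC).
  by move=> /(_ v0 (component_refl adj S _)); rewrite v0i ltnn.
exists v0 => //=; split.
- apply/setP => w; rewrite in_setU; apply/idP/orP => [wf|[wC|wf]].
  + have [wi|wi] := boolP (w \in front S i); first by right.
    left; have [u uw ui] := ex w wf wi.
    have -> : v0 = u by apply: rank_inj; rewrite v0i ui.
    by rewrite (component_eq adj_sym uw) component_refl.
  + apply/frontP; split=> [|u]; first exact: CS.
    by rewrite (component_eq adj_sym wC) eC; exact: v1r.
  + exact: (subsetP sub).
- by rewrite eC.
- split; first exact: nC.
  move=> u w uC wf; have [wS _] := frontP _ _ _ wf; apply: contraL wf => uw.
  by apply: nC; apply: (component_adj (CS u uC) wS uC uw).
- by rewrite disjoint_subset; apply/subsetP => w /nC.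
Qed.

Let front0 S : front S 0 = set0.
Proof.
apply/setP => v; rewrite in_set0; apply/negP => /frontP[_].
by move=> /(_ v (component_refl adj S _)); rewrite ltn0.
Qed.

Let frontT S : front S #|V| = S.
Proof.
by apply/setP => v; apply/frontP/idP => [[]//|vS]; split=> // u _; exact: ltn_ord.
Qed.

Variable c : nat -> R.
Hypothesis c0 : forall j, 0 <= c j.
Hypothesis hc : forall C f, (forall x, 0 < mu x -> 0 <= f x) ->
  block_ent C f <= c #|C| * \sum_(v in C) block_ent [set v] f.

Let front_ent S f i : (forall x, 0 < mu x -> 0 <= f x) ->
  Phi mu f - Phi mu (E (front S i) f) <=
  \sum_(v in front S i) c #|component adj S v| *
     block_ent [set v] (E (below S v :\: component adj S v) f).
Proof.
move=> f0; elim: i => [|i IH].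
  rewrite front0 big_set0 setC0 (@eq_Phi _ _ _ mu mu_ge0 (condE mu _ f) f) ?subrr//.
  by move=> s s0; rewrite condE_setT.
have [->//|/front_succ[v0 v0S]] := eqVneq (front S i.+1) (front S i).
move=> [eF Cr CF dCF]; set C := component adj S v0 in eF Cr CF dCF.
have CS w : w \in C -> w \in S by exact: (subsetP (component_sub adj v0S)).
rewrite eF (eq_bigl [predU C & front S i]) => [|v]; last first.
  by rewrite in_setU.
rewrite bigU//= -Phi_block2//.
set g := E (front S i) f in IH *.
have g0 x : 0 < mu x -> 0 <= g x by move=> _; exact: condE_ge0.
have -> : Phi mu f - Phi mu (E C g) = block_ent C g + (Phi mu f - Phi mu g).
  by rewrite /block_ent; ring.
apply: lerD; last exact: IH.
apply: le_trans (hc C g0) _; rewrite mulr_sumr; apply: ler_sum => v vC.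
rewrite (component_eq adj_sym vC) -/C ler_wpM2l//.
have isoN w u : w \in isolated_vertices adj S -> u \in S -> ~~ adj u w.
  by move=> /isolatedP[_ H] /H; rewrite adj_sym.
apply: block_ent_mono => //.
- apply/subsetP => w; rewrite in_setD => /andP[_].
  rewrite [w \in below S v]in_set => /andP[wI wv].
  have [wS _] := isolatedP _ _ _ wI; apply/frontP; split=> // u.
  rewrite (component_isolated adj_sym wI) inE => /eqP ->.
  by rewrite (leq_trans wv)// -ltnS Cr.
- by apply: nonadjacentW CF; rewrite ?sub1set.
- split=> [w|u w]; first by rewrite in_setD => /andP[].
  rewrite !in_setD => /andP[_ uF] /andP[_].
  rewrite [w \in below S v]in_set => /andP[wI _].
  by apply: isoN => //; have /frontP[] := uF.
Qed.

(** The components of [S] are updated in the order of their last vertices, so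
    that every isolated vertex of [S] that precedes [v] and lies outside the
    component of [v] has been averaged out before that component. *)
Lemma block_ent_components S f : (forall x, 0 < mu x -> 0 <= f x) ->
  block_ent S f <=
  \sum_(v in S) c #|component adj S v| *
     block_ent [set v] (E (below S v :\: component adj S v) f).
Proof. by move=> /(front_ent S #|V|); rewrite frontT. Qed.

(** The chain rule for the isolated vertices, updated in the order of their ranks;
    it is exact because their updates commute. *)
Lemma block_ent_isolated S f :
  block_ent (isolated_vertices adj S) f =
  \sum_(v in isolated_vertices adj S) block_ent [set v] (E (below S v) f).
Proof.
pose I i := [set w in isolated_vertices adj S | (rank w < i)%N].
have II : I #|V| = isolated_vertices adj S.
  by apply/setP => w; rewrite inE ltn_ord andbT.
rewrite -II; elim: #|V| => [|i IH].
  have -> : I 0 = set0 by apply/setP => w; rewrite !inE ltn0 andbF.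
  rewrite big_set0 /block_ent setC0 (@eq_Phi _ _ _ mu mu_ge0 (condE mu _ f) f) ?subrr//.
  by move=> s s0; rewrite condE_setT.
have [v|no] := pickP [pred v | (v \in isolated_vertices adj S) && (rank v == i)]; last first.
  suff -> : I i.+1 = I i by [].
  apply/setP => w; rewrite !inE ltnS leq_eqVlt.
  have := no w; rewrite !inE /=; case: (w \in S) => //=.
  by case: forallP => //= _ ->.
rewrite /= => /andP[vI /eqP vi].
have eI : I i.+1 = v |: I i.
  apply/setP => w; rewrite in_setU1 [LHS]in_set [w \in I i]in_set ltnS leq_eqVlt.
  have [->|wv] := eqVneq w v; first by rewrite vI vi eqxx.
  suff -> : (rank w == i) = false by [].
  by apply: contraNF wv => /eqP wi; apply/eqP/rank_inj; rewrite wi vi.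
have eb : below S v = I i by apply/setP => w; rewrite !in_set vi.
have vn : v \notin I i by rewrite in_set vi ltnn andbF.
rewrite eI big_setU1//= -IH eb /block_ent -Phi_block2; first by ring.
split=> [w|u w]; rewrite in_set1 => /eqP ->//.
by rewrite in_set => /andP[/isolatedP[wS _] _]; have [_] := isolatedP _ _ _ vI; exact.
Qed.

(** A set [S] whose component at [v] is [C] is mapped to [S'], where [C] is
    replaced by the single vertex [v]: then [v] is isolated in [S'], the other
    isolated vertices do not change, and the probability gains a factor
    [((1 - t) / t) ^+ (#|C| - 1)]. *)
Lemma sum_component_le (t K : R) (D : {set V} -> R) v : 0 < t < 1 ->
  (forall W, 0 <= D W) ->
  \sum_(C in components_at adj v) (t / (1 - t)) ^+ #|C|.-1 * c #|C| <= K ->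
  \sum_(S : {set V} | v \in S) bern t S * (c #|component adj S v| *
     D (below S v :\: component adj S v)) <=
  K * \sum_(S : {set V} | v \in isolated_vertices adj S) bern t S * D (below S v).
Proof.
move=> /andP[t0 t1] D0 hK; set T := \sum_(S | v \in isolated_vertices adj S) _.
have t01 : 0 <= t <= 1 by rewrite !ltW.
have T0 : 0 <= T by apply: sumr_ge0 => S _; rewrite mulr_ge0// bern_ge0.
apply: le_trans (ler_wpM2r T0 hK).
rewrite (partition_big (fun S => component adj S v) (mem (components_at adj v)))/=;
  last by move=> S vS; apply/imsetP; exists S; rewrite ?inE.
rewrite mulr_suml; apply: ler_sum => C _.
pose h (S : {set V}) := v |: (S :\: C).
pose P := [set S : {set V} | (v \in S) && (component adj S v == C)].
rewrite (eq_bigl (fun S => S \in P)) => [|S]; last by rewrite inE.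
have PS S : S \in P -> [/\ C \subset S, v \in C & v \in S].
  rewrite inE => /andP[vS /eqP <-]; split=> //; last exact: component_refl.
  exact: component_sub.
have PC S : S \in P -> component adj S v = C.
  by rewrite inE => /andP[_ /eqP].
have hiso S w : S \in P -> w != v ->
    (w \in isolated_vertices adj (h S)) = (w \in isolated_vertices adj S :\: C).
  move=> PS' wv; have [CS vC vS] := PS S PS'; have eC := PC S PS'.
  apply/isolatedP/setDP => [[]|[/isolatedP[wS H] wC]].
    rewrite in_setU1 (negPf wv) in_setD/= => /andP[wC wS] H; split=> //.
    apply/isolatedP; split=> // u uS; have [uC|uC] := boolP (u \in C).
      apply: contra wC => wu; rewrite -eC; apply: (component_adj uS wS).
        by rewrite eC.
      by rewrite adj_sym.
    by apply: H; rewrite in_setU1 in_setD uC uS orbT.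
  split=> [|u]; first by rewrite in_setU1 in_setD wC wS orbT.
  by rewrite in_setU1 in_setD => /orP[/eqP ->|/andP[_ uS]]; apply: H.
have hv S : S \in P -> v \in isolated_vertices adj (h S).
  move=> PS'; have [CS vC vS] := PS S PS'; have eC := PC S PS'.
  apply/isolatedP; split=> [|u]; first exact: setU11.
  rewrite in_setU1 in_setD => /orP[/eqP ->|/andP[uC uS]]; first by rewrite adj_irr.
  apply: contra uC => vu; rewrite -eC; apply: (component_adj vS uS) vu.
  exact: component_refl.
have hbelow S : S \in P -> below S v :\: C = below (h S) v.
  move=> PS'; apply/setP => w; rewrite in_setD [w \in below S v]in_set [RHS]in_set.
  have [->|wv] := eqVneq w v; first by rewrite ltnn !andbF.
  by rewrite hiso// in_setD andbA.
have card_h S : S \in P -> #|S| = (#|h S| + #|C|.-1)%N.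
  move=> /PS[CS vC vS]; rewrite cardsU1 in_setD vC/= cardsDS//.
  have : (0 < #|C|)%N by rewrite (cardsD1 v) vC.
  have := subset_leq_card CS; case: #|C| => // m mS _ /=.
  by rewrite add1n addSnnS subnK.
have bern_h S : S \in P -> bern t S = (t / (1 - t)) ^+ #|C|.-1 * bern t (h S).
  move=> PS'; rewrite /bern (card_h S PS').
  have le : (#|h S| + #|C|.-1 <= #|V|)%N by rewrite -card_h// max_card.
  have -> : (#|V| - #|h S| = #|V| - (#|h S| + #|C|.-1) + #|C|.-1)%N.
    by rewrite subnDA subnK// leq_subRL// (leq_trans (leq_addr _ _) le).
  rewrite !exprD expr_div_n; field.
  by rewrite expf_neq0// subr_eq0 eq_sym lt_eqF.
have hinj : {in P &, injective h}.
  move=> S1 S2 /PS[C1 vC _] /PS[C2 _ _] e.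
  have eD : S1 :\: C = S2 :\: C.
    apply/setP => w; move/setP: e => /(_ w); rewrite !in_setU1 !in_setD.
    by have [->|] := eqVneq w v; rewrite ?vC.
  by rewrite -(setID S1 C) -[RHS](setID S2 C) eD !(setIidPr _).
rewrite (eq_bigr (fun S => (t / (1 - t)) ^+ #|C|.-1 * c #|C| *
    (bern t (h S) * D (below (h S) v)))) => [|S PS']; last first.
  have eC := PC S PS'.
  by rewrite bern_h// eC hbelow//; ring.
rewrite -mulr_sumr ler_wpM2l ?mulr_ge0 ?exprn_ge0 ?divr_ge0 ?subr_ge0 ?(ltW t0) ?(ltW t1)//.
rewrite -(big_imset (fun S => bern t S * D (below S v)) hinj)/=.
rewrite [leRHS](bigID [in h @: P])/= ler_wpDr//.
  by apply: sumr_ge0 => S _; rewrite mulr_ge0// bern_ge0.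
rewrite le_eqVlt; apply/orP; left; apply/eqP; apply: eq_bigl => S.
rewrite andbC; case: (boolP (S \in h @: P)) => //= /imsetP[S' PS' ->].
by rewrite hv.
Qed.

(** The entropy in a random set is at most [K] times the entropy in its isolated
    vertices: every component is charged to each of its vertices, made isolated. *)
Lemma isolated_block_le (t K : R) f : 0 < t < 1 ->
  (forall x, 0 < mu x -> 0 <= f x) ->
  (forall v, \sum_(C in components_at adj v)
     (t / (1 - t)) ^+ #|C|.-1 * c #|C| <= K) ->
  \sum_(S : {set V}) bern t S * block_ent S f <=
  K * \sum_(S : {set V}) bern t S * block_ent (isolated_vertices adj S) f.
Proof.
move=> t01 f0 hK; have /andP[t0 t1] := t01.
have b0 S : 0 <= bern t S by rewrite bern_ge0// !ltW.
pose D v W := block_ent [set v] (E W f).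
apply: (@le_trans _ _ (\sum_(S : {set V}) \sum_(v in S) bern t S *
    (c #|component adj S v| * D v (below S v :\: component adj S v)))).
  apply: ler_sum => S _; rewrite -mulr_sumr ler_wpM2l//.
  exact: block_ent_components.
rewrite (exchange_big_dep xpredT)//= mulr_sumr.
have -> : \sum_(S : {set V}) K * (bern t S * block_ent (isolated_vertices adj S) f) =
    \sum_v K * \sum_(S : {set V} | v \in isolated_vertices adj S) bern t S * D v (below S v).
  rewrite -!mulr_sumr; congr (_ * _).
  rewrite (exchange_big_dep xpredT)//=; apply: eq_bigr => S _.
  by rewrite block_ent_isolated mulr_sumr.
apply: ler_sum => v _; apply: sum_component_le => // W.
by apply: block_ent_ge0 => x _; exact: condE_ge0.
Qed.

End ComponentSum.

(** * Comparison of monotone chains *)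

Section Monotone.
Variables (R : realType) (q : nat) (V : finType) (mu : {ffun V -> 'I_q} -> R).
Local Notation config := {ffun V -> 'I_q}.
Hypothesis mu_ge0 : forall s, 0 <= mu s.
Implicit Types (s x y : config) (f g h : config -> R) (v : V) (le : V -> rel 'I_q).
Local Notation E B := (condE mu (~: B)).

Definition increasing le f := forall s s',
  0 < mu s -> 0 < mu s' -> config_le le s s' -> f s <= f s'.

Definition site_monotone le := forall v f, increasing le f -> increasing le (E [set v] f).

Lemma sum_conditioned L s f :
  \sum_x conditioned mu (pinned L s) x * f x = condE mu L f s.
Proof.
rewrite /condE mulr_suml [RHS]big_mkcond; apply: eq_bigr => x _.
rewrite /conditioned /cprob; have [xs|xs] := boolP (x \in pinned L s).
  by rewrite (setIidPl _) ?sub1set// /prob big_set1 mulrAC.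
have -> : [set x] :&: pinned L s = set0.
  by apply/eqP; rewrite setI_eq0 disjoints1.
by rewrite /prob big_set0 !mul0r.
Qed.

(** A function that is increasing on the support extends to an increasing
    function of all configurations: its running maximum. *)
Lemma increasing_extend le f : (forall v, linear_order (le v)) -> increasing le f ->
  exists2 g, (forall s s', config_le le s s' -> g s <= g s') &
             forall s, 0 < mu s -> g s = f s.
Proof.
move=> hle fi; pose m := - \sum_x `|f x|.
have fm x : m <= f x.
  rewrite lerNl (le_trans (ler_norm _))// normrN (bigD1 x)//= lerDl.
  by apply: sumr_ge0 => y _.
pose leb s s' := [forall v, le v (s v) (s' v)].
(* [m] is a lower bound of [f], the value of the empty maximum. *)
exists (fun s => \big[Num.max/m]_(x | (0 < mu x) && leb x s) f x).
  move=> s s' ss'; apply: bigmax_le => [|x /andP[x0 /forallP xs]].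
    exact: bigmax_ge_id.
  apply: (bigmax_sup x) => //; rewrite x0; apply/forallP => v.
  by have [_ _ tr _] := hle v; apply: tr (ss' v).
move=> s s0; apply/eqP; rewrite eq_le; apply/andP; split.
  apply: bigmax_le => // x /andP[x0 /forallP xs]; exact: fi.
apply: (bigmax_sup s) => //; rewrite s0; apply/forallP => v.
by have [re _ _ _] := hle v; apply: re.
Qed.

Lemma monotone_site (le : V -> rel 'I_q) : (forall v, linear_order (le v)) ->
  (forall (L : {set V}) (t1 t2 : config),
    feasible mu (~: L) t1 -> feasible mu (~: L) t2 ->
    (forall v, v \in ~: L -> le v (t2 v) (t1 v)) ->
    stoch_dominates le (conditioned mu (pinned (~: L) t1))
                       (conditioned mu (pinned (~: L) t2))) ->
  site_monotone le.
Proof.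
move=> hle hm v f fi s s' s0 s0' ss'.
have [g gi gf] := increasing_extend hle fi.
have := hm [set v] s' s (prob_pinned_gt0 mu_ge0 _ s0') (prob_pinned_gt0 mu_ge0 _ s0)
  (fun w _ => ss' w) g gi.
rewrite !sum_conditioned; congr (_ <= _); apply: eq_condE => // x _ x0; exact: gf.
Qed.

(** Statements about the bottom configuration are those about the top one for the
    reversed orders. *)
Definition reverse_order le : V -> rel 'I_q := fun v a b => le v b a.

Lemma reverse_linear le : (forall v, linear_order (le v)) ->
  forall v, linear_order (reverse_order le v).
Proof.
move=> hle v; have [re an tr to] := hle v; split=> //.
- by move=> a b ab; apply: an; rewrite andbC.
- by move=> b a c ab bc; exact: tr ab.
- by move=> a b; exact: to.
Qed.

Lemma increasing_reverse le f :
  increasing le f <-> increasing (reverse_order le) (fun s => - f s).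
Proof.
by split=> H s s' s0 s0' ss'; [rewrite lerN2|rewrite -lerN2]; apply: H.
Qed.

Lemma reverse_monotone le : site_monotone le -> site_monotone (reverse_order le).
Proof.
move=> hm v f /(@increasing_reverse (reverse_order le)) /(hm v) H.
move=> s s' s0 s0' ss'; have := H _ _ s0' s0 ss'.
by rewrite !condEN lerN2.
Qed.

Section Order.
Variable le : V -> rel 'I_q.
Hypothesis hle : forall v, linear_order (le v).
Hypothesis hm : site_monotone le.
Local Notation incr := (increasing le).

(** Chebyshev's association inequality on the fibres of one site, which are
    totally ordered. *)
Lemma mean_site_le v f g : incr f -> incr g ->
  mean mu (fun s => E [set v] f s * g s) <= mean mu (fun s => f s * g s).
Proof.
move=> fi gi; set cE := E [set v].
have key s : 0 < mu s -> cE f s * cE g s <= cE (fun x => f x * g x) s.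
  move=> s0.
  have : 0 <= cE (fun x => cE (fun y => (f x - f y) * (g x - g y)) s) s.
    rewrite -{1}(condE_cst mu_ge0 (~: [set v]) 0 s0).
    apply: le_condE => // x xs x0.
    rewrite -{1}(condE_cst mu_ge0 (~: [set v]) 0 s0).
    apply: le_condE => // y ys y0.
    have cmp a c : a \in pinned (~: [set v]) s -> c \in pinned (~: [set v]) s ->
        le v (a v) (c v) -> config_le le a c.
      move=> /pinnedP as_ /pinnedP cs ac w; have [->//|wv] := eqVneq w v.
      by rewrite as_ ?cs ?inE//; have [re _ _ _] := hle w; apply: re.
    have [_ _ _ /(_ (x v) (y v)) /orP[xy|yx]] := hle v.
      have c := cmp x y xs ys xy.
      by rewrite mulr_le0// subr_le0; [exact: fi|exact: gi].
    have c := cmp y x ys xs yx.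
    by rewrite mulr_ge0// subr_ge0; [exact: fi|exact: gi].
  have -> : cE (fun x => cE (fun y => (f x - f y) * (g x - g y)) s) s =
      2 * (cE (fun x => f x * g x) s - cE f s * cE g s).
    transitivity (cE (fun x => f x * g x - f x * cE g s - cE f s * g x
        + cE (fun y => f y * g y) s) s).
      apply: eq_condE => // x _ _.
      transitivity (cE (fun y => f x * g x - f x * g y - g x * f y + f y * g y) s).
        by apply: eq_condE => // y _ _; ring.
      by rewrite /cE condED !condEB !condEZ condE_cst//; ring.
    rewrite /cE condED !condEB condE_cst//.
    rewrite condEZ -[X in _ - X - _](_ : cE g s * cE f s = _); first by rewrite /cE; ring.
    by rewrite /cE -condEZ; apply: eq_condE => // x _ _; ring.
  by rewrite pmulr_rge0// subr_ge0.
rewrite -(mean_condE mu_ge0 (~: [set v]) (fun s => f s * g s)).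
apply: le_trans (le_mean mu_ge0 key).
rewrite le_eqVlt; apply/orP; left; apply/eqP.
transitivity (mean mu (fun s => g s * cE f s)).
  by apply: eq_mean => // s _; rewrite mulrC.
rewrite -(mean_condE_pull mu_ge0 g (condE_dep mu f)).
by apply: eq_mean => // s _; rewrite mulrC.
Qed.

End Order.

Definition scan (vs : seq V) f := foldr (fun v g => E [set v] g) f vs.

Lemma mean_scan_sym vs f g :
  mean mu (fun s => scan vs f s * g s) = mean mu (fun s => f s * scan (rev vs) g s).
Proof.
elim: vs g => [//|v vs IH] g /=.
by rewrite rev_cons -cats1 /scan foldr_cat/= -IH mean_condE_sym.
Qed.

Lemma increasing_scan le vs f : site_monotone le -> increasing le f ->
  increasing le (scan vs f).
Proof. by move=> hm fi; elim: vs => //= v vs IH; exact: hm. Qed.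

(** Censoring: deleting updates makes the chain slower, in the sense of the
    bilinear form on pairs of increasing functions. *)
Lemma mean_scan_filter le (p : pred V) vs f g : (forall v, linear_order (le v)) ->
  site_monotone le -> increasing le f -> increasing le g ->
  mean mu (fun s => scan vs f s * g s) <=
  mean mu (fun s => scan [seq v <- vs | p v] f s * g s).
Proof.
move=> hle hm fi; elim: vs g => [//|v vs IH] g gi /=.
have := IH _ (hm v g gi).
rewrite -!mean_condE_sym// => H; case: ifP => _; first exact: H.
apply: le_trans H _; apply: (mean_site_le hle) => //; exact: increasing_scan.
Qed.

Variable adj : rel V.
Hypothesis hM : markov_field mu adj.

Lemma scan_block vs f : uniq vs -> {in vs &, forall u v, ~~ adj u v} ->
  forall s, 0 < mu s -> scan vs f s = E [set v in vs] f s.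
Proof.
elim: vs => [|v vs IH] /=.
  move=> _ _ s s0; rewrite (_ : ~: _ = [set: V]) ?condE_setT//.
  by apply/setP => u; rewrite !inE.
move=> /andP[vvs uvs] ind s s0.
have {}IH x : 0 < mu x -> scan vs f x = E [set v in vs] f x.
  by apply: IH => // u w uv wv; apply: ind; rewrite inE ?uv ?wv orbT.
rewrite (eq_condE mu_ge0 (g := E [set v in vs] f)) => [|x _]; last exact: IH.
rewrite (condE_block mu_ge0 hM) => //; last first.
  split=> [u|u w]; rewrite in_set1 => /eqP ->; rewrite inE// => wv.
  by apply: ind; rewrite inE ?eqxx// wv orbT.
by congr (condE _ (~: _) _ _); apply/setP => u; rewrite !inE.
Qed.

(** One step of the comparison chain: heat bath of the isolated vertices of a
    random subset of [V]. *)
Definition random_update (t : R) f s :=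
  \sum_(S : {set V}) bern t S * E (isolated_vertices adj S) f s.

Lemma mean_random_update t f g :
  mean mu (fun s => random_update t f s * g s) =
  \sum_(S : {set V}) bern t S * mean mu (fun s => E (isolated_vertices adj S) f s * g s).
Proof.
under [RHS]eq_bigr do rewrite -meanZ.
rewrite -mean_sum; apply: eq_mean => // s _; rewrite mulr_suml.
by apply: eq_bigr => S _; rewrite mulrA.
Qed.

Lemma mean_random_update_sym t f g :
  mean mu (fun s => random_update t f s * g s) =
  mean mu (fun s => f s * random_update t g s).
Proof.
rewrite mean_random_update.
transitivity (mean mu (fun s => random_update t g s * f s)); last first.
  by apply: eq_mean => // s _; rewrite mulrC.
rewrite mean_random_update; apply: eq_bigr => S _; congr (_ * _).
by rewrite mean_condE_sym; apply: eq_mean => // s _; rewrite mulrC.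
Qed.

Lemma isolated_scan phi S f s : perm_eq phi (enum V) -> 0 < mu s ->
  scan [seq v <- phi | v \in isolated_vertices adj S] f s = E (isolated_vertices adj S) f s.
Proof.
move=> phiE s0; rewrite scan_block//.
- congr (condE _ (~: _) _ _); apply/setP => v.
  by rewrite in_set mem_filter (perm_mem phiE) mem_enum andbT.
- by rewrite filter_uniq// (perm_uniq phiE) enum_uniq.
- move=> u v; rewrite !mem_filter => /andP[/isolatedP[_ H] _].
  by move=> /andP[/isolatedP[vS _] _]; exact: H.
Qed.

Lemma increasing_random_update le t f : site_monotone le -> 0 <= t <= 1 ->
  increasing le f -> increasing le (random_update t f).
Proof.
move=> hm t01 fi s s' s0 s0' ss'; apply: ler_sum => S _.
rewrite ler_wpM2l ?bern_ge0//.
rewrite -!(@isolated_scan (enum V))//; exact: (increasing_scan _ hm fi s0 s0' ss').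
Qed.

(** The symmetrized scan, acting on functions. *)
Definition sym_update phi f := scan (phi ++ rev phi) f.

Lemma mean_sym_update_le le phi t f g : (forall v, linear_order (le v)) ->
  site_monotone le -> perm_eq phi (enum V) -> 0 <= t <= 1 ->
  increasing le f -> increasing le g ->
  mean mu (fun s => sym_update phi f s * g s) <=
  mean mu (fun s => random_update t f s * g s).
Proof.
move=> hle hm phiE t01 fi gi.
have half : mean mu (fun s => sym_update phi f s * g s) <=
    mean mu (fun s => scan phi f s * g s).
  rewrite (_ : sym_update phi f = scan phi (scan (rev phi) f)); last exact: foldr_cat.
  rewrite mean_scan_sym [leRHS]mean_scan_sym.
  have gi' : increasing le (scan (rev phi) g) by exact: increasing_scan.
  have := mean_scan_filter (fun=> false) (rev phi) hle hm fi gi'.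
  by rewrite (filter_pred0 (rev phi)).
rewrite mean_random_update -[leLHS]mul1r -(sum_bern V t) mulr_suml.
apply: ler_sum => S _; rewrite ler_wpM2l ?bern_ge0//; apply: le_trans half _.
apply: le_trans (mean_scan_filter [in isolated_vertices adj S] phi hle hm fi gi) _.
rewrite le_eqVlt; apply/orP; left; apply/eqP; apply: eq_mean => // s s0.
by rewrite isolated_scan.
Qed.

(** The comparison of one step is iterated by moving the steps of the comparison
    chain to the other side, where they keep [g] increasing. *)
Lemma mean_iter_le le phi t m f g : (forall v, linear_order (le v)) ->
  site_monotone le -> perm_eq phi (enum V) -> 0 <= t <= 1 ->
  increasing le f -> increasing le g ->
  mean mu (fun s => iter m (sym_update phi) f s * g s) <=
  mean mu (fun s => f s * iter m (random_update t) g s).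
Proof.
move=> hle hm phiE t01 fi; elim: m g => [//|m IH] g gi.
rewrite iterS [in leRHS]iterSr.
have fm : increasing le (iter m (sym_update phi) f).
  by elim: m {IH} => //= m; exact: increasing_scan.
apply: le_trans (mean_sym_update_le hle hm phiE t01 fm gi) _.
rewrite mean_random_update_sym; apply: IH; exact: increasing_random_update.
Qed.

End Monotone.

(** * Convergence of the scan from all starting configurations *)

Section Convergence.
Variables (R : realType) (q : nat) (V : finType) (mu : {ffun V -> 'I_q} -> R).
Local Notation config := {ffun V -> 'I_q}.
Hypothesis mu_ge0 : forall s, 0 <= mu s.
Hypothesis mu1 : \sum_s mu s = 1.
Hypothesis hconn : totally_connected mu.
Implicit Types (s x y : config) (f g h : config -> R) (v : V) (le : V -> rel 'I_q).

(** An integer-valued, strictly increasing function of the configuration. *)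
Definition height le s : nat := (\sum_v #|[set a | le v a (s v)]|)%N.

Lemma height_le le s s' : (forall v, linear_order (le v)) ->
  config_le le s s' -> (height le s <= height le s')%N.
Proof.
move=> hle ss'; apply: leq_sum => v _; apply: subset_leq_card.
apply/subsetP => a; rewrite !inE => as_; have [_ _ tr _] := hle v.
exact: tr as_ (ss' v).
Qed.

Lemma height_lt le s s' : (forall v, linear_order (le v)) ->
  config_le le s s' -> s != s' -> (height le s < height le s')%N.
Proof.
move=> hle ss' neq.
have [v sv] : exists v, s v != s' v.
  apply/existsP; apply: contraNT neq; rewrite negb_exists => /forallP H.
  by apply/eqP/ffunP => v; apply/eqP; have := H v; rewrite negbK.
rewrite /height (bigD1 v)//= [X in (_ < X)%N](bigD1 v)//= -addSn leq_add//.
  have [re an tr _] := hle v; apply: proper_card; apply/properP; split.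
    apply/subsetP => a; rewrite !inE => as_; exact: tr as_ (ss' v).
  exists (s' v); rewrite !inE ?re//.
  by apply: contra sv => h; apply/eqP/an; rewrite h ss'.
apply: leq_sum => w _; apply: subset_leq_card; apply/subsetP => a.
rewrite !inE => as_; have [_ _ tr _] := hle w; exact: tr as_ (ss' w).
Qed.

Lemma height_max le s : (height le s <= #|V| * q)%N.
Proof.
rewrite /height -sum_nat_const; apply: leq_sum => v _.
by rewrite -[leqRHS]card_ord max_card.
Qed.

(** The support has a largest configuration: a flip path that starts below a
    maximal configuration cannot leave the set of configurations below it. *)
Lemma exists_top le : (forall v, linear_order (le v)) -> site_monotone mu le ->
  exists2 x, 0 < mu x & forall y, 0 < mu y -> config_le le y x.
Proof.
move=> hle hm.
have [x0 x00] := support_nonempty mu_ge0 mu1.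
pose x := [arg max_(y > x0 | 0 < mu y) height le y].
have [px mx] : 0 < mu x /\ forall y, 0 < mu y -> (height le y <= height le x)%N.
  by rewrite /x; case: arg_maxnP.
exists x => // y py.
have Z0 : feasible mu set0 x by exact: prob_pinned_gt0.
have inOm s : 0 < mu s -> s \in feasible_configs mu :&: pinned set0 x.
  by move=> s0; rewrite in_setI pinned0 in_setT inE s0.
have /connectP[p pp ->] := hconn Z0 (inOm x px) (inOm y py).
pose e s s' := [&& s \in feasible_configs mu :&: pinned set0 x,
  s' \in feasible_configs mu :&: pinned set0 x & one_flip s s'].
suff H z : path e z p -> config_le le z x -> config_le le (last z p) x.
  by apply: H => // v; have [re _ _ _] := hle v; apply: re.
elim: p z {pp} => [//|z' p IH] z /= /andP[/and3P[zO zO' fl] pp] zx.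
apply: (IH _ pp); have pz : 0 < mu z by move: zO; rewrite in_setI inE => /andP[].
have pz' : 0 < mu z' by move: zO'; rewrite in_setI inE => /andP[].
have /cards1P[v ev] := fl.
have zz w : w != v -> z' w = z w.
  move=> wv; apply/esym/eqP; move/setP: ev => /(_ w); rewrite !inE (negPf wv).
  by move/negbFE.
move=> w; have [->{w}|wv] := eqVneq w v; last by rewrite zz.
have [re an tr to] := hle v.
apply: contraT => nle; exfalso.
have xz : le v (x v) (z' v) by have := to (x v) (z' v); rewrite (negPf nle) orbF.
pose f s : R := (le v (z' v) (s v))%:R.
have fi : increasing mu le f.
  move=> s s' _ _ ss'; rewrite ler_nat /f; case h : (le v (z' v) (s v)) => //.
  by rewrite (tr _ _ _ h (ss' v)).
have f0 s : 0 < mu s -> 0 <= f s by move=> _; exact: ler0n.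
have Ez : 0 < condE mu (~: [set v]) f z.
  have zf : z' \in pinned (~: [set v]) z.
    by apply/pinnedP => w; rewrite !inE => /zz.
  rewrite -(condE_dep mu f zf); apply: condE_gt0 => //.
  by rewrite /f re ltr01.
have Ex := lt_le_trans Ez (hm v f fi z x pz px zx).
have [x' [px' xf fx']] : exists x', [/\ 0 < mu x', x' \in pinned (~: [set v]) x
    & le v (z' v) (x' v)].
  apply: contrapT => H; move: Ex.
  rewrite (eq_condE mu_ge0 (g := fun=> 0)) ?condE_cst ?ltxx// => y' yf py'.
  rewrite /f; case h : (le v _ _) => //; exfalso; apply: H.
  by exists y'.
have xx' : config_le le x x'.
  move=> w; have [->|wv] := eqVneq w v; first exact: tr xz fx'.
  rewrite (pinnedP _ _ _ xf) ?inE//; have [re' _ _ _] := hle w; exact: re'.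
have : x != x'.
  by apply: contraNneq nle => ->.
by move/(height_lt hle xx'); rewrite ltnNge mx.
Qed.

Lemma scanD vs f g s : scan mu vs (fun x => f x + g x) s =
  scan mu vs f s + scan mu vs g s.
Proof.
by elim: vs s => [//|v vs IH] s /=; rewrite -condED; apply: eq_condE => // x _ _.
Qed.

Lemma mean_scan vs f : mean mu (scan mu vs f) = mean mu f.
Proof. by elim: vs => //= v vs <-; rewrite mean_condE. Qed.

Variables (adj : rel V) (phi : seq V) (t rho Lam : R).
Hypothesis hM : markov_field mu adj.
Hypothesis phiE : perm_eq phi (enum V).
Hypothesis t01 : 0 <= t <= 1.
Hypothesis rho01 : 0 <= rho <= 1.
Hypothesis hdecay : forall g, (forall x, 0 < mu x -> 0 <= g x) -> mean mu g = 1 ->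
  rho * Phi mu g <= \sum_(S : {set V}) bern t S * block_ent mu (isolated_vertices adj S) g.
Hypothesis hLam : forall x, 0 < mu x -> ln (mu x)^-1 <= Lam.
Local Notation P := (sym_update mu phi).
Local Notation L := (random_update mu adj t).

Lemma Phi_random_update_le g : (forall x, 0 < mu x -> 0 <= g x) -> mean mu g = 1 ->
  Phi mu (L g) <= (1 - rho) * Phi mu g.
Proof.
move=> g0 g1.
apply: (@le_trans _ _ (\sum_(S : {set V}) bern t S *
    Phi mu (condE mu (~: isolated_vertices adj S) g))).
  apply: (@Phi_convex _ _ _ mu mu_ge0 _ (bern t)
    (fun S => condE mu (~: isolated_vertices adj S) g)).
  - by move=> S; exact: bern_ge0.
  - exact: sum_bern.
  - by move=> S x _; exact: condE_ge0.
have := hdecay g0 g1; rewrite /block_ent.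
under eq_bigr do rewrite mulrBr.
by rewrite sumrB -mulr_suml sum_bern mul1r; lra.
Qed.

Lemma random_update_ge0 g : (forall x, 0 < mu x -> 0 <= g x) ->
  forall x, 0 < mu x -> 0 <= L g x.
Proof.
move=> g0 x _; apply: sumr_ge0 => S _; rewrite mulr_ge0 ?bern_ge0//.
exact: condE_ge0.
Qed.

Lemma mean_random_update1 g : mean mu (L g) = mean mu g.
Proof.
rewrite mean_sum -[RHS]mul1r -(sum_bern V t) mulr_suml; apply: eq_bigr => S _.
by rewrite meanZ mean_condE.
Qed.

Lemma iter_random_update m g : (forall x, 0 < mu x -> 0 <= g x) -> mean mu g = 1 ->
  [/\ forall x, 0 < mu x -> 0 <= iter m L g x, mean mu (iter m L g) = 1 &
      Phi mu (iter m L g) <= (1 - rho) ^+ m * Phi mu g].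
Proof.
move=> g0 g1; elim: m => [|m [m0 m1 mP]]; first by rewrite expr0 mul1r.
rewrite iterS; split; first exact: random_update_ge0.
  by rewrite mean_random_update1.
apply: le_trans (Phi_random_update_le m0 m1) _.
by rewrite exprS -mulrA ler_wpM2l// subr_ge0; case/andP: rho01.
Qed.

(** Started from the top configuration, the scan is stochastically below the
    comparison chain, whose density is close to [1] in relative entropy. *)
Lemma top_bound le x m M e f : (forall v, linear_order (le v)) ->
  site_monotone mu le -> 0 < mu x -> (forall y, 0 < mu y -> config_le le y x) ->
  increasing mu le f -> (forall s, `|f s| <= M) -> 0 < e ->
  iter m P f x - mean mu f <= M * ((1 - rho) ^+ m * Lam / (2 * e) + 2 * e).
Proof.
move=> hle hm x0 xtop fi fM e0; pose g s := (s == x)%:R / mu x.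
have g0 s : 0 < mu s -> 0 <= g s by move=> _; rewrite divr_ge0.
have mg h : mean mu (fun s => h s * g s) = h x.
  rewrite /mean (bigD1 x)//= big1 ?addr0 => [|s sx].
    by rewrite /g eqxx mul1r mulrCA divff ?mulr1// gt_eqF.
  by rewrite /g (negPf sx) mul0r !mulr0.
have g1 : mean mu g = 1.
  by rewrite -[RHS](mg (fun=> 1)); apply: eq_mean => // s _; rewrite mul1r.
have gPhi : Phi mu g = ln (mu x)^-1.
  transitivity (mean mu (fun s => ln (g s) * g s)).
    by apply: eq_mean => // s _; rewrite mulrC.
  by rewrite mg /g eqxx mul1r.
have gi : increasing mu le g.
  move=> s s' s0 s0' ss'; rewrite /g; have [sx|sx] := eqVneq s x; last first.
    by rewrite mul0r divr_ge0.
  rewrite (_ : s' = x) ?eqxx//; apply/ffunP => v; have [_ an _ _] := hle v.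
  by apply: an; rewrite (xtop s' s0') -sx ss'.
have [m0 m1 mP] := iter_random_update m g0 g1.
have := mean_iter_le mu_ge0 hM m hle hm phiE t01 fi gi.
rewrite mg -(lerD2r (- mean mu f)) => /le_trans; apply.
rewrite -meanB.
have M0 : 0 <= M by exact: le_trans (normr_ge0 _) (fM x).
apply: (@le_trans _ _ (mean mu (fun s => M * `|iter m L g s - 1|))).
  apply: le_mean => // s _; rewrite -[X in _ - X]mulr1 -mulrBr.
  apply: le_trans (ler_norm _) _; rewrite normrM ler_wpM2r//.
rewrite meanZ ler_wpM2l//; apply: le_trans (mean_norm_sub1_le mu_ge0 mu1 e0 m0 m1) _.
rewrite lerD2r ler_wpM2r ?invr_ge0 ?mulr_ge0 ?(ltW e0)//.
apply: le_trans mP _; rewrite gPhi ler_wpM2l ?hLam// exprn_ge0// subr_ge0.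
by case/andP: rho01.
Qed.

Lemma increasing_iter le m f : site_monotone mu le -> increasing mu le f ->
  increasing mu le (iter m P f).
Proof. by move=> hm fi; elim: m => //= m; exact: increasing_scan. Qed.

Lemma iterD m f g s : iter m P (fun x => f x + g x) s = iter m P f s + iter m P g s.
Proof.
elim: m s => [//|m IH] s; rewrite !iterS -scanD.
by congr (scan _ _ _ _); apply: funext.
Qed.

Lemma mean_iter m f : mean mu (iter m P f) = mean mu f.
Proof. by elim: m => //= m <-; exact: mean_scan. Qed.

Lemma iterN m f s : iter m P (fun x => - f x) s = - iter m P f s.
Proof.
have H vs g x : scan mu vs (fun x => - g x) x = - scan mu vs g x.
  elim: vs x => [//|v vs IH] x /=; rewrite -condEN.
  by apply: eq_condE => // y _ _.
elim: m s => [//|m IH] s; rewrite !iterS -H.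
by congr (scan _ _ _ _); apply: funext.
Qed.

(** Adding to the height a function of oscillation at most [1] keeps it
    increasing.  So the heights at the extreme configurations control the distance
    between the laws of the chain from all starting configurations. *)
Lemma convergence_bound le m e x g : (forall v, linear_order (le v)) ->
  site_monotone mu le -> 0 < e -> 0 < mu x -> (forall s, `|g s| <= 2^-1) ->
  iter m P g x - mean mu g <=
  3 * ((#|V| * q)%:R * ((1 - rho) ^+ m * Lam / (2 * e) + 2 * e)).
Proof.
move=> hle hm e0 x0 g1.
have [top top0 htop] := exists_top hle hm.
have [bot bot0 hbot] := exists_top (reverse_linear hle) (reverse_monotone hm).
pose H s : R := (height le s)%:R.
have Hi : increasing mu le H.
  by move=> s s' _ _ ss'; rewrite ler_nat height_le.
have Hgi (k : config -> R) : (forall s, `|k s| <= 2^-1) ->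
    increasing mu le (fun s => H s + k s).
  move=> k1 s s' _ _ ss'; have [->//|neq] := eqVneq s s'.
  have : H s + 1 <= H s' by rewrite natr1 ler_nat height_lt.
  by have := k1 s; have := k1 s'; rewrite !ler_norml => /andP[? ?] /andP[? ?]; lra.
set B := _ * (_ + _).
have HM s : `|H s| <= (#|V| * q)%:R by rewrite ger0_norm// ler_nat height_max.
have hT : iter m P H top - mean mu H <= B by exact: (top_bound m hle hm).
have hB : mean mu H - iter m P H bot <= B.
  have := @top_bound _ bot m (#|V| * q)%:R e (fun s => - H s)
    (reverse_linear hle) (reverse_monotone hm) bot0 hbot.
  rewrite iterN meanN opprK addrC; apply=> //.
    exact: (proj1 (@increasing_reverse _ _ _ mu le H) Hi).
  by move=> s; rewrite normrN.
have cmp s : 0 < mu s ->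
    `|iter m P g s - iter m P g top| <= iter m P H top - iter m P H s.
  move=> s0; rewrite ler_norml; apply/andP; split.
    have Ni : increasing mu le (fun s => H s + - g s).
      by apply: Hgi => y; rewrite normrN.
    have := increasing_iter m hm Ni s0 top0 (htop s s0).
    by rewrite !iterD !iterN; lra.
  have := increasing_iter m hm (Hgi _ g1) s0 top0 (htop s s0).
  by rewrite !iterD; lra.
have top_x : iter m P g x - iter m P g top <= iter m P H top - iter m P H bot.
  apply: le_trans (ler_norm _) (le_trans (cmp x x0) _).
  by rewrite lerD2l lerN2; apply: (increasing_iter m hm Hi) => //; exact: hbot.
have top_mean : iter m P g top - mean mu g <= iter m P H top - mean mu H.
  have cst c : c = mean mu (fun=> c).
    by rewrite /mean -mulr_suml mu1 mul1r.
  rewrite -(mean_iter m g) -(mean_iter m H) {1}[iter m P g top]cst.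
  rewrite {1}[iter m P H top]cst -!meanB; apply: le_mean => // s s0.
  by apply: le_trans (ler_norm _) _; rewrite distrC; exact: cmp.
lra.
Qed.

End Convergence.

(** * Gibbs measures and transition matrices *)

Section GibbsMeasure.
Variables (R : realType) (q : nat) (G : sgraph) (X : spin_system R q G).
Local Notation config := {ffun G -> 'I_q}.

Let expr (x : \bar R) : R := fine (expeR x).

Let expr_ge0 x : 0 <= expr x.
Proof. by rewrite /expr fine_ge0// expeR_ge0. Qed.

Let exprD x y : (x < +oo)%E -> (y < +oo)%E -> expr (x + y)%E = expr x * expr y.
Proof.
rewrite /expr; case: x => [x||] //; case: y => [y||] // _ _ /=.
- by rewrite exp.expRD.
- by rewrite mulr0.
- by rewrite mul0r.
- by rewrite mulr0.
Qed.

Let expr_sum (I : Type) (r : seq I) (P : pred I) (F : I -> \bar R) :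
  (forall i, P i -> F i < +oo)%E ->
  expr (\sum_(i <- r | P i) F i)%E = \prod_(i <- r | P i) expr (F i).
Proof.
move=> Foo; suff [] : (\sum_(i <- r | P i) F i < +oo)%E /\
  expr (\sum_(i <- r | P i) F i)%E = \prod_(i <- r | P i) expr (F i) by [].
elim/big_rec2: _ => [|i y x Pi [xoo e]]; first by rewrite ltry /expr /= expR0.
by rewrite exprD ?Foo// e lte_add_pinfty ?Foo.
Qed.

Lemma weightE (s : config) : weight X s =
  (\prod_(u : G) \prod_(v : G | sedge u v && (enum_rank u < enum_rank v)%N)
     expr (ss_K X (s u) (s v))) *
  (\prod_(u : G) \prod_(w : {w : bc_ext (ss_bc X) | w \in bc_dom (ss_bc X)}
               | sedge (bc_emb (ss_bc X) u) (val w))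
     expr (ss_K X (s u) (bc_spin w))) *
  \prod_(v : G) expr (ss_U X (s v))%:E.
Proof.
rewrite /weight /hamiltonian -/(expr _).
set S1 := (\sum_u _)%E; set S2 := (\sum_u _)%E; set S3 := (\sum_v _)%E.
have Koo s1 s2 : (ss_K X s1 s2 < +oo)%E by exact: ss_K_lty.
have oo1 : (S1 < +oo)%E.
  by apply: lte_sum_pinfty => u _; apply: lte_sum_pinfty => v _.
have oo2 : (S2 < +oo)%E.
  by apply: lte_sum_pinfty => u _; apply: lte_sum_pinfty => v _.
have oo3 : (S3 < +oo)%E by apply: lte_sum_pinfty => u _; rewrite ltry.
have -> : (- (- S1 - S2 - S3) = S1 + S2 + S3)%E.
  move: S1 S2 S3 oo1 oo2 oo3 => [x||] [y||] [z||] //= _ _ _.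
  by congr (_%:E); ring.
rewrite !exprD ?lte_add_pinfty//; congr (_ * _ * _).
- rewrite expr_sum => [|u _]; last by apply: lte_sum_pinfty.
  by apply: eq_bigr => u _; rewrite expr_sum.
- rewrite expr_sum => [|u _]; last by apply: lte_sum_pinfty.
  by apply: eq_bigr => u _; rewrite expr_sum.
- by rewrite expr_sum// => u _; rewrite ltry.
Qed.

Lemma gibbs_ge0 (s : config) : 0 < partition_function X -> 0 <= gibbs X s.
Proof. by move=> Z0; rewrite divr_ge0 ?(ltW Z0)//; exact: expr_ge0. Qed.

Lemma sum_gibbs : 0 < partition_function X -> \sum_s gibbs X s = 1.
Proof. by move=> Z0; rewrite -mulr_suml divff// gt_eqF. Qed.

(** The weight is a product of factors that involve one vertex, or one edge; each
    edge that leaves [A] ends in the boundary, where the configurations agree. *)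
Lemma gibbs_markov : markov_field (gibbs X) (@sedge G).
Proof.
move=> A s x H; rewrite /gibbs.
suff e : weight X s * weight X x = weight X (mix A s x) * weight X (mix A x s).
  by rewrite mulrACA e mulrACA.
rewrite !weightE.
have swap (F : 'I_q -> 'I_q -> R) u v : sedge u v -> F (s u) (s v) * F (x u) (x v) =
    F (mix A s x u) (mix A s x v) * F (mix A x s u) (mix A x s v).
  move=> uv; rewrite !ffunE; have [uA|uA] := boolP (u \in A);
    have [vA|vA] := boolP (v \in A); rewrite //; last by rewrite mulrC.
    by rewrite (H u v).
  by have -> : s u = x u by [apply: H vA uA _; rewrite sedge_sym].
rewrite mulrACA [X in X * _]mulrACA [RHS]mulrACA [X in _ = X * _]mulrACA.
congr (_ * _ * _); rewrite -2!big_split; apply: eq_bigr => u _ /=.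
- rewrite -2!big_split; apply: eq_bigr => v /andP[uv _].
  exact: (swap (fun a c => expr (ss_K X a c))).
- rewrite -2!big_split; apply: eq_bigr => v _ /=; rewrite !ffunE.
  by case: ifP => // _; rewrite mulrC.
- by rewrite !ffunE; case: ifP => // _; rewrite mulrC.
Qed.

End GibbsMeasure.

Section TransitionMatrices.
Variables (R : realType) (q : nat) (V : finType) (mu : {ffun V -> 'I_q} -> R).
Local Notation config := {ffun V -> 'I_q}.
Hypothesis mu_ge0 : forall s, 0 <= mu s.
Local Notation N := #|feasible_configs mu|.

Let feasP (i : 'I_N) : 0 < mu (enum_val i).
Proof. by have := enum_valP i; rewrite inE. Qed.

Let column (f : config -> R) : 'cV[R]_N := \col_i f (enum_val i).

Let sum_feasible (F : config -> R) : (forall s, mu s = 0 -> F s = 0) ->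
  \sum_(j < N) F (enum_val j) = \sum_s F s.
Proof.
move=> F0; rewrite -(big_enum_val F) big_mkcond; apply: eq_bigr => s _.
by rewrite inE; case: ifP => // /negbT; case: (mu_gt0P mu_ge0 s) => [/F0 ->|->].
Qed.

Let heat_bath_column v f :
  heat_bath mu v *m column f = column (condE mu (~: [set v]) f).
Proof.
apply/colP => i; rewrite !mxE; set x := enum_val i.
pose F y := (if y \in pinned (~: [set v]) x
    then cprob mu (has_spin v (y v)) (pinned (~: [set v]) x) else 0) * f y.
have e y : F y = if y \in pinned (~: [set v]) x
    then mu y * f y / prob mu (pinned (~: [set v]) x) else 0.
  rewrite /F; case: ifP => [yx|]; last by rewrite mul0r.
  rewrite /cprob -(pinned_eq yx) -pinned1 -pinnedU setUCr.
  by rewrite pinned_setT /(prob _ [set y]) big_set1 mulrAC.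
transitivity (\sum_(j < N) F (enum_val j)).
  by apply: eq_bigr => j _; rewrite !mxE.
rewrite sum_feasible => [|y y0]; last by rewrite e y0 !mul0r; case: ifP.
by under eq_bigr do rewrite e; rewrite -big_mkcond /condE mulr_suml.
Qed.

Let prod_column vs f :
  (\prod_(v <- vs) heat_bath mu v) *m column f = column (scan mu vs f).
Proof.
elim: vs => [|v vs IH]; first by rewrite big_nil mul1mx.
by rewrite big_cons -[_ * _]/(_ *m _) -mulmxA IH heat_bath_column.
Qed.

Let power_column phi m f :
  (sym_scan mu phi ^+ m) *m column f = column (iter m (sym_update mu phi) f).
Proof.
elim: m => [|m IH]; first by rewrite expr0 mul1mx.
rewrite exprS -[_ * _]/(_ *m _) -mulmxA IH /sym_scan -[_ * _]/(_ *m _) -mulmxA.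
by rewrite !prod_column iterS /sym_update /scan foldr_cat.
Qed.

(** The total variation distance is attained by half the sign of the difference. *)
Lemma tv_to_mu_le phi m (d : R) :
  (forall x (g : config -> R), 0 < mu x -> (forall s, `|g s| <= 2^-1) ->
     iter m (sym_update mu phi) g x - mean mu g <= d) ->
  forall i, tv_to_mu (sym_scan mu phi ^+ m) i <= d.
Proof.
move=> H i; set M := sym_scan mu phi ^+ m.
pose g (y : config) : R := if [pick j : 'I_N | enum_val j == y] is Some j
  then 2^-1 * Num.sg (M i j - mu (enum_val j)) else 0.
have gE j : g (enum_val j) = 2^-1 * Num.sg (M i j - mu (enum_val j)).
  rewrite /g; case: pickP => [k /eqP/enum_val_inj ->//|/(_ j)].
  by rewrite eqxx.
have g1 s : `|g s| <= 2^-1.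
  rewrite /g; case: pickP => [j _|_]; last by rewrite normr0 invr_ge0.
  by rewrite normrM normr_sg ger0_norm ?invr_ge0// ler_piMr ?invr_ge0// lern1 leq_b1.
apply: le_trans (H _ g (feasP i) g1).
have -> : iter m (sym_update mu phi) g (enum_val i) = \sum_j M i j * g (enum_val j).
  have := power_column phi m g; rewrite -/M => /colP/(_ i); rewrite !mxE => <-.
  by apply: eq_bigr => j _; rewrite !mxE.
have -> : mean mu g = \sum_(j < N) mu (enum_val j) * g (enum_val j).
  by rewrite (sum_feasible (F := fun s => mu s * g s))// => s ->; rewrite mul0r.
rewrite -sumrB /tv_to_mu mulr_sumr; apply: ler_sum => j _.
by rewrite gE -mulrBl mulrCA normrEsg ler_wpM2l ?invr_ge0// mulrC.
Qed.

Lemma mixing_time_le phi m : (0 < m)%N ->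
  (forall x (g : config -> R), 0 < mu x -> (forall s, `|g s| <= 2^-1) ->
     iter m (sym_update mu phi) g x - mean mu g <= 4^-1) ->
  (mixing_time (sym_scan mu phi) <= (m%:R)%:E)%E.
Proof.
move=> m0 H; apply: ereal_inf_lbound; exists m => //; split=> //.
by apply: bigmax_le => [|i _]; [rewrite invr_ge0|exact: tv_to_mu_le].
Qed.

End TransitionMatrices.

(** * Entropy contraction and mixing time *)

Section EntropyDecay.
Variables (R : realType) (q : nat) (V : finType) (mu : {ffun V -> 'I_q} -> R).
Local Notation config := {ffun V -> 'I_q}.
Hypothesis mu_ge0 : forall s, 0 <= mu s.
Hypothesis mu1 : \sum_s mu s = 1.
Variables (b eta : R) (d k : nat).
Hypotheses (b0 : 0 < b) (b1 : b <= 1) (eta0 : 0 < eta).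
Hypothesis hb : marginally_bounded mu b.
Hypothesis hSI : spectrally_independent mu eta.
Hypothesis hconn : totally_connected mu.
Hypothesis hk : 2 * eta / b <= k%:R.
Variable adj : rel V.
Hypotheses (adj_sym : symmetric adj) (adj_irr : irreflexive adj).
Hypothesis hM : markov_field mu adj.
Hypothesis hd : forall v, (#|[set w | adj v w]| <= d)%N.
Hypothesis d3 : (3 <= d)%N.
Implicit Types (g : config -> R) (A : {set V}).

(** Small enough for the sum over components, whose terms grow like
    [d ^+ 2 / b ^+ 4] per vertex, to converge. *)
Definition block_density : R := b ^+ 4 / (8 * d%:R ^+ 2).
Definition decay_rate : R := block_density ^+ k.+1 / (32 / b ^+ 4).

Let d0 : (0 : R) < d%:R. Proof. by rewrite ltr0n (leq_trans _ d3). Qed.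

Let b4 : 0 < b ^+ 4 <= 1.
Proof. by rewrite exprn_gt0//= exprn_ile1// ltW. Qed.

Lemma block_density_bounds : 0 < block_density <= 2^-1.
Proof.
have /andP[b40 b41] := b4.
have d1 : (1 : R) <= d%:R ^+ 2 by rewrite exprn_ege1// ler1n (leq_trans _ d3).
apply/andP; split; first by rewrite divr_gt0// mulr_gt0// exprn_gt0.
rewrite /block_density ler_pdivrMr; last by rewrite mulr_gt0// exprn_gt0.
lra.
Qed.

(** An instance of [random_block_ge], where [Psi A] is the value of [Phi] once the
    spins on [A] are revealed. *)
Lemma random_block_ent g : (forall x, 0 < mu x -> 0 <= g x) -> mean mu g = 1 ->
  block_density ^+ k.+1 * Phi mu g <=
  \sum_(S : {set V}) bern block_density S * block_ent mu S g.
Proof.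
move=> g0 g1; have /andP[t0 t1] := block_density_bounds.
pose Psi A := Phi mu (condE mu A g).
have mono A u : Psi A <= Psi (u |: A).
  have h0 x : 0 < mu x -> 0 <= condE mu (u |: A) g x by move=> _; exact: condE_ge0.
  rewrite /Psi (@eq_Phi _ _ _ mu mu_ge0 (condE mu A g)
    (condE mu A (condE mu (u |: A) g))) => [|s s0]; first exact: Phi_condE_le.
  by rewrite condE_tower// subsetUr.
have PT : Psi [set: V] = Phi mu g.
  by apply: eq_Phi => // s s0; rewrite condE_setT.
have P0 : Psi set0 = 0.
  rewrite /Psi (@eq_Phi _ _ _ mu mu_ge0 _ (fun=> 1)) => [|s s0].
    by rewrite /Phi /mean big1// => s _; rewrite ln1 !mulr0.
  by rewrite condE_set0.
have := @random_block_ge R V Psi k mono _ block_density _; rewrite PT P0 subr0; apply.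
  move=> A; apply: le_trans (Phi_local_ge mu_ge0 hSI b0 hb b1 eta0 A g0).
  rewrite ler_wpM2r ?lerN2//; apply: sumr_ge0 => u _; rewrite subr_ge0; exact: mono.
by rewrite (ltW t0)/=; lra.
Qed.

Lemma random_update_decay g : (forall x, 0 < mu x -> 0 <= g x) -> mean mu g = 1 ->
  decay_rate * Phi mu g <=
  \sum_(S : {set V}) bern block_density S * block_ent mu (isolated_vertices adj S) g.
Proof.
move=> g0 g1; have /andP[t0 t1] := block_density_bounds; have /andP[b40 b41] := b4.
have K0 : 0 < 32 / b ^+ 4 by rewrite divr_gt0.
rewrite /decay_rate mulrAC ler_pdivrMr// mulrC [leRHS]mulrC.
rewrite [leLHS]mulrC; apply: le_trans (random_block_ent g0 g1) _.
pose c j : R := 16 / (b ^+ j) ^+ 4.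
apply: (@isolated_block_le _ _ _ mu mu_ge0 adj adj_sym adj_irr hM c) => //.
- by move=> j; rewrite divr_ge0// !exprn_ge0// ltW.
- by move=> C f f0; exact: (Phi_block_le mu_ge0 b0 hb hconn b1).
- by rewrite t0/=; lra.
move=> v; pose z : R := (2 * d%:R)^-1.
have z0 : 0 <= z by rewrite invr_ge0 mulr_ge0// ltW.
have z1 : z <= 1.
  rewrite invf_le1 ?mulr_gt0//; have : (3 : R) <= d%:R by rewrite ler_nat.
  lra.
have dz : d%:R * z <= 2^-1.
  by rewrite /z invfM mulrCA divff ?mulr1// gt_eqF.
(* [z ^+ 2 = 1 / (4 d ^+ 2)] bounds the weight of one more vertex. *)
have := sum_components_le adj_sym v hd (introT andP (conj z0 z1)) dz => hz.
apply: (@le_trans _ _ (16 / b ^+ 4 *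
    \sum_(C in components_at adj v) (z ^+ 2) ^+ #|C|.-1)); last first.
  have -> : 32 / b ^+ 4 = 16 / b ^+ 4 * 2 by ring.
  by rewrite ler_wpM2l// divr_ge0// ltW.
rewrite mulr_sumr; apply: ler_sum => C /imsetP[S /[!inE] vS eC].
have : (0 < #|C|)%N by rewrite (cardsD1 v) eC component_refl.
rewrite /c; case: #|C| => // j _ /=.
have -> : (block_density / (1 - block_density)) ^+ j * (16 / (b ^+ j.+1) ^+ 4) =
    16 / b ^+ 4 * (block_density / (1 - block_density) / b ^+ 4) ^+ j.
  rewrite exprAC [_ ^+ j.+1]exprS [(_ / b ^+ 4) ^+ j]expr_div_n.
  field; rewrite !expf_neq0 ?gt_eqF//.
rewrite ler_wpM2l ?divr_ge0 ?(ltW b40)//.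
have u0 : 0 < 1 - block_density by lra.
have tu0 : 0 <= block_density / (1 - block_density) / b ^+ 4.
  exact: divr_ge0 (divr_ge0 (ltW t0) (ltW u0)) (ltW b40).
rewrite lerXn2r ?nnegrE ?sqr_ge0//.
rewrite ler_pdivrMr// ler_pdivrMr// /z exprVn.
have -> : ((2 * d%:R) ^+ 2)^-1 * b ^+ 4 = 2 * block_density.
  by rewrite /block_density; field; rewrite gt_eqF.
by nra.
Qed.

Lemma ln_inv_mu_le x : 0 < mu x -> ln (mu x)^-1 <= #|V|%:R / b.
Proof.
move=> x0; have := mu_ge_pinned mu_ge0 b0 hb [set: V] x0.
rewrite setCT pinned0 cardsT.
have -> : prob mu [set: config] = 1.
  by rewrite -[RHS]mu1; apply: eq_bigl => s; rewrite inE.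
rewrite mulr1 => bx.
have bp : 0 < b ^+ #|V| by rewrite exprn_gt0.
apply: (@le_trans _ _ (ln (b ^+ #|V|)^-1)).
  by rewrite ler_ln ?posrE ?invr_gt0// lef_pV2 ?posrE.
rewrite -exprVn lnXn ?invr_gt0// -[leLHS]mulr_natl ler_wpM2l//.
by apply/ltW/ln_sublinear; rewrite invr_gt0.
Qed.

End EntropyDecay.

Section MixingTime.
Variables (R : realType) (q : nat) (G : sgraph) (X : spin_system R q G).
Variables (b eta : R) (d k : nat) (phi : seq G).
Local Notation config := {ffun G -> 'I_q}.
Local Notation mu := (gibbs X).
Local Notation n := #|G|.
Hypotheses (b0 : 0 < b) (eta0 : 0 < eta) (d3 : (3 <= d)%N).
Hypothesis deg : max_degree G = d.
Hypothesis Z0 : 0 < partition_function X.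
Hypothesis hconn : totally_connected mu.
Hypothesis hmono : monotone_system mu.
Hypothesis hSI : spectrally_independent mu eta.
Hypothesis hb : marginally_bounded mu b.
Hypothesis phiE : perm_eq phi (enum G).
Hypothesis hk : 2 * eta / b <= k%:R.
Local Notation rho := (decay_rate b d k).

Let mu_ge0 s : 0 <= mu s. Proof. exact: gibbs_ge0. Qed.

Let mu1 : \sum_s mu s = 1. Proof. exact: sum_gibbs. Qed.

Let degree_le v : (#|[set w : G | sedge v w]| <= d)%N.
Proof. by rewrite -deg; exact: leq_bigmax. Qed.

Lemma gibbs_card_ge4 : (4 <= n)%N.
Proof.
have n0 : (0 < n)%N.
  apply/card_gt0P; case: (pickP (fun _ : G => true)) => [v _|no]; first by exists v.
  by move: d3; rewrite -deg /max_degree big_pred0.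
suff : (d <= n.-1)%N by move=> /(leq_trans d3); case: (n) n0.
rewrite -deg; apply/bigmax_leqP => v _.
rewrite -ltnS prednK// -cardsT; apply: proper_card; rewrite properE subsetT /=.
by apply/subsetPn; exists v; rewrite !inE // sedge_irrefl.
Qed.

Let mu_support := support_nonempty mu_ge0 mu1.

Let n_ge4 := gibbs_card_ge4.

Lemma marginal_bound_le1 : b <= 1.
Proof.
have /card_gt0P[v _] : (0 < n)%N by exact: leq_trans n_ge4.
have [x x0] := mu_support; have p0 := prob_pinned_gt0 mu_ge0 set0 x0.
have vN : v \notin set0 by rewrite inE.
have := prob_pinnedU1_ge mu_ge0 hb x0 vN.
move=> /le_trans/(_ (prob_sub mu_ge0 (pinned_sub x (subsetUr _ _)))).
by rewrite -{2}[prob _ _]mul1r ler_pM2r.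
Qed.

Let b_le1 := marginal_bound_le1.

Let q_gt0 : (0 < q)%N.
Proof.
have /card_gt0P[v _] : (0 < n)%N by exact: leq_trans n_ge4.
by have [x _] := mu_support; exact: leq_ltn_trans (ltn_ord (x v)).
Qed.

Let ln_n_ge : 2^-1 <= ln n%:R :> R.
Proof.
have n0 : (0 : R) < n%:R by rewrite ltr0n (leq_trans _ n_ge4).
have := @ln_le_sub1 R (n%:R^-1); rewrite invr_gt0 => /(_ n0).
rewrite lnV ?posrE// => h.
have : (n%:R : R)^-1 <= 4^-1 by rewrite lef_pV2 ?posrE// ler_nat.
lra.
Qed.

Let rho_bounds : 0 < rho <= 1.
Proof.
have /andP[t0 t1] := block_density_bounds b0 b_le1 d3.
have b40 : 0 < b ^+ 4 by rewrite exprn_gt0.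
have b41 : b ^+ 4 <= 1 by rewrite exprn_ile1// ltW.
have K0 : 0 < 32 / b ^+ 4 by rewrite divr_gt0.
rewrite /decay_rate divr_gt0 ?exprn_gt0//= ler_pdivrMr// mul1r.
apply: (@le_trans _ _ 1); first by rewrite exprn_ile1 ?(ltW t0)//; lra.
by rewrite ler_pdivlMr// mul1r; lra.
Qed.

(* After [Y / rho] steps the relative entropy of the comparison chain is at most
   [1 / (576 n ^+ 2 q ^+ 2)]: it is at most [n / b] at the start, and each step
   multiplies it by at most [1 - rho]. *)
Let Y : R := (1152 * q%:R ^+ 2 + 5) * ln n%:R / b.

Let Y_ge : ln (576 * q%:R ^+ 2 * n%:R ^+ 3 / b) <= Y.
Proof.
have q0 : (0 : R) < q%:R by rewrite ltr0n.
have n0 : (0 : R) < n%:R by rewrite ltr0n (leq_trans _ n_ge4).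
have c0 : (0 : R) < 576 by rewrite ltr0n.
have q2 : 0 < 576 * q%:R ^+ 2 := mulr_gt0 c0 (exprn_gt0 2 q0).
have n3 : (0 : R) < n%:R ^+ 3 by rewrite exprn_gt0.
have qn : 0 < 576 * q%:R ^+ 2 * n%:R ^+ 3 := mulr_gt0 q2 n3.
rewrite (ln_div qn b0) (lnM q2 n3) (lnXn 3 n0).
have := ln_sublinear q2; have bV : 0 < b^-1 by rewrite invr_gt0.
have := ln_sublinear bV; rewrite lnV ?posrE//.
have b1 : 1 <= b^-1 by rewrite invf_ge1.
rewrite /Y; move: ln_n_ge b1; set l := ln _; set B := b^-1 => l2 B1 h1 h2.
have lB : 2^-1 * B <= l * B by rewrite ler_wpM2r//; lra.
have lB' : l <= l * B by rewrite ler_peMr//; lra.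
have Q0 : (0 : R) <= q%:R ^+ 2 by rewrite sqr_ge0.
have QlB : q%:R ^+ 2 * 2^-1 <= q%:R ^+ 2 * (l * B) by rewrite ler_wpM2l//; lra.
lra.
Qed.

Let m := (Num.truncn (Y / rho)).+1.

Let Y_ge1 : 1 <= Y.
Proof.
rewrite /Y ler_pdivlMr// mul1r; apply: le_trans b_le1 _.
have : (0 : R) <= q%:R ^+ 2 by rewrite sqr_ge0.
by move: ln_n_ge; set l := ln _; set Q := _ ^+ 2; nra.
Qed.

Let YrhoP : 1 <= Y / rho.
Proof.
have /andP[r0 r1] := rho_bounds; rewrite ler_pdivlMr// mul1r.
exact: le_trans r1 Y_ge1.
Qed.

Let pow_le : (1 - rho) ^+ m <= b / (576 * q%:R ^+ 2 * n%:R ^+ 3).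
Proof.
have /andP[r0 r1] := rho_bounds.
have q0 : (0 : R) < q%:R by rewrite ltr0n.
have n0 : (0 : R) < n%:R by rewrite ltr0n (leq_trans _ n_ge4).
have W0 : 0 < 576 * q%:R ^+ 2 * n%:R ^+ 3 / b.
  have c0 : (0 : R) < 576 by rewrite ltr0n.
  exact: divr_gt0 (mulr_gt0 (mulr_gt0 c0 (exprn_gt0 2 q0)) (exprn_gt0 3 n0)) b0.
rewrite -[leRHS]invrK invf_div.
apply: (@le_trans _ _ (expR (- rho) ^+ m)).
  rewrite lerXn2r ?nnegrE ?subr_ge0 ?expR_ge0//; exact: expR_ge1Dx.
rewrite -expRM_natl mulrN expRN lef_pV2 ?posrE ?expR_gt0//.
rewrite -[leLHS]lnK ?posrE// ler_expR; apply: le_trans Y_ge _.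
have := truncn_itv (le_trans ler01 YrhoP) => /andP[_ h].
by rewrite -ler_pdivrMr// ltW.
Qed.

Lemma mixing_time_gibbs_le :
  (mixing_time (sym_scan mu phi) <= (2 * (Y / rho))%:E)%E.
Proof.
have /andP[r0 r1] := rho_bounds.
have q0 : (0 : R) < q%:R by rewrite ltr0n.
have n0 : (0 : R) < n%:R by rewrite ltr0n (leq_trans _ n_ge4).
have /andP[t0 t1] := block_density_bounds b0 b_le1 d3.
have t01 : 0 <= block_density b d <= 1 by rewrite (ltW t0)/=; lra.
have r01 : 0 <= rho <= 1 by rewrite ltW.
have [le hle hdom] := hmono.
have hm := monotone_site mu_ge0 hle hdom.
apply: (@le_trans _ _ (m%:R)%:E); last first.
  rewrite lee_fin /m -natr1.
  have /andP[h _] := truncn_itv (le_trans ler01 YrhoP).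
  by move: YrhoP; lra.
apply: mixing_time_le => // x g x0 g1.
(* [M] bounds the height.  This [e] balances the two terms of
   [convergence_bound], which are then at most [1 / 8] each. *)
pose M : R := (n * q)%:R; pose e : R := (48 * M)^-1.
have M0 : 0 < M by rewrite ltr0n muln_gt0 q_gt0 (leq_trans _ n_ge4).
have e0 : 0 < e by rewrite invr_gt0 mulr_gt0// ltr0n.
have := convergence_bound mu_ge0 mu1 hconn (gibbs_markov X) phiE t01 r01
  (random_update_decay mu_ge0 mu1 b0 b_le1 eta0 hb hSI hconn hk
     (@sedge_sym G) (@sedge_irrefl G) (gibbs_markov X) degree_le d3)
  (ln_inv_mu_le mu_ge0 mu1 b0 hb) m hle hm e0 x0 g1.
move=> /le_trans; apply; rewrite -/M.
apply: (@le_trans _ _ (3 * (M * (b / (576 * q%:R ^+ 2 * n%:R ^+ 3) * (n%:R / b) / (2 * e)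
   + 2 * e)))).
  rewrite ler_wpM2l// ler_wpM2l ?(ltW M0)// lerD2r.
  rewrite ler_wpM2r ?invr_ge0 ?mulr_ge0 ?(ltW e0)//.
  by apply: ler_wpM2r pow_le; rewrite divr_ge0// ltW.
rewrite /e /M natrM le_eqVlt; apply/orP; left; apply/eqP.
by field; rewrite !gt_eqF.
Qed.

End MixingTime.

Theorem theorem1p6 (R : realType) (q : nat) :
  exists C A : R, [/\ 0 < C, 0 < A &
    forall (b eta : R) (Delta : nat) (G : sgraph) (X : spin_system R q G),
      0 < b -> 0 < eta -> (3 <= Delta)%N ->
      max_degree G = Delta ->
      0 < partition_function X ->
      totally_connected (gibbs X) ->
      monotone_system (gibbs X) ->
      spectrally_independent (gibbs X) eta ->
      marginally_bounded (gibbs X) b ->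
      forall phi : seq G, perm_eq phi (enum G) ->
      let k : int := Num.ceil (2 * eta / b) in
      (mixing_time (sym_scan (gibbs X) phi) <=
       (Delta%:R ^ (9 + 4 * k) * (C * (eta + 1) ^+ 5 / b ^+ 6) ^ (2 + k)
        * (A * ln #|G|%:R))%:E)%E].
Proof.
(* The factor [8] absorbs the [8] of [block_density]; [64] is twice the [32] of
   [decay_rate]. *)
exists 8, (64 * (1152 * q%:R ^+ 2 + 5)).
have c1152 : (0 : R) <= 1152 by rewrite ler0n.
have c64 : (0 : R) < 64 by rewrite ltr0n.
have c8 : (0 : R) < 8 by rewrite ltr0n.
have c5 : (0 : R) < 5 by rewrite ltr0n.
have A0 : (0 : R) < 1152 * q%:R ^+ 2 + 5 := ltr_wpDl (mulr_ge0 c1152 (sqr_ge0 _)) c5.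
split; [exact: c8|exact: mulr_gt0 c64 A0|].
move=> b eta d G X b0 eta0 d3 deg Z0 hconn hmono hSI hb phi phiE.
cbv zeta; set k : int := Num.ceil _.
have [K kK] : exists K : nat, k = K.
  have : 0 <= k by rewrite /k ceil_ge0 (lt_le_trans (ltrN10 R))// divr_ge0 ?mulr_ge0 ?ltW.
  by case: (k) => // K _; exists K.
have hk : 2 * eta / b <= K%:R.
  by apply: le_trans (ceil_ge _) _; rewrite -/k kK.
apply: le_trans (mixing_time_gibbs_le b0 eta0 d3 deg Z0 hconn hmono hSI hb phiE hk) _.
have b1 := marginal_bound_le1 d3 deg Z0 hb.
have -> : 9 + 4 * k = (9 + 4 * K)%N by rewrite kK PoszD PoszM.
have -> : 2 + k = (2 + K)%N by rewrite kK PoszD.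
rewrite lee_fin -!exprnP.
set W := 1152 * _ + 5 in A0 *; set l := ln _.
have l0 : 0 <= l by rewrite ln_ge0// ler1n (leq_trans _ (gibbs_card_ge4 d3 deg)).
rewrite [64 * W * l]mulrAC [64 * l * W]mulrAC; move: W A0 => W A0.
pose D : R := d%:R; pose p := b^-1.
have D1 : 1 <= D by rewrite ler1n (leq_trans _ d3).
have p1 : 1 <= p by rewrite invf_ge1.
have D0 : 0 < D := lt_le_trans ltr01 D1.
have p0 : 0 < p := lt_le_trans ltr01 p1.
have t0 : 0 < block_density b d by have /andP[] := block_density_bounds b0 b1 d3.
have thE : 8 * D ^+ 2 * p ^+ 4 = (block_density b d)^-1.
  by rewrite /block_density /D /p; field; rewrite !gt_eqF.
have -> : 2 * (W * l / b / decay_rate b d K) =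
    (p ^+ 5 * (8 * D ^+ 2 * p ^+ 4) ^+ K.+1) * (64 * W * l).
  rewrite thE /decay_rate /p !exprVn.
  have : block_density b d ^+ K.+1 != 0 by rewrite expf_neq0 ?gt_eqF.
  by move: (_ ^+ K.+1) => T T0; field; rewrite T0 gt_eqF.
apply: (@ler_wpM2r _ (64 * W * l)).
  exact: mulr_ge0 (mulr_ge0 (ltW c64) (ltW A0)) l0.
apply: (@le_trans _ _ (D ^+ (9 + 4 * K) * (8 * p ^+ 6) ^+ (2 + K))); last first.
  apply: ler_wpM2l; first by rewrite exprn_ge0 ?(ltW D0).
  have -> : 8 * (eta + 1) ^+ 5 / b ^+ 6 = 8 * p ^+ 6 * (eta + 1) ^+ 5.
    by rewrite /p exprVn; ring.
  have e1 : 1 <= (eta + 1) ^+ 5 by rewrite exprn_ege1//; lra.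
  have p6 : 0 <= 8 * p ^+ 6 := mulr_ge0 (ltW c8) (exprn_ge0 6 (ltW p0)).
  have le : 8 * p ^+ 6 <= 8 * p ^+ 6 * (eta + 1) ^+ 5 by rewrite ler_peMr.
  by rewrite lerXn2r ?nnegrE// (le_trans p6 le).
have p46 : p ^+ 4 <= p ^+ 6 by rewrite ler_weXn2l.
have p56 : p ^+ 5 <= 8 * p ^+ 6.
  have : p ^+ 5 <= p ^+ 6 by rewrite ler_weXn2l.
  have := exprn_ge0 6 (ltW p0); lra.
have x0 : 0 <= 8 * p ^+ 4 := mulr_ge0 (ltW c8) (exprn_ge0 4 (ltW p0)).
have -> : 8 * D ^+ 2 * p ^+ 4 = D ^+ 2 * (8 * p ^+ 4) by ring.
rewrite exprMn -exprM mulrCA [(8 * p ^+ 6) ^+ (2 + K)]exprS.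
apply: ler_pM.
- exact: exprn_ge0 (ltW D0).
- exact: mulr_ge0 (exprn_ge0 5 (ltW p0)) (exprn_ge0 _ x0).
- apply: (ler_weXn2l D1).
  by rewrite mulnS; apply: leq_add => //; rewrite leq_mul2r orbT.
- apply: ler_pM p56 _; [exact: exprn_ge0 (ltW p0)|exact: exprn_ge0|].
  rewrite lerXn2r ?nnegrE ?(le_trans x0)//; first by rewrite ler_pM2l.
  by rewrite ler_pM2l.
Qed.
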